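(* 4-FREE-FLOOD-IT remains NP-hard when restricted to $3\times n$ boards.
   Context: A $k\times n$ board is a $k\times n$ grid of squares, each coloured from a colour-set; two squares are adjacent if they are horizontally or vertically adjacent. In Free-Flood-It, a move $(v,d)$ (any square $v$, any colour $d$) gives colour $d$ to every square of the monochromatic connected region containing $v$ in the current colouring. 4-FREE-FLOOD-IT is the problem of determining the minimum number of moves needed to make a given board monochromatic, when only colours from a fixed set of size $4$ are used. *)

(* Defs.v *)
From mathcomp Require Import all_boot all_order all_algebra.

Set Implicit Arguments.
Unset Strict Implicit.
Unset Printing Implicit Defensive.

(** * Deterministic multi-tape Turing machines *)

Inductive direction := MoveLeft | Stay | MoveRight.

(* Two-way infinite tapes: [left_cells] lists the cells to the left of the
   head, nearest first, [right_cells] those to its right; all the cells not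
   listed are blank. *)
Record tape (G : Type) := Tape {
  left_cells : seq G;
  head_cell : G;
  right_cells : seq G
}.

Definition move_head (G : Type) (blank : G) (d : direction) (t : tape G) :
    tape G :=
  let: Tape l x r := t in
  match d with
  | MoveLeft => Tape (behead l) (head blank l) (x :: r)
  | Stay => t
  | MoveRight => Tape (x :: l) (head blank r) (behead r)
  end.

Definition write_cell (G : Type) (x : G) (t : tape G) : tape G :=
  Tape (left_cells t) x (right_cells t).

(* There are [extra_tapes.+1] tapes: the input is on the first one ([ord0]),
   the output is read on the last one ([ord_max]). *)
Record machine := Machine {
  extra_tapes : nat;
  state : finType;
  symbol : finType;
  blank : symbol;
  start : state;
  halting : pred state;
  transition : state -> (extra_tapes.+1).-tuple symbol ->
               state * (extra_tapes.+1).-tuple (symbol * direction)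
}.

Record config (M : machine) := Config {
  current : state M;
  tapes : ((extra_tapes M).+1).-tuple (tape (symbol M))
}.

(* A halted machine stays forever in the same configuration. *)
Definition step (M : machine) (c : config M) : config M :=
  if halting (current c) then c else
  let: (q, acts) :=
    transition (current c) [tuple head_cell (tnth (tapes c) i) | i < _] in
  Config q [tuple move_head (blank M) (tnth acts i).2
                    (write_cell (tnth acts i).1 (tnth (tapes c) i)) | i < _].

Definition word_tape (G : Type) (blank : G) (w : seq G) : tape G :=
  Tape [::] (head blank w) (behead w).

Definition init (M : machine) (w : seq (symbol M)) : config M :=
  Config (start M)
    [tuple word_tape (blank M) (if i == ord0 then w else [::]) | i < _].

Arguments init : clear implicits.

(* The maximal blank-free word that starts at the head of the output tape. *)
Definition output (M : machine) (c : config M) : seq (symbol M) :=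
  let t := tnth (tapes c) ord_max in
  let s := head_cell t :: right_cells t in
  take (index (blank M) s) s.

(** * Polynomial time, NP and NP-hardness *)

(* Input and output letters are represented by non-blank tape symbols.  Since
   halted configurations are stationary, the equation on [iter] says that the
   machine halts within [p.[size w]] steps. *)
Definition polytime (A B : finType) (f : seq A -> seq B) : Prop :=
  exists (M : machine) (inp : A -> symbol M) (out : B -> symbol M)
         (p : {poly nat}),
    [/\ injective inp, forall a, inp a != blank M,
        injective out, forall b, out b != blank M
      & forall w : seq A,
          let c := iter p.[size w]%R (@step M) (init M (map inp w)) in
          halting (current c) /\ output c = map out (f w)].

Definition language (A : finType) := seq A -> Prop.

(* Polynomial-time many-one (Karp) reducibility. *)
Definition karp_reducible (A B : finType) (L : language A) (H : language B) :
    Prop :=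
  exists f : seq A -> seq B, polytime f /\ forall w, L w <-> H (f w).

(* A pair of an instance [w] and a certificate [u] is encoded as the
   concatenation of the two words, over disjoint copies of their alphabets;
   the verifier accepts by writing the one-letter word [true]. *)
Definition in_NP (A : finType) (L : language A) : Prop :=
  exists (V : seq (A + bool) -> seq bool) (p : {poly nat}),
    polytime V /\
    forall w, L w <-> exists u : seq bool,
      size u <= p.[size w]%R /\ V (map inl w ++ map inr u) = [:: true].

Definition NP_hard (B : finType) (H : language B) : Prop :=
  forall (A : finType) (L : language A), in_NP L -> karp_reducible L H.

(** * Free-Flood-It *)

Section FreeFloodIt.
Variables (C : finType) (k n : nat).

Definition square : finType := ('I_k * 'I_n)%type.

Definition board := 'M[C]_(k, n).

Definition consecutive (a b : nat) : bool := (a.+1 == b) || (b.+1 == a).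

Definition adjacent (u v : square) : bool :=
  (u.1 == v.1) && consecutive u.2 v.2 || (u.2 == v.2) && consecutive u.1 v.1.

Definition colour (b : board) (v : square) : C := b v.1 v.2.

(* [in_region b v u]: [u] is in the monochromatic connected region of [v]. *)
Definition in_region (b : board) : rel square :=
  connect [rel u v | adjacent u v && (colour b u == colour b v)].

Definition flood (b : board) (m : square * C) : board :=
  (\matrix_(i < k, j < n) if in_region b m.1 (i, j) then m.2 else b i j)%R.

Definition play (b : board) (s : seq (square * C)) : board := foldl flood b s.

Definition monochromatic (b : board) : bool :=
  [forall u, forall v, colour b u == colour b v].

Definition floodable_in (b : board) (m : nat) : bool :=
  [exists s : m.-tuple (square * C), monochromatic (play b s)].

Lemma floodable (b : board) : exists m, floodable_in b m.
Proof.
case: (pickP (@predT square)) => [v0 _|no_square]; last first.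
  exists 0; apply/existsP; exists [tuple]; apply/forallP => u.
  by have := no_square u.
set d := colour b v0; pose s := [seq (v, d) | v <- enum square].
exists (size s); apply/existsP; exists (in_tuple s).
suff play_d v : colour (play b s) v = d.
  by apply/forallP => u; apply/forallP => v; rewrite !play_d.
suff play_vs vs b' : (v \in vs) || (colour b' v == d) ->
    colour (play b' [seq (v, d) | v <- vs]) v = d.
  by apply: play_vs; rewrite mem_enum.
elim: vs b' => [b' /eqP //|u vs IHvs] b' /=.
rewrite in_cons => v_in; apply: IHvs.
rewrite /colour mxE -surjective_pairing.
case: (v \in vs) v_in => //; rewrite orbF /=.
by case/orP => [/eqP <-|bv]; [rewrite /in_region connect0 | case: ifP].
Qed.

Definition min_moves (b : board) : nat := ex_minn (floodable b).

(* The colours column by column, followed by the bound [m] in unary.  Unary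
   notation costs nothing: only the bounds [m <= k * n] are of interest, since
   recolouring the squares one by one takes [k * n] moves. *)
Definition encode (b : board) (m : nat) : seq (option C) :=
  [seq Some (b i j) | j <- enum 'I_n, i <- enum 'I_k] ++ nseq m None.

End FreeFloodIt.

(* The decision problem: given a [k] x [n] board, with [k] fixed, and a bound
   [m], is the minimum number of moves at most [m]?  The number of columns is
   determined by the word. *)
Definition free_flood_it (C : finType) (k : nat) : language (option C) :=
  fun w => exists (n : nat) (b : board C k n) (m : nat),
    [/\ 0 < n, w = encode b m & min_moves b <= m].

Arguments free_flood_it : clear implicits.

(* Main.v *)
(* A board is made of a zone between two mirrored clocks.  The bottom row of the
   zone, of colour 0, is the backbone; above it, each gadget is a word over the
   colours 0, 1, 2 on the top row, walled by colour 3 and open only on its left.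
   A potential which is 0 on the left end of the board, 2D on the right end, and
   whose differences a move decreases by at most 2, shows that D moves, D being
   the length of a clock, only suffice if each of them recolours the region of
   the backbone; the last one must give it the colour 3, and the previous ones
   form a word W of length D - 1 = 3(2n + 1) which has the word of each gadget as
   a subsequence.  The words (20)^(2n+1) and (21)^(2n+1) force W to be made of
   2n + 1 blocks 201 or 210, that is, to be a sequence of 2n + 1 bits, those at
   positions 0, 2, 4, ... giving an assignment of n variables.  A word is then
   attached to each clause so that it is a subsequence of W if and only if the
   clause is satisfied: a true literal is the only one read within a single
   block.
   Conversely, the clocks are built so that each such W crosses them.

   The clauses describe a run of the verifier as an array of cells in which
   columns are shifted instead of heads.  They are written out by a program on
   stacks, compiled to a Turing machine with one tape per stack. *)

Require Import Defs.
From mathcomp Require Import all_boot all_order all_algebra.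
From mathcomp Require Import zify.

Set Implicit Arguments.
Unset Strict Implicit.
Unset Printing Implicit Defensive.

(** * Effect of a move *)

(** The obstacle is freedom: a gadget might be prepared by moves played inside it. The potential is
    constant on the zone, so such a move gains nothing unless it touches the backbone, and a height
    of 2D for D moves requires a gain of 2 each time. Profitable moves inside a clock remain
    possible; they do not lengthen W, and only an upper bound on its length is used. Outside the
    zone, colour 3 is confined to the two end columns, where a region merges on one side only, so
    giving colour 3 before the last move gains at most 1. Consecutive letters of a gadget differ and
    the first is not 0, so that a move on the backbone absorbs at most one more letter of each
    gadget. The bits at odd positions are room: a false literal, or an absent variable, overflows
    into the next block. On the side of the machine, the rules are Horn clauses and only the
    certificate involves a choice: a model has to contain the bits of the run but may contain
    others, and no clause says that a cell holds a single symbol. Every clause lists all the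
    variables, most of them as absent, so that printing it takes counters only. *)

Section Flooding.
Variables (C : finType) (k n : nat).
Implicit Types (b : board C k n) (u v : square k n) (h : square k n -> nat).

Lemma adjacent_sym u v : adjacent u v = adjacent v u.
Proof.
by rewrite /adjacent /consecutive (eq_sym v.1) (eq_sym v.2) ![_ || (v.2.+1 == _)]orbC
           ![_ || (v.1.+1 == _)]orbC.
Qed.

Lemma in_region_sym b u v : in_region b u v = in_region b v u.
Proof.
apply: (sym_connect_sym _ u v) => {u v} u v /=; by rewrite adjacent_sym eq_sym.
Qed.

Lemma region_adjacent b v0 u v :
  adjacent u v -> colour b u = colour b v -> in_region b v0 u -> in_region b v0 v.
Proof.
move=> adj_uv col_uv reg_u; apply: connect_trans reg_u (connect1 _).
by rewrite /= adj_uv col_uv eqxx.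
Qed.

Lemma region_ind b v0 (S : square k n -> Prop) :
    (forall u v, adjacent u v -> colour b u = colour b v ->
       in_region b v0 u -> S u -> S v) ->
  S v0 -> forall v, in_region b v0 v -> S v.
Proof.
move=> closedS Sv0 v /connectP[p path_p ->] {v}.
have reg0 : in_region b v0 v0 by exact: connect0.
suff: forall u, in_region b v0 u -> S u ->
    path [rel u v | adjacent u v && (colour b u == colour b v)] u p -> S (last u p).
  exact.
elim: p {path_p} => //= v p IHp u reg_u Su /andP[/andP[adj_uv /eqP col_uv]].
by apply: IHp; [apply: region_adjacent reg_u | apply: closedS Su].
Qed.

Lemma colour_region b u v : in_region b u v -> colour b v = colour b u.
Proof. by move: v; apply: region_ind => // x y _ <-. Qed.

Lemma colour_flood b v0 d u :
  colour (flood b (v0, d)) u = if in_region b v0 u then d else colour b u.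
Proof. by case: u => i j; rewrite /colour /flood mxE. Qed.

Lemma flood_region b v0 d u :
  in_region b v0 u -> in_region (flood b (v0, d)) v0 u.
Proof.
move: u; apply: region_ind => [u v adj col_uv ru|]; last exact: connect0.
apply: region_adjacent => //; rewrite !colour_flood ru.
by rewrite (region_adjacent adj col_uv ru).
Qed.

(* A potential bounds from below the number of colour changes along any walk. *)
Definition potential b h :=
  forall u v, adjacent u v ->
    h u <= (h v).+1 /\ (colour b u = colour b v -> h u = h v).

Lemma potential_region b h u v : potential b h -> in_region b u v -> h v = h u.
Proof. by move=> pot; move: v; apply: region_ind => // x y /pot[_ eq_h] /eq_h <-. Qed.

(** The only pairs that become monochromatic join the flooded region to a square which already has
    the colour [d]; these are the heights that [g] has to identify. *)
Lemma potential_flood b h v0 d (g : nat -> nat) :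
    potential b h -> (forall x y, x <= y.+1 -> y <= x.+1 -> g x <= (g y).+1) ->
    (forall u v, adjacent u v -> in_region b v0 u -> ~~ in_region b v0 v ->
       colour b v = d -> g (h u) = g (h v)) ->
  potential (flood b (v0, d)) (g \o h).
Proof.
move=> pot g_lip merge u v adj_uv; have [h_uv eq_h] := pot _ _ adj_uv.
have [h_vu _] := pot _ _ (etrans (adjacent_sym v u) adj_uv).
split; first exact: g_lip.
rewrite !colour_flood /=; case: ifPn => ru; case: ifPn => rv.
- by rewrite !(potential_region pot ru, potential_region pot rv).
- by move=> /esym; apply: merge.
- by move=> ?; apply/esym/merge; rewrite // adjacent_sym.
by move=> /eq_h ->.
Qed.

(** The levels [c.-1], [c] and [c.+1] (0, 1 and 2 if [c = 0]) are merged and the higher ones go down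
    by 2: the most that a move on a region of height [c] can achieve. *)
Definition collapse c x := minn x (maxn c.-1 (x - 2)).

Lemma potential_collapse b h v0 d :
  potential b h -> potential (flood b (v0, d)) (collapse (h v0) \o h).
Proof.
move=> pot; apply: potential_flood => // [x y|u v adj_uv ru nrv _].
  by rewrite /collapse; lia.
rewrite (potential_region pot ru).
have [h_uv _] := pot _ _ adj_uv.
have [h_vu _] := pot _ _ (etrans (adjacent_sym v u) adj_uv).
rewrite (potential_region pot ru) in h_uv h_vu.
by rewrite /collapse; lia.
Qed.

End Flooding.

Section Rows.
Variables (C : finType) (k n : nat).
Implicit Types (b : board C k.+1 n.+1) (h : square k.+1 n.+1 -> nat).

Lemma monochromatic_potential b h u v :
  monochromatic b -> potential b h -> u.1 = v.1 -> h u = h v.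
Proof.
move=> /forallP mono pot; case: u v => i j [i' j'] /= <- {i'}.
suff h0 (l : 'I_n.+1) : h (i, l) = h (i, ord0) by rewrite !h0.
case: l => m; elim: m => [|m IHm] lt_m; first by congr h; congr pair; apply: val_inj.
rewrite -(IHm (ltnW lt_m)); apply: (pot _ _ _).2.
  by rewrite /adjacent /consecutive /= !eqxx orbT.
by apply/eqP; move/forallP: (mono (i, Ordinal lt_m)); apply.
Qed.

Lemma play_potential b h s u v :
    potential b h -> u.1 = v.1 -> h v + size s *2 < h u ->
  ~~ monochromatic (play b s).
Proof.
elim: s b h => [|[v0 d] s IHs] b h pot eq_uv lt_h /=.
  by apply/negP => mono; have := monochromatic_potential mono pot eq_uv; move: lt_h => /=; lia.
apply: (IHs _ _ (potential_collapse v0 d pot)) => //=; move: lt_h => /=.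
by rewrite /collapse; lia.
Qed.

End Rows.

(** * Lower bound on the number of moves *)

Definition c0 : 'I_4 := @Ordinal 4 0 isT.
Definition c1 : 'I_4 := @Ordinal 4 1 isT.
Definition c2 : 'I_4 := @Ordinal 4 2 isT.
Definition c3 : 'I_4 := @Ordinal 4 3 isT.

Definition column := seq 'I_4.

(* The label of a letter column is the prefix of the word up to that letter. *)
Inductive label :=
  Out of nat & column | Door | Letter of seq 'I_4 | Sep.

Definition column_of l :=
  match l with
  | Out _ c => c
  | Door => [:: c0; c0; c0]
  | Letter p => [:: last c0 p; c3; c0]
  | Sep => [:: c3; c3; c0]
  end.

Section LowerBound.
Variable D : nat.

Definition height l := if l is Out i _ then i else D.

(** The columns differ in each row, so the potential may change from one to the other. *)
Definition differ (c c' : column) :=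
  all (fun i => nth c0 c i != nth c0 c' i) (iota 0 3).

(** A letter differs from the previous one, and the first one from the backbone: otherwise one move
    would absorb two letters. *)
Definition follows l l' :=
  match l, l' with
  | Out i c, Out i' c' => (i' == i.+1) && differ c c'
  | Out i c, Door => (i.+1 == D) && differ c (column_of Door)
  | Door, Out i c => (i == D.+1) && differ (column_of Door) c
  | Door, Letter p => (size p == 1) && (last c0 p != c0)
  | Letter p, Letter p' =>
      (p' == rcons p (last c0 p')) && (last c0 p' != last c0 p)
  | Letter _, Sep => true
  | Sep, Door => true
  | _, _ => false
  end.

(** Outside the zone, colour 3 is allowed only at the extreme heights. *)
Definition wf_label l :=
  match l with
  | Out i c => (i != D) && ((c3 \in c) ==> ((i == 0) || (i == D * 2)))
  | Letter p => (p != [::]) && (last c0 p != c3)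
  | _ => true
  end.

Variables (n : nat) (ls : seq label).
Hypotheses (size_ls : size ls = n.+1) (follows_ls : sorted follows ls)
  (wf_ls : all wf_label ls).

Notation square := (square 3 n.+1).
Notation board := (board 'I_4 3 n.+1).
Implicit Types (b : board) (u v : square) (h : square -> nat) (W : seq 'I_4).

Definition lab u := nth Sep ls (u.2 : nat).
Definition zone u := if lab u is Out _ _ then false else true.
Definition back u :=
  match lab u with
  | Out _ _ => false
  | Door => true
  | _ => u.1 == 2 :> nat
  end.

Lemma follows_lab j : j < n -> follows (nth Sep ls j) (nth Sep ls j.+1).
Proof. by move=> lt_j; move/(sortedP Sep): follows_ls; apply; rewrite size_ls. Qed.

Lemma wf_lab u : wf_label (lab u).
Proof. by apply: (all_nthP Sep wf_ls); rewrite size_ls. Qed.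

Variant adjacent_spec u v : Prop :=
| AdjNext of u.1 = v.1 & follows (lab u) (lab v)
| AdjPrev of u.1 = v.1 & follows (lab v) (lab u)
| AdjVert of u.2 = v.2 & consecutive u.1 v.1.

Lemma adjacentP u v : adjacent u v -> adjacent_spec u v.
Proof.
rewrite /adjacent; case/orP => /andP[/eqP eq1].
  rewrite /consecutive => /orP[] /eqP eq2; [apply: AdjNext | apply: AdjPrev] => //.
    by rewrite /lab -eq2; apply: follows_lab; have := ltn_ord v.2; lia.
  by rewrite /lab -eq2; apply: follows_lab; have := ltn_ord u.2; lia.
by apply: AdjVert.
Qed.

Lemma lab_vert u v : u.2 = v.2 -> lab u = lab v.
Proof. by rewrite /lab => ->. Qed.

(** The zone is bounded by doors, which belong to the backbone with all their squares. *)
Lemma out_zone_back u v : adjacent u v -> ~~ zone u -> zone v -> back v.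
Proof.
case/adjacentP => [_|_|/lab_vert eq_uv _]; rewrite /zone /back.
- by case: (lab u) (lab v) => [i c||p|] [i' c'||p'|].
- by case: (lab u) (lab v) => [i c||p|] [i' c'||p'|].
by rewrite eq_uv => /negbTE ->.
Qed.

Lemma zone_height u : zone u = (height (lab u) == D).
Proof.
have := wf_lab u; rewrite /zone /height; case: (lab u) => [i c||p|] //=; rewrite ?eqxx //.
by case/andP => /negbTE ->.
Qed.

Lemma height_mono i j : i <= j -> j <= n ->
  height (nth Sep ls i) <= height (nth Sep ls j).
Proof.
move=> le_ij; rewrite -(subnKC le_ij); elim: (j - i) => [|m IHm]; first by rewrite addn0.
rewrite addnS => lt_n; apply: leq_trans (IHm (ltnW lt_n)) _.
have := follows_lab lt_n; case: (nth Sep ls (i + m)) (nth Sep ls (i + m).+1) =>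
  [i1 x||p|] [i2 x'||p'|] //=.
- by case/andP => /eqP -> _; lia.
- by case/andP => /eqP <- _; lia.
by case/andP => /eqP -> _; lia.
Qed.

(** Heights increase along the board, so the zone, a level set, is an interval of columns. *)
Lemma zone_interval u v j (lt_j : j < n.+1) (i : 'I_3) :
  zone u -> zone v -> u.2 <= j <= v.2 -> zone (i, Ordinal lt_j).
Proof.
rewrite !zone_height => /eqP zu /eqP zv /andP[le_uj le_jv].
have := height_mono le_uj (ltnSE lt_j); have := height_mono le_jv (ltnSE (ltn_ord _)).
by rewrite [height (nth _ _ u.2)]zu [height (nth _ _ v.2)]zv /lab /=; lia.
Qed.

Definition row2 : 'I_3 := @Ordinal 3 2 isT.

Lemma back_row2 u j (i := (row2, j) : square) : u.2 = j -> zone u -> back i.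
Proof. by rewrite /zone /back /lab => -> /=; case: (nth _ _ _). Qed.

Section Connected.
Variables (b : board) (d : 'I_4).
Hypothesis back_d : forall u, back u -> colour b u = d.

Lemma back_down u : back u -> in_region b u (row2, u.2).
Proof.
move=> back_u; have zu : zone u by move: back_u; rewrite /back /zone; case: (lab u).
have [e2|ne2] := eqVneq (u.1 : nat) 2.
  suff -> : (row2, u.2) = u by exact: connect0.
  by case: u e2 {back_u zu} => i j /= e2; congr pair; apply: val_inj.
have lab_u : lab u = Door.
  by move: back_u; rewrite /back; case: (lab u) => // [p|]; rewrite (negbTE ne2).
have backj (i : 'I_3) : back (i, u.2).
  by rewrite /back /lab /=; rewrite /lab in lab_u; rewrite lab_u.
have one : in_region b (@Ordinal 3 1 isT, u.2) (row2, u.2).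
  apply: (@region_adjacent _ _ _ _ _ (@Ordinal 3 1 isT, u.2)); last exact: connect0.
    by rewrite /adjacent /consecutive /= eqxx.
  by rewrite !back_d.
have [e1|ne1] := eqVneq (u.1 : nat) 1.
  suff <- : (@Ordinal 3 1 isT, u.2) = u by [].
  by case: u e1 {back_u zu ne2 lab_u backj one} => i j /= e2; congr pair; apply: val_inj.
rewrite in_region_sym; apply: (@region_adjacent _ _ _ _ _ (@Ordinal 3 1 isT, u.2)).
- have e0 : u.1 = 0 :> nat by have := ltn_ord u.1; lia.
  by rewrite /adjacent /consecutive /= eqxx e0 /= orbT.
- by rewrite !back_d.
by rewrite in_region_sym.
Qed.

Lemma back_row2_region u v : zone u -> zone v -> u.2 <= v.2 ->
  in_region b (row2, u.2) (row2, v.2).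
Proof.
move=> zu zv le_uv.
suff H m (lt_m : m < n.+1) : u.2 <= m <= v.2 -> in_region b (row2, u.2) (row2, Ordinal lt_m).
  have := H _ (ltn_ord v.2); rewrite le_uv leqnn => /(_ isT).
  by congr (in_region _ _ (_, _)); apply: val_inj.
elim: m lt_m => [|m IHm] lt_m /andP[].
  rewrite leqn0 => /eqP u0 _.
  suff <- : u.2 = Ordinal lt_m by exact: connect0.
  by apply: val_inj.
rewrite leq_eqVlt => /orP[/eqP u0 _|lt_um le_mv].
  suff <- : u.2 = Ordinal lt_m by exact: connect0.
  by apply: val_inj.
apply: (@region_adjacent _ _ _ _ _ (row2, Ordinal (ltnW lt_m))); last first.
- by apply: IHm; apply/andP; split; lia.
- have zi i (lt_i : i < n.+1) : u.2 <= i <= v.2 -> back (row2, Ordinal lt_i).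
    by move=> int_i; apply: back_row2 (zone_interval lt_i row2 zu zv int_i).
  by rewrite !back_d //; apply: zi; lia.
by rewrite /adjacent /consecutive /= !eqxx.
Qed.

Lemma back_region u v : back u -> back v -> in_region b u v.
Proof.
move=> back_u back_v.
have zb w : back w -> zone w by rewrite /back /zone; case: (lab w).
apply: connect_trans (back_down back_u) _; rewrite -/(in_region b _ _) in_region_sym.
apply: connect_trans (back_down back_v) _; rewrite -/(in_region b _ _).
case/orP: (leq_total u.2 v.2) => le_uv; last by apply: back_row2_region => //; apply: zb.
by rewrite in_region_sym; apply: back_row2_region => //; apply: zb.
Qed.

End Connected.

Definition sq_left : square := (ord0, ord0).
Definition sq_right : square := (ord0, ord_max).

Definition wall u :=
  match lab u with
  | Letter _ => u.1 == 1 :> nat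
  | Sep => u.1 != 2 :> nat
  | _ => false
  end.

(* [W] is the word of colours given so far to the region of the backbone, and
   [r] is the number of moves left. *)
Record play_inv b h W r : Prop := PlayInv {
  inv_pot : potential b h;
  inv_left : h sq_left = 0;
  inv_right : h sq_right = r * 2;
  inv_out : forall u, ~~ zone u -> colour b u = c3 -> (h u == 0) || (h u == r * 2);
  inv_zone : forall u v, zone u -> zone v -> h u = h v;
  inv_back : forall u, back u -> colour b u = last c0 W;
  inv_wall : forall u, wall u -> colour b u = c3;
  inv_letter : forall u p, lab u = Letter p -> u.1 = 0 :> nat ->
    colour b u = last c0 p \/ subseq p W;
  inv_colours : c3 \notin W
}.

Lemma last_neq3 W : c3 \notin W -> last c0 W != c3.
Proof.
case/lastP: W => [|W x] //; rewrite last_rcons mem_rcons inE negb_or eq_sym.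
by case/andP.
Qed.

Lemma zone_cases u : zone u ->
  [\/ back u, wall u | exists2 p, lab u = Letter p & u.1 = 0 :> nat].
Proof.
rewrite /zone /back /wall; case: (lab u) => [||p|] //= _.
- by constructor 1.
- have [->|n2] := eqVneq (u.1 : nat) 2; first by constructor 1.
  have [->|n1] := eqVneq (u.1 : nat) 1; first by constructor 2.
  constructor 3; exists p => //.
  by move: n1 n2; case: (u.1) => -[|[|[|m]]].
by case: eqP; [constructor 1 | constructor 2].
Qed.

Lemma back_zone u : back u -> zone u.
Proof. by rewrite /back /zone; case: (lab u). Qed.

Lemma wall_zone u : wall u -> zone u.
Proof. by rewrite /wall /zone; case: (lab u). Qed.

(** An embedding of [p] can avoid the last letter of [W], which is not the last letter of [p]; that
    letter is then free for [x]. *)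
Lemma subseq_rcons_last (p W : seq 'I_4) x :
  p != [::] -> subseq p W -> x != last c0 p -> x = last c0 W -> subseq (rcons p x) W.
Proof.
case/lastP: W => [|W y]; first by rewrite subseq0 => /negbTE ->.
rewrite last_rcons => + + + eq_xy; rewrite -{}eq_xy {y}.
case/lastP: p => [|p y] // _.
rewrite last_rcons -subseq_rev -[subseq (rcons _ _) _]subseq_rev !rev_rcons /= eqxx => + ne_x.
by rewrite eq_sym (negbTE ne_x).
Qed.

(** The proof walks from the backbone. A letter is entered from its left neighbour, whose prefix has
    already been read, or from its right neighbour, whose prefix is longer; the walls still have
    colour 3, which is not the colour of the region. *)
Lemma letter_absorbed b h W r v0 u p :
    play_inv b h W r -> back v0 -> in_region b v0 u ->
  lab u = Letter p -> u.1 = 0 :> nat -> subseq p W.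
Proof.
move=> [_ _ _ _ _ colour_back colour_wall letters colsW] back0 reg_u.
have lastW := last_neq3 colsW.
move: p; move: u reg_u; apply: region_ind => [x y adj col_xy reg_x Sx p lab_y y0|p]; last first.
  by move: back0; rewrite /back => + lab0; rewrite lab0 => /eqP ->.
have col_x : colour b x = last c0 W by rewrite (colour_region reg_x) colour_back.
have [col_y|//] := letters _ _ lab_y y0.
have last_p : last c0 p = last c0 W by rewrite -col_y -col_xy.
have := wf_lab y; rewrite lab_y /= => /andP[_ p3].
have nwall : ~~ wall x.
  by apply: contra lastW => /colour_wall <-; rewrite col_x.
case: (adjacentP adj) => [e1|e1|e2]; rewrite ?(lab_vert e2) ?lab_y; last first.
- rewrite y0 /consecutive /= => x1; case/negP: nwall.
  by rewrite /wall (lab_vert e2) lab_y; rewrite -(eqP x1).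
- case lab_x: (lab x) => [||p'|] //=; last first.
    by move=> _; move: nwall; rewrite /wall lab_x e1 y0.
  case/andP => /eqP p'E _; apply: (subseq_trans _ (Sx _ lab_x _)); last by rewrite e1.
  by rewrite p'E subseq_rcons.
case lab_x: (lab x) => [||p'|] //=.
  (* Entry from a door: the first letter [z] is not 0, the default value of [last], so [W] is not
     empty and ends with [z]. *)
  case/andP => /eqP; case: p lab_y last_p p3 {col_y} => [|z []] //= _ zW _ _ z0.
  by move: z0; rewrite zW sub1seq; case: (W) => [|w W'] //= _; apply: mem_last.
case/andP => /eqP pE ne_last; rewrite pE; apply: subseq_rcons_last => //.
- by have := wf_lab x; rewrite lab_x => /andP[].
- by apply: Sx => //; rewrite e1.
Qed.
Variant region_spec b v0 : Prop :=
| RegionBack v1 of back v1 & in_region b v0 v1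
| RegionZone of (forall u, in_region b v0 u -> zone u && ~~ back u)
| RegionOut of (forall u, in_region b v0 u -> ~~ zone u).

(** A region that avoids the backbone cannot cross the border of the zone. *)
Lemma regionP b v0 : region_spec b v0.
Proof.
case: (pickP (fun u => back u && in_region b v0 u)) => [v1 /andP[]|no_back].
  by apply: RegionBack.
have nback u : in_region b v0 u -> ~~ back u.
  by move=> reg_u; have := no_back u; rewrite reg_u andbT => ->.
have [z0|nz0] := boolP (zone v0).
  apply: RegionZone => u reg_u; rewrite nback // andbT.
  move: u reg_u; apply: region_ind => // u v adj col_uv reg_u zu; apply/negPn/negP => nzv.
  by have := out_zone_back (etrans (adjacent_sym v u) adj) nzv zu; apply/negP/nback.
apply: RegionOut; apply: region_ind => // u v adj col_uv reg_u nzu; apply/negP => zv.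
have := out_zone_back adj nzu zv; apply/negP/nback.
exact: region_adjacent reg_u.
Qed.

(** The squares next to such a region lie in the zone, where [h] is constant, so [h] itself is still
    a potential after the move. *)
Lemma zone_move_wasted b h W r v0 d :
    play_inv b h W r -> (forall u, in_region b v0 u -> zone u && ~~ back u) ->
  potential (flood b (v0, d)) h.
Proof.
move=> inv reg_zone.
apply: (@potential_flood _ _ _ _ _ _ _ id (inv_pot inv)) => // u v adj /reg_zone/andP[zu nbu] _ _.
apply: (inv_zone inv) => //; apply/negPn/negP => nzv.
by have := out_zone_back (etrans (adjacent_sym v u) adj) nzv zu; apply/negP.
Qed.

(** After the move, a potential that is 0 on the left may be at most [r.+1 * 2] on the right, since
    the [r.+1] moves left must finish. A bad move is refuted by a potential that drops by less than
    2. *)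
Lemma play_inv_step b h W r v0 d s :
    play_inv b h W r.+2 -> size s = r.+1 ->
    monochromatic (play (flood b (v0, d)) s) ->
  exists h' W', play_inv (flood b (v0, d)) h' W' r.+1 /\ size W' <= (size W).+1.
Proof.
move=> inv size_s mono; have [pot hl hr h_out h_zone col_back col_wall letters colsW] := inv.
have lastW := last_neq3 colsW.
have tight h' : potential (flood b (v0, d)) h' -> h' sq_left = 0 -> h' sq_right <= r.+1 * 2.
  move=> pot' hl'; rewrite leqNgt; apply/negP => lt_h.
  have := @play_potential _ _ _ _ h' s sq_right sq_left pot' (erefl _).
  by rewrite mono hl' size_s => /(_ lt_h).
have reg_c u : in_region b v0 u -> h u = h v0 by apply: potential_region.
have wasted3 : (forall u v, adjacent u v -> in_region b v0 u -> ~~ in_region b v0 v ->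
    colour b v = c3 -> zone v -> h u = h v) -> d != c3.
  move=> same_zone; apply/negP => /eqP d3.
  (* Squares of colour 3 outside the zone have extreme heights, so it is enough to merge the two
     lowest or the two highest levels: a drop of 1 only. *)
  pose g := if h v0 <= 1 then predn else minn (r.+2 * 2).-1.
  suff pot' : potential (flood b (v0, d)) (g \o h).
    have := tight _ pot'; rewrite /= hl hr /g; case: ifP => _ /=; lia.
  apply: potential_flood => // [x y|u v adj ru nrv]; first by rewrite /g; case: ifP => _; lia.
  rewrite d3 => col_v; have [zv|nzv] := boolP (zone v); first by rewrite (same_zone u v).
  have [h_uv _] := pot _ _ adj.
  have [h_vu _] := pot _ _ (etrans (adjacent_sym v u) adj).
  rewrite reg_c // in h_uv h_vu *.
  have := h_out _ nzv col_v; rewrite /g; case: ifP; lia.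
pose h' := collapse (h v0) \o h.
have pot' : potential (flood b (v0, d)) h' by apply: potential_collapse.
have hl' : h' sq_left = 0 by rewrite /h' /= hl /collapse; lia.
have hr' : h' sq_right = r.+1 * 2.
  by have := tight _ pot' hl'; rewrite /h' /= hr /collapse; lia.
have h_out' u : d != c3 -> ~~ zone u -> colour (flood b (v0, d)) u = c3 ->
    (h' u == 0) || (h' u == r.+1 * 2).
  move=> nd3 nzu; rewrite colour_flood; case: ifP => _ col_u; first by rewrite col_u eqxx in nd3.
  case/orP: (h_out _ nzu col_u) => /eqP hu; apply/orP; [left | right].
    by rewrite -hl' /h' /= hu hl.
  by rewrite -hr' /h' /= hu hr.
have h_zone' u v : zone u -> zone v -> h' u = h' v.
  by move=> zu zv; rewrite /h' /= (h_zone u v).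
(* A move on the backbone appends [d] to [W], a move elsewhere in the zone is wasted, and a move in
   a clock keeps [W]. *)
case: (regionP b v0) => [v1 back1 reg1|reg_zone|reg_out].
- have reg_back u : back u -> in_region b v0 u.
    by move=> back_u; apply: connect_trans reg1 (back_region col_back back1 back_u).
  have col_reg u : in_region b v0 u -> colour b u = last c0 W.
    by move=> ru; rewrite (colour_region ru) -(colour_region reg1) col_back.
  have nd3 : d != c3.
    apply: wasted3 => u v adj ru nrv _ zv; have [zu|nzu] := boolP (zone u).
      exact: h_zone.
    by case/negP: nrv; apply/reg_back/(out_zone_back adj).
  exists h', (rcons W d); rewrite size_rcons; split=> //; split=> //.
  + by move=> u; apply: h_out'.
  + by move=> u back_u; rewrite colour_flood reg_back // last_rcons.
  + move=> u wall_u; rewrite colour_flood col_wall //; case: ifP => // /col_reg.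
    by rewrite col_wall // => eq3; rewrite -eq3 eqxx in lastW.
  + move=> u p lab_u u0; rewrite colour_flood; case: ifPn => [ru|_]; last first.
      by case: (letters _ _ lab_u u0) => [->|sub]; [left | right; apply: subseq_trans (subseq_rcons _ _)].
    right; apply: subseq_trans (subseq_rcons _ _).
    apply: (letter_absorbed inv back1) lab_u u0.
    by apply: connect_trans ru; rewrite -/(in_region b _ _) in_region_sym.
  + by rewrite mem_rcons inE negb_or colsW eq_sym nd3.
- by have := tight _ (zone_move_wasted d inv reg_zone) hl; rewrite hr; lia.
have nreg u : zone u -> in_region b v0 u = false.
  by move=> zu; apply/negP => /reg_out; rewrite zu.
have nd3 : d != c3.
  apply: wasted3 => u v adj ru nrv col_v zv.
  have := col_back _ (out_zone_back adj (reg_out _ ru) zv).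
  by rewrite col_v => eq3; rewrite -eq3 eqxx in lastW.
exists h', W; split=> //; split=> //.
+ by move=> u; apply: h_out'.
+ by move=> u back_u; rewrite colour_flood nreg ?col_back ?back_zone.
+ by move=> u wall_u; rewrite colour_flood nreg ?col_wall ?wall_zone.
+ move=> u p lab_u u0; rewrite colour_flood nreg; first exact: letters.
  by rewrite /zone lab_u.
Qed.

(* The last move must absorb the walls, hence it gives the third colour to the
   backbone, and all the letters have been absorbed before. *)
Lemma play_inv_last b h W v0 d v1 w1 u p :
    play_inv b h W 1 -> monochromatic (flood b (v0, d)) -> back v1 -> wall w1 ->
  lab u = Letter p -> u.1 = 0 :> nat -> subseq p W.
Proof.
move=> inv mono back1 wall1 lab_u u0; have [pot hl hr h_out h_zone col_back col_wall letters colsW] := inv.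
have lastW := last_neq3 colsW.
have eq_col x y : colour (flood b (v0, d)) x = colour (flood b (v0, d)) y.
  by apply/eqP; move/forallP/(_ x)/forallP/(_ y): mono.
case: (regionP b v0) => [v2 back2 reg2|reg_zone|reg_out]; last 2 first.
- have := @play_potential _ _ _ _ h [::] sq_right sq_left (zone_move_wasted d inv reg_zone) (erefl _).
  by rewrite /= mono hl hr => /(_ isT).
- have := eq_col v1 w1; rewrite !colour_flood.
  have nreg x : zone x -> in_region b v0 x = false.
    by move=> zx; apply/negP => /reg_out; rewrite zx.
  rewrite (nreg _ (back_zone back1)) (nreg _ (wall_zone wall1)).
  by rewrite (col_back _ back1) (col_wall _ wall1) => eq3; rewrite eq3 eqxx in lastW.
have reg20 : in_region b v2 v0 by rewrite in_region_sym.
have [ru|nru] := boolP (in_region b v0 u).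
  by apply: (letter_absorbed inv back2) lab_u u0; apply: connect_trans ru.
have nreg_w : in_region b v0 w1 = false.
  apply/negP => rw; move: lastW; rewrite -(col_back _ back2) -(colour_region reg20).
  by rewrite -(colour_region rw) col_wall ?eqxx.
case: (letters _ _ lab_u u0) => // col_u.
have := eq_col u w1; rewrite !colour_flood (negbTE nru) nreg_w (col_wall _ wall1) col_u => p3.
by have := wf_lab u; rewrite lab_u /= p3 eqxx andbF.
Qed.

Lemma play_inv_words r b h W s v1 w1 :
    play_inv b h W r.+1 -> size s = r.+1 -> monochromatic (play b s) ->
    back v1 -> wall w1 ->
  exists W', [/\ size W' <= size W + r, c3 \notin W' &
    forall u p, lab u = Letter p -> u.1 = 0 :> nat -> subseq p W'].
Proof.
elim: r b h W s => [|r IHr] b h W [//|[v0 d] s] inv /= [size_s] mono back1 wall1.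
  exists W; split; rewrite ?addn0 ?(inv_colours inv) // => u p.
  by move: mono; rewrite (size0nil size_s) => mono; apply: (play_inv_last inv mono back1 wall1).
have [h' [W' [inv' size_W']]] := play_inv_step inv size_s mono.
have [W2 [size_W2 cols2 sub2]] := IHr _ _ _ _ inv' size_s mono back1 wall1.
by exists W2; split=> //; lia.
Qed.

Lemma follows_height l l' (i : 'I_3) :
    follows l l' -> height l <= height l' <= (height l).+1 /\
  (nth c0 (column_of l) i = nth c0 (column_of l') i -> height l = height l').
Proof.
have difP c c' : differ c c' -> nth c0 c i = nth c0 c' i -> false.
  by move=> /allP/(_ (i : nat)); rewrite mem_iota /= ltn_ord => /(_ isT)/eqP.
case: l l' => [j c||p|] [j' c'||p'|] //=; rewrite ?leqnn ?leqnSn //.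
- by case/andP => /eqP -> /difP ne; split; [rewrite leqnn leqnSn | move/ne].
- by case/andP => /eqP <- /difP ne; split; [rewrite leqnn leqnSn | move/ne].
by case/andP => /eqP -> /difP ne; split; [rewrite leqnn leqnSn | move/ne].
Qed.

Lemma play_inv_start b :
    (forall u, colour b u = nth c0 (column_of (lab u)) u.1) ->
    height (nth Sep ls 0) = 0 -> height (nth Sep ls n) = D * 2 ->
  play_inv b (fun u => height (lab u)) [::] D.
Proof.
move=> col_b first_ls last_ls; split=> //.
- move=> u v; rewrite !col_b.
  case/adjacentP => [e1|e1|e2 _]; last by rewrite (lab_vert e2).
    by rewrite e1 => /(follows_height v.1)[] ? H; split; [lia | exact: H].
  by rewrite e1 => /(follows_height v.1)[] ? H; split; [lia | move/esym/H].
- move=> u; have := wf_lab u; rewrite col_b /zone; case: (lab u) => //= i c /andP[_ /implyP out3] _ col3.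
  apply: out3; rewrite -col3 mem_nth // ltnNge; apply/negP => le_c.
  by move: col3; rewrite nth_default.
- by move=> u v; rewrite !zone_height => /eqP -> /eqP ->.
- by move=> u; rewrite col_b /back; case: (lab u) => [i c||p|] //=; [case: (u.1) => -[|[|[|]]] | move/eqP-> | move/eqP->].
- by move=> u; rewrite col_b /wall; case: (lab u) => [i c||p|] //=; [move/eqP-> | case: (u.1) => -[|[|[|]]]].
by move=> u p lab_u u0; rewrite col_b lab_u u0; left.
Qed.

Lemma floodable_words b m :
    (forall u, colour b u = nth c0 (column_of (lab u)) u.1) ->
    height (nth Sep ls 0) = 0 -> height (nth Sep ls n) = D * 2 -> 0 < D ->
    (exists v1, back v1) -> (exists w1, wall w1) ->
    m <= D -> floodable_in b m ->
  exists W, [/\ size W < D, c3 \notin W &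
    forall u p, lab u = Letter p -> u.1 = 0 :> nat -> subseq p W].
Proof.
move=> col_b first_ls last_ls D_gt0 [v1 back1] [w1 wall1] le_m /existsP[s mono].
have inv := play_inv_start col_b first_ls last_ls.
(* The potential excludes fewer than [D] moves. *)
have size_s : size s = D.
  apply/eqP; rewrite size_tuple eqn_leq le_m leqNgt; apply/negP => lt_m.
  have := @play_potential _ _ _ _ _ s sq_right sq_left (inv_pot inv) (erefl _).
  by rewrite mono (inv_left inv) (inv_right inv) size_tuple; move/(_ _)/negP; apply=> //; lia.
case: D D_gt0 size_s inv => // D' _ size_s inv.
have [W [size_W cols sub]] := play_inv_words inv size_s mono back1 wall1.
by exists W; split.
Qed.
End LowerBound.

(** * Playing always on the same square *)

Section FixedPlay.
Variables (C : finType) (k n : nat) (b : board C k n) (v0 : square k n).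
Implicit Types (w : seq C) (u v : square k n).

Definition absorbed w u := in_region (play b [seq (v0, c) | c <- w]) v0 u.

Lemma play_rcons w c :
  play b [seq (v0, x) | x <- rcons w c] =
  flood (play b [seq (v0, x) | x <- w]) (v0, c).
Proof. by rewrite map_rcons /play foldl_rcons. Qed.

Lemma absorbed_rcons w c u : absorbed w u -> absorbed (rcons w c) u.
Proof. by rewrite /absorbed play_rcons; apply: flood_region. Qed.

Lemma absorbed_cat w w' u : absorbed w u -> absorbed (w ++ w') u.
Proof.
elim/last_ind: w' => [|w' c IHw] abs_u; first by rewrite cats0.
by rewrite -rcons_cat; apply/absorbed_rcons/IHw.
Qed.

Lemma absorbed_colour w u :
  absorbed w u -> colour (play b [seq (v0, x) | x <- w]) u = last (colour b v0) w.
Proof.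
elim/last_ind: w u => [|w c _] u abs_u; first exact: colour_region abs_u.
rewrite (colour_region abs_u) play_rcons colour_flood last_rcons.
by rewrite /in_region connect0.
Qed.

(** All the moves are played on [v0], so a square changes colour only by being absorbed. *)
Lemma absorbed_or w u :
  absorbed w u \/ colour (play b [seq (v0, x) | x <- w]) u = colour b u.
Proof.
elim/last_ind: w => [|w c IHw]; first by right.
case: IHw => [abs_u|<-]; first by left; apply: absorbed_rcons.
rewrite play_rcons colour_flood; case: ifPn => abs_u; last by right.
by left; apply: (absorbed_rcons (w := w)).
Qed.

Lemma absorbed_same w u v : absorbed w u -> adjacent u v ->
  colour b v = last (colour b v0) w -> absorbed w v.
Proof.
move=> abs_u adj col_v; case: (absorbed_or w v) => // col_wv.
by apply: (region_adjacent adj) (abs_u); rewrite col_wv col_v absorbed_colour.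
Qed.

Lemma absorbed_next w u v c : absorbed w u -> adjacent u v ->
  colour b v = c -> absorbed (rcons w c) v.
Proof.
move=> abs_u adj col_v; apply: absorbed_same adj _; first exact: absorbed_rcons abs_u.
by rewrite last_rcons.
Qed.

Lemma absorbed_monochromatic w :
  (forall u, absorbed w u) -> monochromatic (play b [seq (v0, x) | x <- w]).
Proof.
move=> abs_all; apply/forallP => u; apply/forallP => v.
by rewrite !absorbed_colour.
Qed.

End FixedPlay.

(** * Crossing the clocks *)

Definition bit_word (x : bool) := if x then [:: c2; c0; c1] else [:: c2; c1; c0].
Definition bits_word (x : seq bool) := flatten (map bit_word x).

(* Crossing a block takes three moves: along the top row if 0 is played before
   1, and along the bottom row otherwise. *)
Definition clock_block : seq column :=
  [:: [:: c2; c2; c2]; [:: c0; c0; c1]; [:: c1; c1; c0]].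
(** A block that is crossed by 2, 0, 1 only, in full columns, followed by the single column of
    colour 3 of the clock. *)
Definition clock_end : seq column :=
  [:: [:: c2; c2; c2]; [:: c0; c0; c0]; [:: c1; c1; c1]; [:: c3; c3; c3]].
Definition clock nb := flatten (nseq nb clock_block) ++ clock_end.

Lemma size_clock nb : size (clock nb) = (nb * 3).+4.
Proof.
rewrite size_cat addn4; do !congr S.
by elim: nb => //= nb ->.
Qed.

Lemma nth_clock nb t s : t <= nb -> s < 3 ->
  nth [::] (clock nb) (t * 3 + s) = nth [::] (if t < nb then clock_block else clock_end) s.
Proof.
elim: nb t => [|nb IHnb] [|t] // le_t lt_s; first by move: lt_s; case: s {IHnb} => [|[|[|]]].
by rewrite mulSn -!addnA; apply: IHnb.
Qed.

Lemma nth_clock_end nb : nth [::] (clock nb) (nb * 3 + 3) = [:: c3; c3; c3].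
Proof. by elim: nb => // nb IHnb; rewrite mulSn -!addnA. Qed.

Section Clock.
Variables (n nb : nat) (b : board 'I_4 3 n) (v0 : square 3 n) (pos : nat -> 'I_n).
Variable x : seq bool.
Hypothesis size_x : size x = nb.
Hypothesis pos_consecutive : forall i, i < size (clock nb) -> consecutive (pos i) (pos i.+1).
Hypothesis pos_colour : forall i (r : 'I_3), i < size (clock nb) ->
  colour b (r, pos i.+1) = nth c0 (nth [::] (clock nb) i) r.
Hypothesis pos_start : forall r, absorbed b v0 [::] (r, pos 0).

Let row (i : nat) : 'I_3 := inord i.
Let abs := absorbed b v0.

Lemma clock_step w i (r : 'I_3) : i < size (clock nb) -> abs w (r, pos i) ->
  abs (rcons w (nth c0 (nth [::] (clock nb) i) r)) (r, pos i.+1).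
Proof.
move=> lt_i abs_i; apply: (absorbed_next abs_i); last exact: pos_colour.
by rewrite /adjacent eqxx pos_consecutive.
Qed.

(** A column of one colour is filled from any of its squares; this is where the top and the bottom
    routes through a block meet again. *)
Lemma clock_column w i c (r : 'I_3) : i < size (clock nb) ->
    nth [::] (clock nb) i = [:: c; c; c] ->
    abs (rcons w c) (r, pos i.+1) ->
  forall r', abs (rcons w c) (r', pos i.+1).
Proof.
move=> lt_i col_i abs_r.
have col r' : colour b (r', pos i.+1) = c.
  by rewrite pos_colour // col_i; case: r' => -[|[|[|]]].
have vert (r1 r2 : 'I_3) : consecutive r1 r2 -> abs (rcons w c) (r1, pos i.+1) ->
    abs (rcons w c) (r2, pos i.+1).
  move=> cons12 abs1; apply: absorbed_same abs1 _ _; last by rewrite last_rcons.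
  by rewrite /adjacent /= eqxx cons12 orbT.
pose i1 : 'I_3 := @Ordinal 3 1 isT.
have abs1 : abs (rcons w c) (i1, pos i.+1).
  case: r abs_r => -[|[|[|//]]] lt_r; [exact: vert| |exact: vert].
  by congr (abs _ (_, _)); apply: val_inj.
move=> r'; have [e1|ne1] := eqVneq (r' : nat) 1.
  by move: abs1; congr (abs _ (_, _)); apply: val_inj.
apply: vert abs1; rewrite /consecutive /=; move: ne1 (ltn_ord r').
by case: (r' : nat) => [|[|[|]]].
Qed.

Lemma clock_two t : t <= nb ->
  forall r, abs (rcons (bits_word (take t x)) c2) (r, pos (t * 3).+1).
Proof.
elim: t => [|t IHt] lt_t r.
  rewrite take0; have := @clock_step [::] 0 r; rewrite size_clock => /(_ isT (pos_start r)).
  have -> : nth [::] (clock nb) 0 = [:: c2; c2; c2] by case: (nb).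
  by case: r => -[|[|[|]]].
have sz1 : (t * 3).+1 < size (clock nb) by rewrite size_clock; lia.
have sz2 : (t * 3).+2 < size (clock nb) by rewrite size_clock; lia.
have sz3 : (t * 3).+3 < size (clock nb) by rewrite size_clock; lia.
have col1 : nth [::] (clock nb) (t * 3).+1 = nth [::] clock_block 1.
  by have := @nth_clock nb t 1 (ltnW lt_t) isT; rewrite addn1 lt_t.
have col2 : nth [::] (clock nb) (t * 3).+2 = nth [::] clock_block 2.
  by have := @nth_clock nb t 2 (ltnW lt_t) isT; rewrite addn2 lt_t.
have col3 : nth [::] (clock nb) (t * 3).+3 = [:: c2; c2; c2].
  by have := @nth_clock nb t.+1 0 lt_t isT; rewrite addn0 => ->; case: ifP.
rewrite (take_nth false) ?size_x // /bits_word map_rcons flatten_rcons.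
set w := flatten _; have {}IHt := IHt (ltnW lt_t).
have step (r' : 'I_3) c c' : nth c0 (nth [::] clock_block 1) r' = c ->
    nth c0 (nth [::] clock_block 2) r' = c' ->
    abs (rcons (rcons (rcons (rcons w c2) c) c') c2) (r', pos (t.+1 * 3).+1).
  move=> cE c'E; have := clock_step sz1 (IHt r'); rewrite col1 cE => /(clock_step sz2).
  by rewrite col2 c'E => /(clock_step sz3); rewrite col3; case: r' {cE c'E} => -[|[|[|]]].
have catE s : rcons (w ++ s) c2 = foldl rcons w (rcons s c2).
  by rewrite -cats1 -catA cats1; elim: (rcons s c2) (w) => [|y s' IHs] w' /=; rewrite ?cats0 // -IHs -cats1 -catA.
apply: (clock_column (r := if nth false x t then @Ordinal 3 0 isT else @Ordinal 3 2 isT) sz3 col3).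
by rewrite catE; case: (nth false x t) => /=; apply: step.
Qed.

(** The squares of a block that lie off the route have colour 0 or 1 and touch a column of 2s,
    entirely absorbed by then; the final 0 and 1 take them. *)
Lemma clock_absorbed i r : i <= size (clock nb) ->
  abs (bits_word x ++ [:: c2; c0; c1; c3]) (r, pos i).
Proof.
case: i => [_|i lt_i]; first exact: (absorbed_cat (bits_word x ++ [:: c2; c0; c1; c3]) (pos_start r)).
set w := bits_word x.
have two t r' : t <= nb -> abs (rcons w c2) (r', pos (t * 3).+1).
  move=> le_t; have := clock_two le_t r'.
  have -> : w = bits_word (take t x) ++ bits_word (drop t x).
    by rewrite /w -{1}(cat_take_drop t x) /bits_word map_cat flatten_cat.
  case: (drop t x) => [|y s]; first by rewrite cats0.
  have [s' ->] : exists s', bits_word (y :: s) = c2 :: s' by case: y; eexists.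
  move=> abs_t; have := absorbed_cat (rcons s' c2) abs_t.
  by rewrite cat_rcons rcons_cat.
have ext (s s' : seq 'I_4) u : abs (w ++ s) u -> abs (w ++ (s ++ s')) u.
  by rewrite catA; apply: absorbed_cat.
have {}two t r' : t <= nb -> abs (w ++ [:: c2]) (r', pos (t * 3).+1).
  by rewrite cats1; apply: two.
have nxt (s : seq 'I_4) c i1 i2 r' : abs (w ++ s) (r', pos i1) -> consecutive (pos i1) (pos i2) ->
    colour b (r', pos i2) = c -> abs (w ++ rcons s c) (r', pos i2).
  move=> abs1 cons12 col2; rewrite -rcons_cat; apply: absorbed_next abs1 _ col2.
  by rewrite /adjacent eqxx cons12.
have zero_one i1 i2 r' : abs (w ++ [:: c2]) (r', pos i1) -> consecutive (pos i1) (pos i2) ->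
    colour b (r', pos i2) \in [:: c0; c1] -> abs (w ++ [:: c2; c0; c1; c3]) (r', pos i2).
  move=> abs1 cons12; rewrite !inE => /orP[]/eqP col2.
    exact: (ext [:: c2; c0] [:: c1; c3] _ (nxt [:: c2] _ _ _ _ abs1 cons12 col2)).
  have abs2 := ext [:: c2] [:: c0] _ abs1.
  exact: (ext [:: c2; c0; c1] [:: c3] _ (nxt [:: c2; c0] _ _ _ _ abs2 cons12 col2)).
have consC i1 i2 : consecutive i1 i2 = consecutive i2 i1.
  by rewrite /consecutive orbC.
have := lt_i; rewrite size_clock => lt_i'.
have [i_end|lt_end] := eqVneq i (nb * 3 + 3).
  have lt0 : nb * 3 + 1 < size (clock nb) by rewrite size_clock; lia.
  have lt1 : nb * 3 + 2 < size (clock nb) by rewrite size_clock; lia.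
  have abs0 : abs (w ++ [:: c2; c0]) (r, pos (nb * 3 + 1).+1).
    apply: (nxt [:: c2] _ _ _ _ (two nb r (leqnn _))); first by have := pos_consecutive lt0; rewrite {1}addn1.
    by rewrite pos_colour // nth_clock // ltnn; case: (r) => -[|[|[|]]].
  have abs1 : abs (w ++ [:: c2; c0; c1]) (r, pos (nb * 3 + 2).+1).
    apply: (nxt [:: c2; c0] _ _ _ _ abs0); first by have := pos_consecutive lt1; rewrite {1}addn2 addn1.
    by rewrite pos_colour // nth_clock // ltnn; case: (r) => -[|[|[|]]].
  have := pos_consecutive lt_i; rewrite i_end addn3 -addn2 => cons_end.
  apply: (nxt [:: c2; c0; c1] _ _ _ _ abs1 cons_end).
  have := pos_colour r lt_i; rewrite i_end nth_clock_end addn3 addn2 => ->.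
  by case: (r) => -[|[|[|]]].
have [t [s [lt_s le_t iE]]] : exists t s, [/\ s < 3, t <= nb & i = t * 3 + s].
  by exists (i %/ 3), (i %% 3); split; lia.
have col_i : colour b (r, pos i.+1) = nth c0 (nth [::] (if t < nb then clock_block else clock_end) s) r.
  by rewrite pos_colour // iE nth_clock.
case: s lt_s iE col_i => [|[|[|//]]] _ iE col_i; rewrite iE.
- by rewrite addn0; apply: (ext [:: c2] [:: c0; c1; c3]); apply: two.
- apply: zero_one (two t r le_t) _ _; first by have := pos_consecutive lt_i; rewrite iE {1}addn1.
  by rewrite -iE col_i; case: ifP => _; case: (r) => -[|[|[|]]].
have [lt_t|ge_t] := ltnP t nb.
  apply: zero_one (two t.+1 r lt_t) _ _.
    rewrite consC; have /pos_consecutive : i.+1 < size (clock nb) by rewrite size_clock; lia.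
    by rewrite iE addn2.
  by rewrite -iE col_i lt_t; case: (r) => -[|[|[|]]].
have tE : t = nb by lia.
apply: (ext [:: c2; c0; c1] [:: c3]).
have lt0 : nb * 3 + 1 < size (clock nb) by rewrite size_clock; lia.
have abs0 : abs (w ++ [:: c2; c0]) (r, pos (nb * 3 + 1).+1).
  apply: (nxt [:: c2] _ _ _ _ (two nb r (leqnn _))); first by have := pos_consecutive lt0; rewrite {1}addn1.
  by rewrite pos_colour // nth_clock // ltnn; case: (r) => -[|[|[|]]].
rewrite tE; apply: (nxt [:: c2; c0] _ _ _ _ abs0).
  by have := pos_consecutive lt_i; rewrite iE tE {1}addn2 addn1.
by rewrite -tE -iE col_i tE ltnn; case: (r) => -[|[|[|]]].
Qed.

End Clock.

Section ZoneAbsorbed.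
Variables (D n : nat) (ls : seq label).
Hypotheses (size_ls : size ls = n.+1) (follows_ls : sorted (follows D) ls)
  (wf_ls : all (wf_label D) ls) (D_gt0 : 0 < D) (first_ls : height D (nth Sep ls 0) = 0).
Variables (b : board 'I_4 3 n.+1) (v0 : square 3 n.+1).
Hypothesis col_b : forall u, colour b u = nth c0 (column_of (lab ls u)) u.1.
Hypothesis back0 : back ls v0.

Lemma colour_back u : back ls u -> colour b u = c0.
Proof.
rewrite col_b /back; case: (lab ls u) => [i c||p|] //=; last 2 first.
- by move/eqP->.
- by move/eqP->.
by case: (u.1) => -[|[|[|]]].
Qed.

Lemma back_absorbed w u : back ls u -> absorbed b v0 w u.
Proof.
move=> back_u; apply: (@absorbed_cat _ _ _ _ _ [::]).
exact: (back_region size_ls follows_ls wf_ls colour_back back0 back_u).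
Qed.

Lemma subseq_rcons2 (p w : seq 'I_4) x c :
  subseq (rcons p x) (rcons w c) = if x == c then subseq p w else subseq (rcons p x) w.
Proof.
rewrite -subseq_rev !rev_rcons /=; case: eqP => _; first by rewrite subseq_rev.
by rewrite -rev_rcons subseq_rev.
Qed.

(** Reading [w] from its end, the move that matches the last letter of [p] absorbs its square, since
    the square on its left (a door, or the previous letter by induction) was absorbed before. *)
Lemma prefix_absorbed w u p :
  lab ls u = Letter p -> u.1 = 0 :> nat -> subseq p w -> absorbed b v0 w u.
Proof.
elim/last_ind: w u p => [|w c IHw] u p lab_u u0.
  rewrite subseq0 => p0; have := wf_lab size_ls wf_ls u.
  by rewrite lab_u /= p0.
case/lastP: p lab_u => [|p x] lab_u; first by have := wf_lab size_ls wf_ls u; rewrite lab_u.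
rewrite subseq_rcons2; case: eqP => [xc|_]; last by move/(IHw _ _ lab_u u0)/absorbed_rcons; apply.
move=> sub_p.
(* The first column has height 0 and a letter has height [D > 0], so there is a column on the
   left. *)
have u2_gt0 : 0 < u.2.
  rewrite lt0n; apply/eqP => u20; move: first_ls; rewrite -{1}u20 -/(lab ls u) lab_u /=.
  by move=> D0; move: D_gt0; rewrite D0.
have lt_j : u.2.-1 < n.+1 by have := ltn_ord u.2; lia.
pose u' : square 3 n.+1 := (u.1, Ordinal lt_j).
have adj : adjacent u' u by rewrite /adjacent /consecutive /= eqxx prednK // eqxx.
have col_u : colour b u = c by rewrite col_b lab_u u0 /= last_rcons.
have next_u : follows D (lab ls u') (lab ls u).
  have := @follows_lab D n ls size_ls follows_ls u.2.-1; rewrite prednK //.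
  by apply; have := ltn_ord u.2; lia.
move: next_u; rewrite lab_u; case lab_u': (lab ls u') => [i ?||q|] //.
  move=> _; apply: absorbed_next adj col_u; apply: back_absorbed.
  by rewrite /back lab_u'.
rewrite /= last_rcons => /andP[/eqP/rcons_inj[pq] _].
by apply: absorbed_next adj col_u; apply: IHw lab_u' _ _; rewrite // -pq.
Qed.

(** The final 3 takes the walls from the backbone just below them, then the top squares of the
    separators; the letters have been taken before. *)
Lemma zone_absorbed W u :
  (forall (v : square 3 n.+1) p, lab ls v = Letter p -> subseq p W) -> zone ls u ->
  absorbed b v0 (rcons W c3) u.
Proof.
move=> sub_W zu; case: (zone_cases zu) => [back_u|wall_u|[p lab_u u0]]; last 2 first.
- pose i1 : 'I_3 := @Ordinal 3 1 isT.
  have wall_col v : wall ls v -> colour b v = c3.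
    rewrite col_b /wall; case: (lab ls v) => // [p /eqP -> //|].
    by case: (v.1) => -[|[|[|]]].
  have z2 : back ls (row2, u.2) by apply: back_row2 zu.
  have abs1 : wall ls (i1, u.2) -> absorbed b v0 (rcons W c3) (i1, u.2).
    move=> wall1; apply: absorbed_next (back_absorbed W z2) _ (wall_col _ wall1).
    by rewrite /adjacent /consecutive /= eqxx.
  have [u1|nu1] := eqVneq (u.1 : nat) 1.
    have uE : u = (i1, u.2) by case: (u) u1 => i j /= ?; congr pair; apply: val_inj.
    by rewrite uE; apply: abs1; rewrite -uE.
  have lab_u : lab ls u = Sep.
    by move: wall_u; rewrite /wall; case: (lab ls u) => // p; rewrite (negbTE nu1).
  have u0 : u.1 = 0 :> nat.
    by move: wall_u nu1; rewrite /wall lab_u; case: (u.1) => -[|[|[|]]].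
  have wall1 : wall ls (i1, u.2) by rewrite /wall /lab /= -/(lab ls u) lab_u.
  apply: absorbed_same (abs1 wall1) _ _; last by rewrite last_rcons wall_col.
  by rewrite /adjacent /consecutive /= eqxx u0 orbT.
- by apply/absorbed_rcons/(prefix_absorbed lab_u u0)/(sub_W u).
exact: back_absorbed.
Qed.

End ZoneAbsorbed.

(** * The labelled board *)

Fixpoint outs i (cs : seq column) : seq label :=
  if cs is c :: cs' then Out i c :: outs i.+1 cs' else [::].

Fixpoint letters p (s : seq 'I_4) : seq label :=
  if s is x :: s' then Letter (rcons p x) :: letters (rcons p x) s' else [::].

Definition gadget_labels s := Door :: rcons (letters [::] s) Sep.
Definition zone_labels ss := rcons (flatten (map gadget_labels ss)) Door.
Definition board_labels nb ss :=
  outs 0 (rev (clock nb)) ++ zone_labels ss ++ outs (size (clock nb)).+1 (clock nb).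

Definition gadget (s : seq 'I_4) : seq column :=
  [:: c0; c0; c0] :: rcons [seq [:: x; c3; c0] | x <- s] [:: c3; c3; c0].
Definition board_columns nb ss : seq column :=
  rev (clock nb) ++ rcons (flatten (map gadget ss)) [:: c0; c0; c0] ++ clock nb.

(** What [follows] and [wf_label] demand of the letters of a gadget. *)
Definition word_ok (s : seq 'I_4) :=
  [&& s != [::], head c0 s != c0, sorted [rel x y | x != y] s & c3 \notin s].

Lemma map_outs i cs : map column_of (outs i cs) = cs.
Proof. by elim: cs i => //= c cs IHcs i; rewrite IHcs. Qed.

Lemma map_letters p s : map column_of (letters p s) = [seq [:: x; c3; c0] | x <- s].
Proof. by elim: s p => //= x s IHs p; rewrite last_rcons IHs. Qed.

Lemma map_board_labels nb ss :
  map column_of (board_labels nb ss) = board_columns nb ss.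
Proof.
rewrite !map_cat !map_outs; congr (_ ++ (_ ++ _)).
rewrite map_rcons; congr rcons; rewrite map_flatten -map_comp; congr flatten.
apply: eq_map => s /=; congr cons; rewrite map_rcons; congr rcons.
exact: map_letters.
Qed.

Lemma outs_cat i s1 s2 : outs i (s1 ++ s2) = outs i s1 ++ outs (i + size s1) s2.
Proof.
elim: s1 i => [|c s1 IHs] i /=; first by rewrite addn0.
by rewrite IHs addSnnS.
Qed.

Lemma nth_outs i cs j : j < size cs -> nth Sep (outs i cs) j = Out (i + j) (nth [::] cs j).
Proof.
elim: cs i j => [|c cs IHcs] i [|j] //= lt_j; first by rewrite addn0.
by rewrite IHcs // addSnnS.
Qed.

Lemma size_outs i cs : size (outs i cs) = size cs.
Proof. by rewrite -[in RHS](map_outs i cs) size_map. Qed.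

Section BoardLabels.
Variables (nb : nat) (ss : seq (seq 'I_4)).
Let D := size (clock nb).

Lemma differ_sym c c' : differ c c' = differ c' c.
Proof. by apply: eq_all => i; rewrite eq_sym. Qed.

Lemma path_outs i c cs : path (follows D) (Out i c) (outs i.+1 cs) = path differ c cs.
Proof. by elim: cs i c => //= c' cs IHcs i c; rewrite eqxx IHcs. Qed.

Lemma clock_differ : path differ [:: c0; c0; c0] (clock nb).
Proof.
rewrite /clock cat_path; set x := [:: c0; c0; c0].
(* A block is entered either from a door or from the last column of a block. *)
have: (x == [:: c0; c0; c0]) || (x == [:: c1; c1; c0]) by [].
by elim: nb x => [|m IHm] x /=; [case/orP => /eqP -> | case/orP => /eqP ->; apply: IHm].
Qed.

(** Isolates the column of colour 3, which goes to the heights 0 and [D * 2]. *)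
Lemma clock_rcons : exists cl, clock nb = rcons cl [:: c3; c3; c3] /\ c3 \notin flatten cl.
Proof.
exists (flatten (nseq nb clock_block) ++ take 3 clock_end); split; first by rewrite rcons_cat.
by rewrite flatten_cat mem_cat negb_or andbT; elim: nb.
Qed.

Lemma last_outs i c cs : last (Out i c) (outs i.+1 cs) = Out (i + size cs) (last c cs).
Proof. by elim: cs i c => [|c' cs IHcs] i c /=; rewrite ?addn0 // IHcs addSnnS. Qed.

Lemma path_letters p s ls : path (follows D) (Letter p) (letters p s ++ Sep :: ls) =
  path [rel x y | x != y] (last c0 p) s && path (follows D) Sep ls.
Proof.
elim: s p => //= x s IHs p.
by rewrite IHs last_rcons eqxx /= eq_sym andbA.
Qed.

Lemma path_zone l ls : all word_ok ss -> follows D l Door ->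
  path (follows D) l (zone_labels ss ++ ls) = path (follows D) Door ls.
Proof.
rewrite /zone_labels cat_rcons; elim: ss l => [|s ss' IHss] l /=; first by move=> _ ->.
case/andP => /and4P[]; case: s => //= x s _ x0 ne_s _ ok_ss ->.
rewrite x0 cat_rcons -catA cat_cons path_letters /= ne_s.
exact: IHss.
Qed.

Lemma board_labels_follows : all word_ok ss -> sorted (follows D) (board_labels nb ss).
Proof.
move=> ok_ss; have [cl [clE _]] := clock_rcons.
have size_cl : (size cl).+1 = D by rewrite /D clE size_rcons.
have := clock_differ; rewrite (eq_path (e' := fun z => differ^~ z)); last first.
  by move=> x y; rewrite differ_sym.
rewrite -rev_path clE last_rcons belast_rcons rev_cons rcons_path => /andP[path_cl last_cl].
rewrite /board_labels -/D {1}clE rev_rcons /= cat_path path_outs path_cl.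
rewrite last_outs add0n size_rev path_zone //; last by rewrite /= size_cl eqxx.
have := clock_differ; case: (clock nb) => //= c cs /andP[dif_c path_cs].
by rewrite eqxx dif_c path_outs.
Qed.

Lemma wf_outs i cs : c3 \notin flatten cs -> (i + size cs <= D) || (D < i) ->
  all (wf_label D) (outs i cs).
Proof.
elim: cs i => //= c cs IHcs i; rewrite mem_cat negb_or => /andP[/negbTE -> n3] lt_D.
by rewrite /= andbT IHcs //; lia.
Qed.

Lemma wf_letters p s : c3 \notin s -> all (wf_label D) (letters p s).
Proof.
elim: s p => //= x s IHs p; rewrite inE negb_or => /andP[x3 s3].
by rewrite last_rcons [x == _]eq_sym x3 IHs // !andbT; case: p.
Qed.

Lemma board_labels_wf : all word_ok ss -> all (wf_label D) (board_labels nb ss).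
Proof.
move=> ok_ss; have [cl [clE cl3]] := clock_rcons.
have size_cl : (size cl).+1 = D by rewrite /D clE size_rcons.
have rev3 : c3 \notin flatten (rev cl).
  apply: contra cl3 => /flattenP[c]; rewrite mem_rev => c_cl c_3.
  by apply/flattenP; exists c.
rewrite !all_cat -/D; apply/and3P; split.
- rewrite clE rev_rcons /= wf_outs //; last by rewrite size_rev add1n size_cl leqnn.
  by rewrite eq_sym -lt0n -size_cl.
- rewrite /zone_labels all_rcons /=; elim: ss ok_ss => //= s ss' IHss /andP[ok_s ok_ss].
  rewrite all_cat /= all_rcons IHss // andbT /= wf_letters //.
  by case/and4P: ok_s.
rewrite clE -cats1 outs_cat all_cat wf_outs //=; last by apply/orP; right.
have -> : D.+1 + size cl = D * 2 by rewrite addSnnS size_cl addnn muln2.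
rewrite eqxx !andbT muln2 -addnn -[X in _ != X]addn0 eqn_add2l.
by rewrite -size_cl.
Qed.

Lemma height_first : height D (nth Sep (board_labels nb ss) 0) = 0.
Proof. by have [cl [clE _]] := clock_rcons; rewrite /board_labels {1}clE rev_rcons. Qed.

Lemma height_last : height D (nth Sep (board_labels nb ss) (size (board_labels nb ss)).-1) = D * 2.
Proof.
have [cl [clE _]] := clock_rcons.
have size_cl : (size cl).+1 = D by rewrite /D clE size_rcons.
rewrite nth_last /board_labels -/D !last_cat clE -cats1 outs_cat last_cat /=.
by rewrite addSnnS size_cl addnn muln2.
Qed.

(** Since labels are prefixes, the column of the last letter of [s] is labelled by the whole of
    [s]. *)
Lemma letter_of_word s : s \in ss -> s != [::] ->
  exists l1 l2, board_labels nb ss = l1 ++ Letter s :: l2.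
Proof.
move=> s_ss s0.
have [l1 [l2 E]] : exists l1 l2, letters [::] s = l1 ++ Letter s :: l2.
  have lettersE p s1 x : letters p (rcons s1 x) = rcons (letters p s1) (Letter (p ++ rcons s1 x)).
    elim: s1 p => [|y s1 IHs] p /=; first by rewrite cats1.
    by rewrite IHs cat_rcons.
  case/lastP: s s0 {s_ss} => // s x _; rewrite lettersE -cats1.
  by exists (letters [::] s), [::].
have [ss1 [ss2 ssE]] : exists ss1 ss2, ss = ss1 ++ s :: ss2.
  by case/splitPr: s_ss => ss1 ss2; exists ss1, ss2.
rewrite /board_labels /zone_labels ssE map_cat flatten_cat /= E.
set o1 := outs 0 _; set o2 := outs _ _.
exists (o1 ++ flatten (map gadget_labels ss1) ++ Door :: l1).
eexists; rewrite -!cats1 -!catA /= -!catA /= -!catA /=; reflexivity.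
Qed.

End BoardLabels.

Lemma colour_cases (c : 'I_4) : [\/ c = c0, c = c1, c = c2 | c = c3].
Proof.
by case: c => -[|[|[|[|//]]]] lt_c; [constructor 1 | constructor 2 | constructor 3 | constructor 4];
  apply: val_inj.
Qed.

(** * Clauses as words *)

Definition alternating c m : seq 'I_4 := flatten (nseq m [:: c2; c]).

(** The 2s are common to both filtered words: each of them is followed by exactly one 0 and one 1,
    whose order is the bit. *)
Lemma bits_word_filter m W : c3 \notin W ->
    filter (predC1 c1) W = alternating c0 m ->
    filter (predC1 c0) W = alternating c1 m ->
  exists2 x, size x = m & W = bits_word x.
Proof.
elim: m W => [|m IHm] W /=.
  case: W => [|c W] /=; first by exists [::].
  by case: (colour_cases c) => ->.
have tail_word y z W' : c3 \notin y :: z :: W' ->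
    filter (predC1 c1) [:: y, z & W'] = c0 :: alternating c0 m ->
    filter (predC1 c0) [:: y, z & W'] = c1 :: alternating c1 m ->
  exists2 x, size x = m.+1 & [:: c2, y, z & W'] = bits_word x.
  rewrite !inE !negb_or => /and3P[_ _ W3].
  case: (colour_cases y) => ->; case: (colour_cases z) => -> //=.
  - by move=> []; case: (m).
  - by move=> [E0] [E1]; have [x <- ->] := IHm _ W3 E0 E1; exists (true :: x).
  - by move=> [E0] [E1]; have [x <- ->] := IHm _ W3 E0 E1; exists (false :: x).
  by move=> _ []; case: (m).
case: W => [|c W] //; case: (colour_cases c) => -> //=; rewrite inE => /norP[_ W3] [E0] [E1].
case: W W3 E0 E1 => [|y [|z W]] //; last by move=> *; apply: tail_word.
by case: (colour_cases y) => ->.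
Qed.

(** By counting: each of 0, 1 and 2 occurs at least [m] times among at most [m * 3] letters, hence
    exactly [m] times. Without its 1s, or without its 0s, [W] is then no longer than the alternating
    word that it contains. *)
Lemma alternating_words m W : size W <= m * 3 -> c3 \notin W ->
    subseq (alternating c0 m) W -> subseq (alternating c1 m) W ->
  exists2 x, size x = m & W = bits_word x.
Proof.
move=> size_W W3 sub0 sub1.
have count_alt c c' : count_mem c' (alternating c m) = m * ((c2 == c') + (c == c')).
  by rewrite /alternating; elim: m {size_W sub0 sub1} => //= m' ->; rewrite mulSn addnA.
have size_alt c : size (alternating c m) = m * 2.
  by rewrite /alternating; elim: m {size_W sub0 sub1 count_alt} => //= m' ->.
have size_sum : count_mem c0 W + count_mem c1 W + count_mem c2 W = size W.
  elim: W W3 {size_W sub0 sub1} => //= c W IHW; rewrite inE negb_or => /andP[c_3 /IHW <-].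
  by move: c_3; case: (colour_cases c) => -> //= _; rewrite ?add0n ?add1n ?addSn ?addnS.
have count0 : m <= count_mem c0 W.
  by have := leq_count_subseq (pred1 c0) sub0; rewrite count_alt muln1.
have count1 : m <= count_mem c1 W.
  by have := leq_count_subseq (pred1 c1) sub1; rewrite count_alt muln1.
have count2 : m <= count_mem c2 W.
  by have := leq_count_subseq (pred1 c2) sub0; rewrite count_alt muln1.
have all_alt c c' : c' != c2 -> c' != c -> all (predC1 c') (alternating c m).
  move=> n2 nc; rewrite /alternating; elim: m {size_W sub0 sub1 count_alt size_alt count0 count1 count2} => //= m' ->.
  by rewrite ![_ == c']eq_sym n2 nc.
have [eq0 eq1 size_W3] : [/\ count_mem c0 W = m, count_mem c1 W = m & size W = m * 3].
  by move: size_W count0 count1 count2; rewrite -size_sum; split; lia.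
have size_filter_c c : count_mem c W = m -> size (filter (predC1 c) W) = m * 2.
  move=> count_c; have := count_predC (pred1 c) W.
  rewrite count_c -size_filter size_W3 (mulnSr m 2) addnC => /addIn <-.
  by congr size; apply: eq_filter.
apply: bits_word_filter => //; apply/esym/eqP.
  have sub : subseq (alternating c0 m) (filter (predC1 c1) W) by rewrite subseq_filter sub0 all_alt.
  by rewrite -(size_subseq_leqif sub).2 size_alt size_filter_c ?eqxx.
have sub : subseq (alternating c1 m) (filter (predC1 c0) W) by rewrite subseq_filter sub1 all_alt.
by rewrite -(size_subseq_leqif sub).2 size_alt size_filter_c ?eqxx.
Qed.

(* A clause on [n] variables gives for each variable its sign in the clause, if
   any. *)
Definition clause := seq (option bool).

Definition clause_sat (x : seq bool) (c : clause) :=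
  has (fun l => l.1 == Some l.2) (zip c x).

(** A block has one 2, with a 0 somewhere after it, whatever its bit. So 2020 takes exactly two
    blocks, for an absent variable as for the end of a clause. *)
Definition literal_word (o : option bool) : seq 'I_4 :=
  if o is Some b then bit_word b else [:: c2; c0; c2; c0].

Definition clause_word (c : clause) : seq 'I_4 :=
  flatten (map literal_word c) ++ [:: c2; c0; c2; c0].

Lemma subseq_wild s b w :
  subseq [:: c2, c0, c2 & s] (bit_word b ++ w) = subseq (c2 :: s) w.
Proof. by case: b. Qed.

(** On a mismatch, the middle letter of [bit_word a] is matched by the last one of [bit_word b], and
    the third letter is left for the next block. *)
Lemma subseq_literal s a b w :
  subseq (bit_word a ++ c2 :: s) (bit_word b ++ w) =
  if a == b then subseq (c2 :: s) w
  else subseq [:: if a then c1 else c0, c2 & s] w.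
Proof. by case: a; case: b. Qed.

(** The only 2 of a block is its first letter, so after the late letter the next 2 has to come from
    the following block. *)
Lemma subseq_late s a b w :
  subseq [:: if a then c1 else c0, c2 & s] (bit_word b ++ w) = subseq (c2 :: s) w.
Proof. by case: a; case: b. Qed.

Lemma clause_word_head c : exists s, clause_word c = c2 :: s.
Proof. by case: c => [|[[]|] c]; eexists. Qed.

Lemma clause_word_cons o c : clause_word (o :: c) = literal_word o ++ clause_word c.
Proof. by rewrite /clause_word /= catA. Qed.

(** Nothing takes more than two blocks, so two per variable and two for the end are always enough.
    This concludes the reading of a clause once a block has been saved. *)
Lemma subseq_literals_late (c : clause) (x : seq bool) :
  (size c).+1 * 2 <= size x -> subseq (clause_word c) (bits_word x).
Proof.
elim: c x => [|o c IHc].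
  by case=> [|b [|b' x]] // _; rewrite /bits_word /=; case: b; case: b' => /=; rewrite ?sub0seq.
case=> [|b [|b' x]] //; rewrite [size (o :: c)]/= mulSn !ltnS => size_x.
have [s sE] := clause_word_head c.
have sub_c := IHc x size_x.
have sub_b y : subseq (clause_word c) (bit_word y ++ bits_word x).
  by apply: subseq_trans sub_c (suffix_subseq _ _).
rewrite clause_word_cons /bits_word /= -/(bits_word x); case: o => [a|] /=.
  rewrite {1}sE subseq_literal; case: ifP => _; first by rewrite -sE.
  by rewrite subseq_late -sE.
by rewrite sE !subseq_wild -sE.
Qed.

(** As long as no literal is true, the variable of index [i] is compared with the bit of index
    [i * 2]. An unpaired last bit is dropped. *)
Fixpoint evens (T : Type) (x : seq T) : seq T :=
  match x with
  | y :: _ :: x' => y :: evens x'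
  | _ => [::]
  end.

(* Reading the word of a clause takes two blocks per variable, except for a
   true literal, which takes only one: as there is one block less than needed
   when all the literals are false, some literal must be true. *)
Lemma subseq_clause_word (c : clause) (x : seq bool) :
  size x = (size c * 2).+1 ->
  subseq (clause_word c) (bits_word x) = clause_sat (evens x) c.
Proof.
elim: c x => [|o c IHc]; first by case=> [|[] [|b' x]].
case=> [|b [|b' x]] //; rewrite [size (o :: c)]/= mulSn !addSn => -[size_x].
have [s sE] := clause_word_head c.
have sub_c := IHc x size_x.
rewrite clause_word_cons /bits_word /= -/(bits_word x); case: o => [a|] /=; last first.
  by rewrite sE !subseq_wild -sE.
rewrite /clause_sat /= -/(clause_sat _ _) {1}sE subseq_literal.
case: eqP => [->|ne_ab].
  (* The saved block leaves [b' :: x], whose length is exactly two for each remaining variable and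
     two for the end. *)
  rewrite eqxx /= -sE; apply: (@subseq_literals_late c (b' :: x)).
  by rewrite /= size_x mulSn.
by rewrite subseq_late -sE sub_c; case: eqP => // -[].
Qed.

(** The bits at odd positions are free, and [true] is an arbitrary choice. *)
Definition interleave (x : seq bool) := flatten [seq [:: b; true] | b <- x].

Lemma evens_interleave x : evens (rcons (interleave x) true) = x.
Proof. by elim: x => //= b x ->. Qed.

Lemma size_interleave x : size (interleave x) = size x * 2.
Proof. by elim: x => //= b x ->. Qed.

Lemma size_evens (T : Type) m (x : seq T) : size x = (m * 2).+1 -> size (evens x) = m.
Proof. by elim: m x => [|m IHm] [|b [|b' x]] //= [/IHm ->]. Qed.

Definition cnf_words n (cnf : seq clause) :=
  alternating c0 (n * 2).+1 :: alternating c1 (n * 2).+1 :: map clause_word cnf.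

Definition satisfiable n (cnf : seq clause) :=
  exists2 x : seq bool, size x = n & all (clause_sat x) cnf.

Lemma subseq_alternating c x : c \in [:: c0; c1] ->
  subseq (alternating c (size x)) (bits_word x).
Proof.
rewrite !inE => /orP[] /eqP -> {c}; elim: x => // b x IHx;
  case: b => //=; exact: subseq_trans IHx (subseq_cons _ _).
Qed.

(** Only [n * 2] blocks of the clock leave a choice: the last of the [n * 2 + 1] bits must be
    [true], since its block is the 2, 0, 1 of the end of the clock. *)
Lemma satisfiable_words n cnf : all (fun c => size c == n) cnf -> satisfiable n cnf ->
  exists2 x, size x = n * 2 &
    all (fun s => subseq s (bits_word x ++ [:: c2; c0; c1])) (cnf_words n cnf).
Proof.
move=> size_cnf [x size_x sat_x]; exists (interleave x); first by rewrite size_interleave size_x.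
have -> : bits_word (interleave x) ++ [:: c2; c0; c1] = bits_word (rcons (interleave x) true).
  by rewrite /bits_word map_rcons flatten_rcons.
have size_y : size (rcons (interleave x) true) = (n * 2).+1.
  by rewrite size_rcons size_interleave size_x.
rewrite /= -size_y !subseq_alternating //= all_map.
apply/allP => c c_cnf /=; have /eqP size_c := allP size_cnf _ c_cnf.
by rewrite subseq_clause_word ?size_c // evens_interleave; apply: (allP sat_x).
Qed.

Lemma words_satisfiable n cnf W : all (fun c => size c == n) cnf ->
    size W <= (n * 2).+1 * 3 -> c3 \notin W ->
    all (fun s => subseq s W) (cnf_words n cnf) ->
  satisfiable n cnf.
Proof.
move=> size_cnf size_W W3 /= /and3P[sub0 sub1 sub_cnf].
have [y size_y WE] := alternating_words size_W W3 sub0 sub1.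
exists (evens y); first exact: size_evens.
apply/allP => c c_cnf; have /eqP size_c := allP size_cnf _ c_cnf.
rewrite -subseq_clause_word ?size_c // -WE.
by move: sub_cnf; rewrite all_map => /allP; apply.
Qed.

Lemma word_ok_alternating c m : c \in [:: c0; c1] -> word_ok (alternating c m.+1).
Proof.
rewrite !inE => c_in; have [n2 n3] : c2 != c /\ c3 != c by case/orP: c_in => /eqP ->.
rewrite /word_ok /= n2 /=; apply/andP; split.
  by elim: m => //= m IHm; rewrite [c == c2]eq_sym n2.
rewrite !inE !negb_or n3 /=; elim: m => //= m IHm.
by rewrite !inE !negb_or n3.
Qed.

Lemma word_ok_clause c : word_ok (clause_word c).
Proof.
have [s sE] := clause_word_head c; rewrite /word_ok sE /= -sE; apply/andP; split.
  suff: path [rel x y | x != y] c0 (clause_word c) by rewrite sE.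
  suff H x : x != c2 -> path [rel x y | x != y] x (clause_word c) by apply: H.
  elim: c x {s sE} => [|o c IHc] x x2; first by rewrite /= x2.
  by rewrite clause_word_cons; case: o => [[]|]; rewrite /= x2 /= IHc.
by elim: c {s sE} => // o c IHc; rewrite clause_word_cons mem_cat negb_or IHc andbT; case: o => [[]|].
Qed.

Lemma cnf_words_ok n cnf : all word_ok (cnf_words n cnf).
Proof.
rewrite /= !word_ok_alternating //= all_map; apply/allP => c _; exact: word_ok_clause.
Qed.

Lemma zone_labels_cons s ss :
  zone_labels (s :: ss) = (Door :: letters [::] s) ++ Sep :: zone_labels ss.
Proof. by rewrite /zone_labels /= cat_rcons rcons_cat. Qed.

Definition letter_good W l := if l is Letter p then subseq p W else true.

Lemma board_labels_good W nb ss :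
  all (fun s => subseq s W) ss -> all (letter_good W) (board_labels nb ss).
Proof.
have outs_good i cs : all (letter_good W) (outs i cs) by elim: cs i => //= c cs IHcs i.
have letters_good p s : subseq (p ++ s) W -> all (letter_good W) (letters p s).
  elim: s p => //= x s IHs p; rewrite -cat_rcons => sub; rewrite IHs // andbT.
  by apply: subseq_trans sub; apply: prefix_subseq.
move=> sub_ss; rewrite !all_cat !outs_good andbT /= all_rcons /=.
elim: ss sub_ss => //= s ss IHss /andP[sub_s /IHss]; rewrite all_cat /= all_rcons /= => ->.
by rewrite letters_good.
Qed.

Lemma zone_labels_zone ss :
  all (fun l => if l is Out _ _ then false else true) (zone_labels ss).
Proof.
rewrite all_rcons /=; elim: ss => //= s ss IHss; rewrite all_cat /= all_rcons IHss andbT /=.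
by elim: s [::] => //=.
Qed.

(** * Number of moves and satisfiability *)

Section SatisfiableBoard.
Variables (n : nat) (cnf : seq clause) (N : nat) (b : board 'I_4 3 N.+1).
Let ss := cnf_words n cnf.
Let D := size (clock (n * 2)).
Let ls := board_labels (n * 2) ss.
Hypotheses (size_cnf : all (fun c => size c == n) cnf)
  (size_b : N.+1 = size (board_columns (n * 2) ss))
  (col_b : forall i j, b i j = nth c0 (nth [::] (board_columns (n * 2) ss) j) i).

Lemma size_ls : size ls = N.+1.
Proof. by rewrite size_b -map_board_labels size_map. Qed.

Lemma colour_lab u : colour b u = nth c0 (column_of (lab ls u)) u.1.
Proof.
rewrite /colour col_b -map_board_labels (nth_map Sep) // -/ls size_ls.
exact: ltn_ord.
Qed.

Lemma size_zone_gt1 : 1 < size (zone_labels ss).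
Proof. by rewrite size_rcons. Qed.

Lemma size_N : N.+1 = D + size (zone_labels ss) + D.
Proof. by rewrite -size_ls /ls !size_cat !size_outs size_rev addnA. Qed.

Lemma min_moves_words : min_moves b <= D ->
  exists W, [/\ size W < D, c3 \notin W & all (fun s => subseq s W) ss].
Proof.
rewrite /min_moves; case: ex_minnP => m flood_m _ le_m.
have follows_ls : sorted (follows D) ls by apply/board_labels_follows/cnf_words_ok.
have wf_ls : all (wf_label D) ls by apply/board_labels_wf/cnf_words_ok.
have first_ls : height D (nth Sep ls 0) = 0 by apply: height_first.
have last_ls : height D (nth Sep ls N) = D * 2.
  by have := height_last (n * 2) ss; rewrite -/ls size_ls.
have D_gt0 : 0 < D by rewrite /D size_clock.
have index_of l l1 l2 : ls = l1 ++ l :: l2 -> exists j : 'I_N.+1, nth Sep ls j = l.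
  move=> E; have lt_j : size l1 < N.+1 by rewrite -size_ls E size_cat /=; lia.
  by exists (Ordinal lt_j); rewrite /= E nth_cat ltnn subnn.
have [jd lab_d] : exists j : 'I_N.+1, nth Sep ls j = Door.
  by apply: index_of; rewrite /ls /board_labels /zone_labels /=.
have [jw lab_w] : exists j : 'I_N.+1, nth Sep ls j = Sep.
  apply: (index_of _ (outs 0 _ ++ (Door :: letters [::] _)) (zone_labels _ ++ outs _ _)).
  by rewrite /ls /board_labels zone_labels_cons -!catA; reflexivity.
have back_d : back ls (ord0 : 'I_3, jd) by rewrite /back /lab /= lab_d.
have wall_w : wall ls (ord0 : 'I_3, jw) by rewrite /wall /lab /= lab_w.
have [W [size_W W3 sub_W]] := floodable_words size_ls follows_ls wf_ls colour_lab first_ls last_ls D_gt0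
  (ex_intro (fun v => back ls v) _ back_d) (ex_intro (fun v => wall ls v) _ wall_w) le_m flood_m.
exists W; split=> //; apply/allP => s s_ss.
have s0 : s != [::] by have /allP/(_ _ s_ss)/andP[] := cnf_words_ok n cnf.
have [l1 [l2 /index_of[j lab_j]]] := letter_of_word (n * 2) s_ss s0.
exact: (sub_W (ord0, j) s).
Qed.

(** Every move is played on one square of the first door. Since the whole backbone is in its region
    from the start, both clocks are crossed simultaneously, each from the door next to it. *)
Lemma floodable_word x : size x = n * 2 ->
  all (fun s => subseq s (bits_word x ++ [:: c2; c0; c1])) ss -> floodable_in b D.
Proof.
move=> size_x sub_ss; set W := _ ++ _ in sub_ss.
have D_gt0 : 0 < D by rewrite /D size_clock.
have Z_gt1 := size_zone_gt1; have NE := size_N; set Z := size _ in Z_gt1 NE.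
have follows_ls : sorted (follows D) ls by apply/board_labels_follows/cnf_words_ok.
have wf_ls : all (wf_label D) ls by apply/board_labels_wf/cnf_words_ok.
have first_ls : height D (nth Sep ls 0) = 0 by apply: height_first.
have door_lab i (j : 'I_N.+1) : nth Sep ls j = Door -> back ls ((i, j) : square 3 N.+1).
  by move=> lab_j; rewrite /back /lab /= lab_j.
have inordE j : j < N.+1 -> (@inord N j : nat) = j by move=> lt_j; rewrite inordK.
have nth_ls j : nth Sep ls j = if j < D then nth Sep (outs 0 (rev (clock (n * 2)))) j
    else if j - D < Z then nth Sep (zone_labels ss) (j - D)
    else nth Sep (outs D.+1 (clock (n * 2))) (j - D - Z).
  by rewrite /ls /board_labels !nth_cat size_outs size_rev.
have door_left i : back ls ((i, inord D) : square 3 N.+1).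
  apply: door_lab; rewrite inordE ?nth_ls ?ltnn ?subnn; last by lia.
  by rewrite ltnW.
have door_right i : back ls ((i, inord (D + Z).-1) : square 3 N.+1).
  apply: door_lab; rewrite inordE; last by lia.
  rewrite nth_ls; have -> : (D + Z).-1 - D = Z.-1 by lia.
  have -> : ((D + Z).-1 < D) = false by lia.
  have -> : (Z.-1 < Z) = true by lia.
  by rewrite nth_last last_rcons.
pose v0 : square 3 N.+1 := (ord0, inord D).
have abs0 := back_absorbed size_ls follows_ls wf_ls colour_lab (door_left ord0).
have consC i j : consecutive i j = consecutive j i by rewrite /consecutive orbC.
have sub_lab (v : square 3 N.+1) p : lab ls v = Letter p -> subseq p W.
  have: letter_good W (lab ls v).
    apply: all_nthP; last by rewrite size_ls.
    exact: board_labels_good.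
  by move=> + lab_v; rewrite lab_v.
have abs_all u : absorbed b v0 (rcons W c3) u.
  have WE : rcons W c3 = bits_word x ++ [:: c2; c0; c1; c3] by rewrite /W rcons_cat.
  rewrite WE; have [lt_j|ge_j] := ltnP u.2 D.
    (* The left clock is followed leftwards from the first door; the right one will be followed
       rightwards from the last door. *)
    pose pos i : 'I_N.+1 := inord (D - i).
    have -> : u = (u.1, pos (D - u.2)).
      case: u lt_j => r j /= lt_j; congr pair; apply: val_inj; rewrite /= inordE; lia.
    apply: (clock_absorbed size_x) => //.
    - move=> i; rewrite -/D => lt_i; rewrite /pos !inordE; [|by lia..].
      by rewrite /consecutive; lia.
    - move=> i r' lt_i; rewrite -/D in lt_i; rewrite colour_lab /lab /= inordE; last by lia.
      rewrite nth_ls; have -> : D - i.+1 < D by lia.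
      rewrite nth_outs ?size_rev /=; last by rewrite -/D; lia.
      by rewrite nth_rev -/D; [congr (nth _ (nth _ _ _) _); lia | lia].
    - by move=> r'; apply: abs0; rewrite /pos subn0.
    exact: leq_subr.
  have [lt_j|ge_j2] := ltnP u.2 (D + Z).
    rewrite -WE.
    apply: (zone_absorbed size_ls follows_ls wf_ls D_gt0 first_ls colour_lab (door_left ord0) sub_lab).
    rewrite /zone /lab nth_ls ltnNge ge_j /=.
    have lt_Z : u.2 - D < Z by lia.
    rewrite lt_Z; have := all_nthP Sep (zone_labels_zone ss) _ lt_Z.
    by case: (nth _ _ _).
  pose pos i : 'I_N.+1 := inord ((D + Z).-1 + i).
  have -> : u = (u.1, pos (u.2 - (D + Z).-1)).
    have := ltn_ord u.2; case: u ge_j ge_j2 => r j /= ge_j ge_j2 lt_j; congr pair; apply: val_inj; rewrite /= inordE; lia.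
  apply: (clock_absorbed size_x) => //.
  - move=> i; rewrite -/D => lt_i; rewrite /pos !inordE; [|by lia..].
    by rewrite /consecutive; lia.
  - move=> i r' lt_i; rewrite -/D in lt_i; rewrite colour_lab /lab /= inordE; last by lia.
    rewrite nth_ls; have -> : ((D + Z).-1 + i.+1 < D) = false by lia.
    have -> : ((D + Z).-1 + i.+1 - D < Z) = false by lia.
    have -> : (D + Z).-1 + i.+1 - D - Z = i by lia.
    by rewrite nth_outs.
  - by move=> r'; apply: abs0; rewrite /pos addn0.
  by have := ltn_ord u.2; rewrite -/D; lia.
pose s := [seq (v0, c) | c <- rcons W c3].
have size_s : size s = D.
  have size_bits y : size (bits_word y) = size y * 3 by elim: y => // -[] y IHy; rewrite mulSn -IHy.
  by rewrite size_map size_rcons size_cat size_bits size_x addn3 /D size_clock.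
apply/existsP; exists (tcast size_s (in_tuple s)).
by rewrite val_tcast; apply: absorbed_monochromatic.
Qed.

Theorem min_moves_satisfiable : min_moves b <= D <-> satisfiable n cnf.
Proof.
split=> [/min_moves_words[W [size_W W3 sub_W]]|/(satisfiable_words size_cnf)[x size_x sub_x]].
  by apply: (words_satisfiable size_cnf _ W3 sub_W); move: size_W; rewrite /D size_clock mulSn.
rewrite /min_moves; case: ex_minnP => m _; apply; exact: floodable_word sub_x.
Qed.

End SatisfiableBoard.

(** * Boards as words *)

Definition board_word n cnf : seq (option 'I_4) :=
  map Some (flatten (board_columns (n * 2) (cnf_words n cnf))) ++
  nseq (size (clock (n * 2))) None.

Section Encoding.
Variable N : nat.
Implicit Types b : board 'I_4 3 N.

Definition columns b : seq column :=
  [seq [seq b i j | i <- enum 'I_3] | j <- enum 'I_N].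

Lemma encodeE b m : encode b m = map Some (flatten (columns b)) ++ nseq m None.
Proof.
rewrite /encode map_flatten /columns -[in RHS]map_comp; congr (flatten _ ++ _).
by apply: eq_map => j /=; rewrite -map_comp.
Qed.

Lemma nth_columns b (i : 'I_3) (j : 'I_N) : nth c0 (nth [::] (columns b) j) i = b i j.
Proof.
rewrite (nth_map j) ?size_enum_ord // nth_ord_enum.
by rewrite (nth_map i) ?size_enum_ord // nth_ord_enum.
Qed.

Lemma size_columns b : size (columns b) = N.
Proof. by rewrite size_map size_enum_ord. Qed.

Lemma columns_size3 b : all (fun c => size c == 3) (columns b).
Proof. by apply/allP => c /mapP[j _ ->]; rewrite size_map size_enum_ord. Qed.

End Encoding.

Lemma flatten3_inj (s s' : seq column) :
  all (fun c => size c == 3) s -> all (fun c => size c == 3) s' ->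
  flatten s = flatten s' -> s = s'.
Proof.
elim: s s' => [|c s IHs] [|c' s'] //=.
- by move=> _ /andP[/eqP]; case: c'.
- by case/andP => /eqP; case: c.
case/andP => /eqP size_c s3 /andP[/eqP size_c' s'3] /eqP.
by rewrite eqseq_cat ?size_c ?size_c' // => /andP[/eqP -> /eqP/IHs ->].
Qed.

Lemma columns3 n cnf : all (fun c => size c == 3) (board_columns (n * 2) (cnf_words n cnf)).
Proof.
have clock3 m : all (fun c => size c == 3) (clock m) by rewrite all_cat andbT; elim: m.
move: (cnf_words n cnf) => ss; rewrite /board_columns all_cat all_rev clock3 all_cat clock3.
rewrite andbT all_rcons /=; elim: ss => //= s ss IHss; rewrite all_cat all_rcons IHss andbT /=.
by elim: s.
Qed.

Lemma word_inj (s s' : seq 'I_4) m m' :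
  map Some s ++ nseq m None = map Some s' ++ nseq m' None -> s = s' /\ m = m'.
Proof.
elim: s s' => [|c s IHs] [|c' s'] //=.
- by move/(congr1 size); rewrite !size_nseq.
- by case: m.
- by case: (m').
by move=> [-> /IHs[-> ->]].
Qed.

(** The language quantifies over all the boards and bounds with a given encoding; injectivity makes
    them the intended ones. *)
Lemma flood_satisfiable n cnf : all (fun c => size c == n) cnf ->
  free_flood_it 'I_4 3 (board_word n cnf) <-> satisfiable n cnf.
Proof.
move=> size_cnf; split.
  case=> -[|N] [b [m [// _ wE le_m]]]; move: wE; rewrite encodeE => /word_inj[colsE mE].
  have {colsE} colsE : columns b = board_columns (n * 2) (cnf_words n cnf).
    by apply: flatten3_inj; rewrite ?columns_size3 ?columns3.
  have size_b : N.+1 = size (board_columns (n * 2) (cnf_words n cnf)).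
    by rewrite -colsE size_columns.
  apply/(min_moves_satisfiable size_cnf size_b (b := b)); last by rewrite mE.
  by move=> i j; rewrite -colsE nth_columns.
move=> sat; have [N NE] : exists N, N.+1 = size (board_columns (n * 2) (cnf_words n cnf)).
  have : 0 < size (board_columns (n * 2) (cnf_words n cnf)).
    by rewrite !size_cat size_rcons; lia.
  by case: (size _) => // N; exists N.
pose b : board 'I_4 3 N.+1 :=
  (\matrix_(i, j) nth c0 (nth [::] (board_columns (n * 2) (cnf_words n cnf)) j) i)%R.
have colsE : columns b = board_columns (n * 2) (cnf_words n cnf).
  apply: (@eq_from_nth _ [::]); first by rewrite size_columns.
  move=> j; rewrite size_columns => lt_j; have /allP cols3 := columns3 n cnf.
  have size_j : size (nth [::] (board_columns (n * 2) (cnf_words n cnf)) j) = 3.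
    by apply/eqP/cols3/mem_nth; rewrite -NE.
  have size_bj : size (nth [::] (columns b) j) = 3.
    by apply/eqP/(allP (columns_size3 b))/mem_nth; rewrite size_columns.
  apply: (@eq_from_nth _ c0); first by rewrite size_j size_bj.
  rewrite size_bj => i lt_i.
  by rewrite (nth_columns b (Ordinal lt_i) (Ordinal lt_j)) mxE.
exists N.+1, b, (size (clock (n * 2))); split=> //; first by rewrite encodeE colsE.
by apply/(min_moves_satisfiable size_cnf NE) => // i j; rewrite mxE.
Qed.

(** * Runs of a Turing machine as arrays *)

Section Array.
Variables X : finType.

(* The atom [(o, x)] of a rule applied at the cell [q] is the bit [x] of the
   cell [q + o] if [o < 3], and of the cell [q + P + (o - 3)] otherwise: the
   rules read two windows of three cells, one below the other in an array with
   rows of length [P].  A rule is a body and a list of alternative heads. *)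
Definition atom : eqType := (nat * X)%type.
Definition rule : eqType := (seq atom * seq atom)%type.
Implicit Types (v : nat -> X -> bool) (r : rule).

Definition offset P o := if o < 3 then o else P + (o - 3).

Definition atom_holds P v q (a : atom) := v (q + offset P a.1) a.2.

Definition rule_holds P v q r :=
  all (atom_holds P v q) r.1 ==> has (atom_holds P v q) r.2.

(* [row] gives the kinds of the cells of the first row, and [ic] the positive
   clauses that a cell of a given kind must satisfy. *)
Definition array_sat (G : finType) (rules : seq rule) (ic : G -> seq (seq X))
    W (row : seq G) v :=
  (forall q, q < W -> all (rule_holds (size row) v q) rules) /\
  (forall g0 p, p < size row -> all (has (v p)) (ic (nth g0 row p))).

End Array.

Lemma all_enumP (T : finType) (U : Type) (P : pred U) (f : T -> U) (c : pred T) :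
  reflect (forall x, c x -> P (f x)) (all P [seq f x | x <- enum T & c x]).
Proof.
rewrite all_map all_filter; apply: (iffP allP) => H x; last by move=> _; apply/implyP/H.
by apply/implyP/(H x); rewrite mem_enum.
Qed.

Section CellContents.
Variables (S : Type) (blank : S) (O : nat).
Hypothesis O_gt0 : 0 < O.

(* The contents of the column [p], the head being at the column [O]. *)
Definition cell (t : tape S) p :=
  if p < O then nth blank (left_cells t) (O - p.+1)
  else nth blank (head_cell t :: right_cells t) (p - O).

(** The heads stay in place and the contents move the opposite way: when a head moves right, the
    column [p] receives what was in [p.+1]. *)
Definition source d p :=
  match d with MoveLeft => p.-1 | Stay => p | MoveRight => p.+1 end.

Lemma cell_head t : cell t O = head_cell t.
Proof. by rewrite /cell ltnn subnn. Qed.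

Lemma cell_write t x p : cell (write_cell x t) p = if p == O then x else cell t p.
Proof.
rewrite /cell /write_cell /=; case: ltngtP => // [lt_p|->]; last by rewrite subnn.
by rewrite -(subnSK lt_p).
Qed.

Lemma cell_move t d p : (d = MoveLeft -> 0 < p) -> cell (move_head blank d t) p = cell t (source d p).
Proof.
case: t => l x r; case: d => p_gt0 //=; rewrite /cell /=.
- case: p p_gt0 => [/(_ erefl)//|p _] /=; case: (ltngtP p.+1 O) => [lt_p|lt_p|p_eq].
  + by rewrite nth_behead subnSK.
  + by rewrite subSn.
  + by rewrite -p_eq !subnn /= nth0.
case: (ltngtP p.+1 O) => [lt_p|lt_p|p_eq].
- by rewrite -[O - p.+1](subnSK lt_p).
- rewrite subSn //=; case: (p - O) => [|m] /=; first by rewrite nth0.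
  by rewrite nth_behead.
by rewrite -p_eq !subnn.
Qed.

Lemma cell_word w p :
  cell (word_tape blank w) p = if p < O then blank else nth blank w (p - O).
Proof.
rewrite /cell /=; case: ifP => _; first by rewrite nth_nil.
by case: w => //=; case: (p - O) => //= m; rewrite nth_nil.
Qed.

End CellContents.

(** * Runs of the verifier *)

Section CookLevin.
Variables (A : finType) (M : machine) (inp : A + bool -> symbol M) (out : bool -> symbol M).
Hypotheses (inj_out : injective out) (out_blank : forall b, out b != blank M).
Notation tapeid := 'I_(extra_tapes M).+1.
Notation sym := (symbol M).
Notation heads := ((extra_tapes M).+1.-tuple sym).

Definition bit : finType := ('I_4 + state M + tapeid * sym + tapeid * sym)%type.

(* [b_ne]: not the last column; [b_mark]: the column to the left of the heads;
   [b_nmark]: any other column; [b_fb]: beyond the end of the certificate.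
   The columns are shifted instead of the heads. *)
Definition b_ne : bit := inl (inl (inl (@Ordinal 4 0 isT))).
Definition b_mark : bit := inl (inl (inl (@Ordinal 4 1 isT))).
Definition b_nmark : bit := inl (inl (inl (@Ordinal 4 2 isT))).
Definition b_fb : bit := inl (inl (inl (@Ordinal 4 3 isT))).
Definition b_state (s : state M) : bit := inl (inl (inr s)).
Definition b_scan (i : tapeid) (x : sym) : bit := inl (inr (i, x)).
Definition b_cell (i : tapeid) (x : sym) : bit := inr (i, x).

(** A halted machine rewrites what it reads, so that the same rules describe all the steps. *)
Definition trans (s : state M) (a : heads) :=
  if halting s then (s, [tuple (tnth a i, Stay) | i < _]) else transition s a.

Definition scanned (c : config M) : heads :=
  [tuple head_cell (tnth (tapes c) i) | i < _].

Lemma step_trans (c : config M) : let: (q, acts) := trans (current c) (scanned c) in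
  current (step c) = q /\ forall i, tnth (tapes (step c)) i =
    move_head (blank M) (tnth acts i).2 (write_cell (tnth acts i).1 (tnth (tapes c) i)).
Proof.
rewrite /trans /step -/(scanned c); case: ifP => _.
  by split=> // i; rewrite !tnth_mktuple; case: (tnth (tapes c) i).
by case: (transition _ _) => q acts; split=> // i; rewrite tnth_mktuple.
Qed.

(** The place in the next row of the contents of cell 1 of the window: the offsets 3, 4 and 5 are
    below the cells 0, 1 and 2. *)
Definition target d := match d with MoveLeft => 5 | Stay => 4 | MoveRight => 3 end.
(** The rows are laid end to end, and the contents must not be moved into a neighbouring row. *)
Definition guard d : seq (atom bit) :=
  match d with MoveLeft => [:: (1, b_ne)] | Stay => [::] | MoveRight => [:: (0, b_ne)] end.

(** The state and the scanned symbols are copied in every column of a row, so that any window can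
    read them. *)
Definition ctx (s : state M) (a : heads) : seq (atom bit) :=
  (1, b_state s) :: [seq (1, b_scan i (tnth a i)) | i <- enum tapeid].

Definition static_rule (x : bit) : rule bit := ([:: (0, x)], [:: (3, x)]).
Definition right_rule (x : bit) : rule bit := ([:: (0, b_ne); (0, x)], [:: (1, x)]).
Definition left_rule (x : bit) : rule bit := ([:: (0, b_ne); (1, x)], [:: (0, x)]).
Definition scan_rule (y : tapeid * sym) : rule bit :=
  ([:: (0, b_mark); (1, b_cell y.1 y.2)], [:: (1, b_scan y.1 y.2)]).
Definition state_rule (y : state M * heads) : rule bit :=
  (ctx y.1 y.2, [:: (4, b_state (trans y.1 y.2).1)]).
Definition write_rule (y : state M * heads * tapeid) : rule bit :=
  let act := tnth (trans y.1.1 y.1.2).2 y.2 in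
  ((0, b_mark) :: ctx y.1.1 y.1.2, [:: (target act.2, b_cell y.2 act.1)]).
Definition shift_rule (y : state M * heads * (tapeid * sym)) : rule bit :=
  let act := tnth (trans y.1.1 y.1.2).2 y.2.1 in
  ([:: (0, b_nmark), (1, b_cell y.2.1 y.2.2) & guard act.2 ++ ctx y.1.1 y.1.2],
   [:: (target act.2, b_cell y.2.1 y.2.2)]).
(** The only accepting output is one letter [true] followed by a blank; with no head, the rule
    forbids its body. *)
Definition reject_rule o (y : state M * sym) : rule bit :=
  ([:: (1, b_state y.1); (0, b_mark); (o, b_cell ord_max y.2)], [::]).

Definition rules : seq (rule bit) :=
  [:: static_rule b_ne; static_rule b_mark; static_rule b_nmark; right_rule b_fb;
      ([:: (0, b_fb)], [:: (0, b_cell ord0 (blank M))])] ++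
  [seq right_rule (b_state s) | s <- enum (state M) & true] ++
  [seq left_rule (b_state s) | s <- enum (state M) & true] ++
  [seq right_rule (b_scan y.1 y.2) | y <- enum {: tapeid * sym} & true] ++
  [seq left_rule (b_scan y.1 y.2) | y <- enum {: tapeid * sym} & true] ++
  [seq scan_rule y | y <- enum {: tapeid * sym} & true] ++
  [seq state_rule y | y <- enum {: state M * heads} & true] ++
  [seq write_rule y | y <- enum {: state M * heads * tapeid} & true] ++
  [seq shift_rule y | y <- enum {: state M * heads * (tapeid * sym)} & true] ++
  [seq reject_rule 1 y | y <- enum {: state M * sym}
    & halting y.1 && (y.2 != out true)] ++
  [seq reject_rule 2 y | y <- enum {: state M * sym}
    & halting y.1 && (y.2 != blank M)].

Definition kind : finType := (A + 'I_5)%type.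
Definition k_left : kind := inr (@Ordinal 5 0 isT).
Definition k_mark : kind := inr (@Ordinal 5 1 isT).
Definition k_cert : kind := inr (@Ordinal 5 2 isT).
Definition k_blank : kind := inr (@Ordinal 5 3 isT).
Definition k_end : kind := inr (@Ordinal 5 4 isT).

Definition cell_clause (g : kind) : seq bit :=
  match g with
  | inl a => [:: b_cell ord0 (inp (inl a))]
  | inr _ =>
    if g == k_cert then
      [:: b_cell ord0 (inp (inr true)); b_cell ord0 (inp (inr false)); b_fb]
    else [:: b_cell ord0 (blank M)]
  end.

Definition kind_clauses (g : kind) : seq (seq bit) :=
  [:: [:: b_state (start M)]; [:: (if g == k_mark then b_mark else b_nmark)];
      cell_clause g] ++
  (if g == k_end then [::] else [:: [:: b_ne]]) ++
  [seq [:: b_cell i (blank M)] | i <- enum tapeid & i != ord0].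

Lemma cell_clause_in g : cell_clause g \in kind_clauses g.
Proof. by rewrite mem_cat !in_cons eqxx !orbT. Qed.

Section Instance.
Variables (w : seq A) (C T : nat).

(** The margins of width [T] compensate for the column lost on each side at every step. The heads
    are on the column after the mark. *)
Definition first_row : seq kind :=
  nseq T k_left ++ k_mark :: map inl w ++ nseq C k_cert ++ rcons (nseq T k_blank) k_end.

Let P := size first_row.

Lemma size_first_row : P = T * 2 + size w + C + 2.
Proof.
by rewrite /P /first_row !(size_cat, size_nseq, size_rcons, size_map) /= !(size_cat, size_nseq, size_rcons, size_map); lia.
Qed.

Variable W : nat.
Hypotheses (T_gt0 : 0 < T) (W_large : T * P <= W).
Let O := T.+1.

Definition input (u : seq bool) : seq sym := map inp (map inl w ++ map inr u).
Definition conf u t := iter t (@step M) (init M (input u)).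

Lemma nth_first_row g0 p : p < P -> nth g0 first_row p =
  if p < T then k_left else if p == T then k_mark
  else if p - O < size w then nth g0 (map inl w) (p - O)
  else if p - O < size w + C then k_cert else if p == P.-1 then k_end else k_blank.
Proof.
have PE := size_first_row; rewrite /first_row => lt_p.
rewrite nth_cat size_nseq nth_nseq; case: ltngtP => // [lt_Tp|->]; last by rewrite subnn.
have -> : p - T = (p - O).+1 by rewrite /O; lia.
rewrite /= nth_cat size_map; case: ifP => // ge_w.
rewrite nth_cat size_nseq nth_nseq; have -> : (p - O - size w < C) = (p - O < size w + C) by lia.
case: (ltnP _ (size w + C)) => // ge_wC; rewrite nth_rcons size_nseq nth_nseq.
rewrite PE in lt_p *; rewrite /O in ge_wC *.
case: eqVneq => [pE|neP].
  have -> : p == (T * 2 + size w + C + 2).-1 by lia.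
  by rewrite pE ltnn.
have -> : (p == (T * 2 + size w + C + 2).-1) = false by lia.
by have -> : p - T.+1 - size w - C < T by lia.
Qed.

Lemma index_lt t p : t < T -> p < P -> t * P + p < T * P.
Proof.
move=> lt_t lt_p; apply: (@leq_trans (t.+1 * P)); first by rewrite mulSnr ltn_add2l.
by rewrite leq_mul2r lt_t orbT.
Qed.

Section Soundness.
Variable v : nat -> bit -> bool.
Hypothesis sat_v : array_sat rules kind_clauses W first_row v.

Lemma rule_fires q r : q < T * P -> r \in rules ->
  all (atom_holds P v q) r.1 -> has (atom_holds P v q) r.2.
Proof.
move=> lt_q r_in body; have := sat_v.1 q (leq_trans lt_q W_large).
by move/allP/(_ _ r_in)/implyP; apply.
Qed.

Lemma mem_enum_map (U : finType) (V : eqType) (f : U -> V) (c : pred U) x :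
  c x -> f x \in [seq f y | y <- enum U & c y].
Proof. by move=> cx; apply: map_f; rewrite mem_filter cx mem_enum. Qed.

Lemma static_fires x q : x \in [:: b_ne; b_mark; b_nmark] -> q < T * P ->
  v q x -> v (q + P) x.
Proof.
move=> x_in lt_q vx; have := @rule_fires q (static_rule x) lt_q.
rewrite /= /atom_holds /offset /= !addn0 vx orbF; apply=> //.
by rewrite !mem_cat; move: x_in; rewrite !inE => /or3P[] /eqP ->; rewrite eqxx ?orbT.
Qed.

Lemma clause_holds g0 p c : p < P -> c \in kind_clauses (nth g0 first_row p) -> has (v p) c.
Proof. by move=> lt_p; apply/allP/(sat_v.2 g0). Qed.

Lemma static_holds t p : t <= T -> p < P ->
  [/\ p < P.-1 -> v (t * P + p) b_ne, p = T -> v (t * P + p) b_mark &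
    p != T -> v (t * P + p) b_nmark].
Proof.
have PE := size_first_row; elim: t => [|t IHt] le_t lt_p.
  have nthE := nth_first_row k_end lt_p.
  rewrite add0n; split=> [lt_pP|pT|npT].
  - suff: has (v p) [:: b_ne] by rewrite /= orbF.
    apply: (@clause_holds k_end) => //.
    suff nE : (nth k_end first_row p == k_end) = false.
      by rewrite !mem_cat nE mem_head !orbT.
    rewrite nthE; case: ifP => // _; case: ifP => // _; case: ifP => [lt_w|_].
      by case: (w) lt_w => // a w' lt_w; rewrite (nth_map a).
    by case: ifP => // _; rewrite ltn_eqF.
  - suff: has (v p) [:: b_mark] by rewrite /= orbF.
    by apply: (@clause_holds k_end) => //; rewrite nthE pT ltnn eqxx !inE eqxx orbT.
  - suff: has (v p) [:: b_nmark] by rewrite /= orbF.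
    apply: (@clause_holds k_end) => //; rewrite !inE.
    suff /negbTE -> : nth k_end first_row p != k_mark by rewrite eqxx orbT.
    rewrite nthE (negbTE npT); case: ifP => // _; case: ifP => [lt_w|_].
      by case: (w) lt_w => // a w' lt_w; rewrite (nth_map a).
    by case: ifP => // _; case: ifP.
have [ne mk nm] := IHt (ltnW le_t) lt_p.
have lt_i := index_lt le_t lt_p.
by split=> [/ne|/mk|/nm] vx; rewrite mulSnr addnAC; apply: static_fires.
Qed.

Lemma broadcast x t p0 : right_rule x \in rules -> left_rule x \in rules ->
  t < T -> p0 < P -> v (t * P + p0) x -> forall p, p < P -> v (t * P + p) x.
Proof.
move=> r_in l_in lt_t lt_p0 vx0.
have next p : p.+1 < P -> v (t * P + p) x = v (t * P + p.+1) x.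
  move=> lt_p; have lt_i := index_lt lt_t (ltnW lt_p).
  have [ne _ _] := static_holds (ltnW lt_t) (ltnW lt_p).
  have {}ne : v (t * P + p) b_ne by apply: ne; lia.
  have := rule_fires lt_i r_in; have := rule_fires lt_i l_in.
  rewrite /= /atom_holds /offset /= !addn0 ne addn1 addnS !andbT !orbF.
  by move=> l r; apply/idP/idP.
have all0 p : p < P -> v (t * P + p) x = v (t * P + 0) x.
  by elim: p => // p IHp lt_p; rewrite -next // IHp // ltnW.
by move=> p lt_p; rewrite all0 // -(all0 p0).
Qed.

Lemma ctx_holds q s a : v q.+1 (b_state s) -> (forall i, v q.+1 (b_scan i (tnth a i))) ->
  all (atom_holds P v q) (ctx s a).
Proof.
move=> vs va; rewrite /= /atom_holds /offset /= addn1 vs /=.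
by rewrite all_map; apply/allP => i _; rewrite /= addn1.
Qed.

(** A cell that carries both letters may be read either way. The first cell that carries none ends
    the certificate: [b_fb] spreads to its right and forces blanks. *)
Lemma certificate : exists2 u : seq bool, size u <= C &
  forall j, j < C -> v (O + size w + j) (b_cell ord0 (nth (blank M) [seq inp (inr b) | b <- u] j)).
Proof.
have PE := size_first_row.
have fb_next p : p.+1 < P -> v p b_fb -> v p.+1 b_fb.
  move=> lt_p fb; have lt_i : p < T * P by have := index_lt T_gt0 (ltnW lt_p); rewrite add0n.
  have := @rule_fires p (right_rule b_fb) lt_i; rewrite /= /atom_holds /offset /= !addn0 fb addn1 orbF.
  apply; first by rewrite !mem_cat !inE eqxx ?orbT.
  have [ne _ _] := static_holds (leq0n T) (ltnW lt_p).
  by rewrite !andbT; apply: ne; lia.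
have fb_blank p : p < P -> v p b_fb -> v p (b_cell ord0 (blank M)).
  move=> lt_p fb; have lt_i : p < T * P by have := index_lt T_gt0 lt_p; rewrite add0n.
  have := @rule_fires p ([:: (0, b_fb)], [:: (0, b_cell ord0 (blank M))]) lt_i.
  rewrite /= /atom_holds /offset /= !addn0 fb orbF.
  by apply=> //; rewrite !mem_cat !inE eqxx ?orbT.
have cert p : O + size w <= p < O + size w + C ->
    [\/ v p (b_cell ord0 (inp (inr true))), v p (b_cell ord0 (inp (inr false))) | v p b_fb].
  case/andP => ge_p lt_p; have ltP : p < P by rewrite PE; rewrite /O in ge_p lt_p *; lia.
  suff: has (v p) [:: b_cell ord0 (inp (inr true)); b_cell ord0 (inp (inr false)); b_fb].
    by rewrite /= orbF => /or3P.
  apply: (@clause_holds k_end) => //; rewrite nth_first_row //.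
  have -> : (p < T) = false by rewrite /O in ge_p; lia.
  have -> : (p == T) = false by rewrite /O in ge_p; lia.
  have -> : (p - O < size w) = false by lia.
  have -> : (p - O < size w + C) = true by lia.
  exact: (cell_clause_in k_cert).
suff H m p : O + size w <= p -> p + m = O + size w + C -> exists2 u : seq bool, size u <= m &
    forall j, j < m -> v (p + j) (b_cell ord0 (nth (blank M) [seq inp (inr b) | b <- u] j)).
  exact: (H C (O + size w)).
elim: m p => [|m IHm] p ge_p eq_p; first by exists [::].
have [u size_u cert_u] := IHm p.+1 (leqW ge_p) (etrans (addSnnS _ _) eq_p).
have ltP : p + m.+1 <= P by rewrite PE eq_p; rewrite /O; lia.
have p_in : O + size w <= p < O + size w + C by rewrite ge_p -eq_p addnS ltnS leq_addr.
have [vt|vf|fb] := cert p p_in.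
- exists (true :: u) => // -[|j] lt_j /=; first by rewrite addn0.
  by rewrite addnS -addSn; apply: cert_u.
- exists (false :: u) => // -[|j] lt_j /=; first by rewrite addn0.
  by rewrite addnS -addSn; apply: cert_u.
exists [::] => // j lt_j; rewrite nth_nil.
have all_fb i : i < m.+1 -> v (p + i) b_fb.
  elim: i => [|i IHi] lt_i; first by rewrite addn0.
  by rewrite addnS; apply: fb_next; [lia | apply: IHi; lia].
by apply: fb_blank; [lia | apply: all_fb].
Qed.

Lemma first_row_cells u i p :
    (forall j, j < C ->
      v (O + size w + j) (b_cell ord0 (nth (blank M) [seq inp (inr b) | b <- u] j))) ->
    size u <= C -> p < P ->
  v p (b_cell i (cell (blank M) O (tnth (tapes (conf u 0)) i) p)).
Proof.
move=> cert_u size_u lt_p; have PE := size_first_row.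
have one x g : nth k_end first_row p = g -> [:: x] \in kind_clauses g -> v p x.
  by move=> <- x_in; have := clause_holds lt_p x_in; rewrite /= orbF.
rewrite tnth_mktuple cell_word; case: eqVneq => [->|ne_i0]; last first.
  rewrite nth_nil if_same; apply: (one _ _ erefl).
  by rewrite !inE !mem_cat (mem_enum_map (fun i => [:: b_cell i (blank M)])) ?orbT.
have blank_kind g : (g \in [:: k_left; k_mark; k_blank; k_end]) ->
    [:: b_cell ord0 (blank M)] \in kind_clauses g.
  rewrite !inE => /or4P[] /eqP ->; [exact: (cell_clause_in k_left) |
    exact: (cell_clause_in k_mark) | exact: (cell_clause_in k_blank) | exact: (cell_clause_in k_end)].
have nthE := nth_first_row k_end lt_p.
case: ltnP => [lt_pO|ge_pO].
  apply: (one _ _ erefl); rewrite nthE; apply: blank_kind.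
  by rewrite ltnS in lt_pO; case: ltngtP lt_pO.
rewrite nthE in one *.
have nT : (p < T) = false by rewrite /O in ge_pO; lia.
have npT : (p == T) = false by rewrite /O in ge_pO; lia.
rewrite nT npT in one; rewrite /input map_cat -!map_comp nth_cat size_map.
have [lt_w|ge_w] := ltnP (p - O) (size w).
  apply: (one _ _ erefl); rewrite lt_w; case: (w) lt_w => // a w' lt_w.
  by rewrite !(nth_map a) //; apply: (cell_clause_in (inl _)).
have [lt_C|ge_C] := ltnP (p - O) (size w + C).
  have := cert_u (p - O - size w); have -> : O + size w + (p - O - size w) = p by lia.
  by apply; lia.
rewrite nth_default; last by rewrite size_map; lia.
apply: (one _ _ erefl); rewrite !ltnNge ge_w ge_C /=; apply: blank_kind.
by case: ifP.
Qed.

(** A shift brings unknown contents in at the ends, so the interval around the heads on which the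
    array is known shrinks by one column on each side per step. *)
Lemma conf_cells u : (forall i p, p < P ->
      v p (b_cell i (cell (blank M) O (tnth (tapes (conf u 0)) i) p))) ->
  forall t, t < T -> (forall p, p < P -> v (t * P + p) (b_state (current (conf u t)))) /\
  (forall i p, O - (T - t) <= p <= O + (T - t) ->
    v (t * P + p) (b_cell i (cell (blank M) O (tnth (tapes (conf u t)) i) p))).
Proof.
move=> cells0; have PE := size_first_row.
have lt_OP : O < P by rewrite /O PE; lia.
elim=> [|t IHt] lt_t.
  split=> [p lt_p|i p /andP[_ le_p]]; last by apply: cells0; rewrite PE; rewrite /O in le_p; lia.
  suff: has (v p) [:: b_state (start M)] by rewrite /= orbF.
  by apply: (@clause_holds k_end) => //; rewrite !inE eqxx.
have [state_t cells_t] := IHt (ltnW lt_t).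
have lt_tT := ltnW lt_t.
have state_in s : right_rule (b_state s) \in rules /\ left_rule (b_state s) \in rules.
  by split; rewrite !mem_cat (mem_enum_map (fun s => _ (b_state s))) ?orbT.
have scan_in i x : [/\ right_rule (b_scan i x) \in rules, left_rule (b_scan i x) \in rules
    & scan_rule (i, x) \in rules].
  split; rewrite !mem_cat.
  - by rewrite (mem_enum_map (fun y : tapeid * sym => right_rule (b_scan y.1 y.2)) (x := (i, x))) ?orbT.
  - by rewrite (mem_enum_map (fun y : tapeid * sym => left_rule (b_scan y.1 y.2)) (x := (i, x))) ?orbT.
  - by rewrite (mem_enum_map scan_rule) ?orbT.
set c := conf u t in state_t cells_t *.
have scan_t i p : p < P -> v (t * P + p) (b_scan i (tnth (scanned c) i)).
  have [r_in l_in s_in] := scan_in i (tnth (scanned c) i).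
  apply: (broadcast r_in l_in lt_tT lt_OP).
  have lt_TP : T < P by apply: ltnW.
  have lt_i := index_lt lt_tT lt_TP.
  have := rule_fires lt_i s_in; rewrite /= /atom_holds /offset /= !addn0 addn1 orbF -addnS.
  apply; rewrite andbT; have [_ mk _] := static_holds (ltnW lt_tT) lt_TP.
  rewrite mk //= tnth_mktuple -(cell_head (blank M) O); apply: cells_t.
  by rewrite leq_subr leq_addr.
have ctx_t p : p.+1 < P -> all (atom_holds P v (t * P + p)) (ctx (current c) (scanned c)).
  by move=> lt_p; apply: ctx_holds; rewrite -addnS; [apply: state_t | move=> i; apply: scan_t].
have := step_trans c; case transE: (trans _ _) => [q acts] [cur_next tapes_next].
have nextE : conf u t.+1 = step c by [].
split.
  have [r_in l_in] := state_in q.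
  rewrite nextE cur_next; apply: (broadcast r_in l_in lt_t lt_OP).
  have lt_i := index_lt lt_tT (ltnW lt_OP : T < P).
  have r_s : state_rule (current c, scanned c) \in rules.
    by rewrite !mem_cat (mem_enum_map state_rule) ?orbT.
  have := rule_fires lt_i r_s (ctx_t T lt_OP).
  by rewrite /= transE /atom_holds /offset /= orbF addn1 addnS mulSnr addnAC addnS.
move=> i p p_in; have p_gt0 : 0 < p by move: p_in; rewrite /O; lia.
rewrite nextE tapes_next cell_move //; set act := tnth acts i.
rewrite cell_write.
have target_i d : 1 < p -> t * P + (source d p).-1 + offset P (target d) = t.+1 * P + p.
  by rewrite mulSnr /offset; case: d => /=; lia.
have guard_i d : 1 < p -> p < P.-1 -> all (atom_holds P v (t * P + (source d p).-1)) (guard d).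
  move=> p_gt1 lt_pP; case: d => //=; rewrite andbT /atom_holds /offset /=.
    have lt1 : p.-1 < P by lia.
    have [ne _ _] := static_holds (ltnW lt_tT) lt1.
    have -> : t * P + p.-1.-1 + 1 = t * P + p.-1 by lia.
    by apply: ne; lia.
  rewrite addn0; have lt1 : p < P by lia.
  by have [ne _ _] := static_holds (ltnW lt_tT) lt1; apply: ne.
have [p_gt1 lt_pP] : 1 < p /\ p < P.-1 by move: p_in; rewrite /O PE; lia.
have src_gt0 : 0 < source act.2 p by case: (act.2) => /=; lia.
have lt_src : source act.2 p < P by case: (act.2) => /=; lia.
have lt_src1 : (source act.2 p).-1 < P by lia.
have lt_i := index_lt lt_tT lt_src1.
have [_ mk nm] := static_holds (ltnW lt_tT) lt_src1.
have srcS : (source act.2 p).-1.+1 = source act.2 p by rewrite prednK.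
case: eqVneq => [src_O|src_nO].
  have r_w : write_rule (current c, scanned c, i) \in rules.
    by rewrite !mem_cat (mem_enum_map write_rule) ?orbT.
  have := rule_fires lt_i r_w; rewrite /write_rule [(_, _).1.1]/= [(_, _).1.2]/= transE -/act.
  rewrite [has _ _]/= orbF /atom_holds [(_, _).1]/= [(_, _).2]/= target_i //; apply.
  apply/andP; split; last by apply: ctx_t; rewrite srcS.
  by rewrite /atom_holds /offset /= addn0; apply: mk; rewrite src_O.
have r_w : shift_rule (current c, scanned c, (i, cell (blank M) O (tnth (tapes c) i) (source act.2 p))) \in rules.
  by rewrite !mem_cat (mem_enum_map shift_rule) ?orbT.
have := rule_fires lt_i r_w; rewrite /shift_rule [(_, _).1.1]/= [(_, _).1.2]/= [(_, _).2.1]/= transE -/act.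
rewrite [has _ _]/= orbF /atom_holds [(_, _).1]/= [(_, _).2]/= target_i //; apply.
rewrite -!cat_cons all_cat; apply/andP; split; last by apply: ctx_t; rewrite srcS.
rewrite -cat1s -[X in _ ++ X]cat1s catA all_cat; apply/andP; split; last exact: guard_i.
rewrite /= andbT; apply/andP; split.
- by rewrite /offset /= addn0; apply: nm; apply: contraNneq src_nO => srcT; rewrite -srcS srcT.
- rewrite /offset /= addn1 -addnS srcS; apply: cells_t; move: p_in; rewrite /O.
  by case: (act.2) => /=; lia.
Qed.

(** In the row [T.-1] one known column is left on each side of the heads, just enough for the
    scanned cell and the next one, which the rejecting rules read. *)
Lemma array_sound (V : seq bool -> seq bool) :
    (forall u, size u <= C -> halting (current (conf u T.-1)) /\
       output (conf u T.-1) = map out (V u)) ->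
  exists2 u, size u <= C & V u = [:: true].
Proof.
move=> run_V; have [u size_u cert_u] := certificate; exists u => //.
have PE := size_first_row.
have lt_T : T.-1 < T by rewrite prednK.
have [|state_t cells_t] := @conf_cells u _ T.-1 lt_T.
  by move=> i p; apply: first_row_cells.
have [halt_u out_u] := run_V u size_u; set c := conf u T.-1 in state_t cells_t halt_u out_u.
have lt_OP : O < P by rewrite /O PE; lia.
have lt_i := index_lt lt_T (ltnW lt_OP : T < P).
have no_reject o x : (o == 1) && (x != out true) || (o == 2) && (x != blank M) ->
    v (T.-1 * P + T + o) (b_cell ord_max x) = false.
  move=> ox; apply/negP => vx.
  have [_ mk _] := static_holds (ltnW lt_T) (ltnW lt_OP : T < P).
  have r_in : reject_rule o (current c, x) \in rules.
    rewrite !mem_cat; case/orP: ox => /andP[/eqP -> nx].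
      by rewrite (mem_enum_map (reject_rule 1)) ?orbT //= halt_u nx.
    by rewrite (mem_enum_map (reject_rule 2)) ?orbT //= halt_u nx.
  have := rule_fires lt_i r_in; rewrite /= /atom_holds /offset /= !addn0.
  rewrite addn1 -addnS state_t // mk //=.
  by case/orP: ox vx => /andP[/eqP -> _] /= -> /(_ isT).
have head_c : head_cell (tnth (tapes c) ord_max) = out true.
  apply/eqP/negPn/negP => ne_x; have := no_reject 1 (head_cell (tnth (tapes c) ord_max)).
  rewrite ne_x /= => /(_ isT); rewrite -addnA addn1 -(cell_head (blank M) O).
  by rewrite cells_t // leq_subr leq_addr.
have next_c : nth (blank M) (right_cells (tnth (tapes c) ord_max)) 0 = blank M.
  apply/eqP/negPn/negP => ne_x; have := no_reject 2 (nth (blank M) (right_cells (tnth (tapes c) ord_max)) 0).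
  rewrite ne_x /= => /(_ isT); rewrite -addnA addn2.
  have := @cells_t ord_max O.+1; rewrite /cell.
  have -> : (O.+1 < O) = false by lia.
  rewrite subSn // subnn /= => -> //.
  by apply/andP; split; lia.
apply: (inj_map inj_out); rewrite -out_u /output head_c /=.
rewrite (negbTE (out_blank true)); case: (right_cells _) next_c => //= x r ->.
by rewrite eqxx.
Qed.

End Soundness.

Section Completeness.
Variable u : seq bool.
Hypothesis size_u : size u <= C.
Hypothesis accept_u : forall t, halting (current (conf u t)) -> output (conf u t) = [:: out true].

Definition can t p (x : bit) : bool :=
  match x with
  | inl (inl (inl j)) =>
    match (j : nat) with
    | 0 => p != P.-1
    | 1 => p == T
    | 2 => p != T
    | _ => (t == 0) && (O + size w + size u <= p)
    end
  | inl (inl (inr s)) => s == current (conf u t)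
  | inl (inr (i, x)) => x == tnth (scanned (conf u t)) i
  | inr (i, x) => x == cell (blank M) O (tnth (tapes (conf u t)) i) p
  end.

(** Not limited to [T] rows, since windows at the last positions reach further; the run simply goes
    on. *)
Definition canonical q x := can (q %/ P) (q %% P) x.
Arguments canonical : simpl never.

Lemma canonical_index t p x : p < P -> canonical (t * P + p) x = can t p x.
Proof.
move=> lt_p; have P_gt0 : 0 < P by apply: leq_ltn_trans lt_p.
by rewrite /canonical divnMDl // divn_small // addn0 modnMDl modn_small.
Qed.

Lemma all_ctx q s a : all (atom_holds P canonical q) (ctx s a) =
  [&& s == current (conf u (q.+1 %/ P)) & a == scanned (conf u (q.+1 %/ P))].
Proof.
rewrite /= /atom_holds /offset /= addn1; congr andb.
rewrite all_map; apply/allP/eqP => [eq_a|-> i _]; last by rewrite /= addn1 /canonical /=.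
apply: eq_from_tnth => i; have := eq_a i; rewrite mem_enum /= addn1 /canonical /= => /(_ isT).
by move/eqP.
Qed.

Lemma array_complete : array_sat rules kind_clauses W first_row canonical.
Proof.
have PE := size_first_row; have P_gt2 : 2 < P by rewrite PE; lia.
have lt_OP : O < P.-1 by rewrite /O PE; lia.
split=> [q _|g0 p lt_p]; last first.
  have canE x : canonical p x = can 0 p x by rewrite -(canonical_index 0 x lt_p).
  have nthE := nth_first_row g0 lt_p; set g := nth _ _ _ in nthE *.
  have inl_kind a : ((inl a : kind) == k_mark) = false /\ ((inl a : kind) == k_end) = false by [].
  have w_kind : p - O < size w -> exists2 a, nth g0 (map inl w) (p - O) = inl a &
      inp (inl a) = nth (blank M) (input u) (p - O).
    rewrite /input map_cat -!map_comp; case: (w) => // a0 w' lt_w.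
    exists (nth a0 (a0 :: w') (p - O)); first by rewrite (nth_map a0).
    by rewrite nth_cat size_map lt_w (nth_map a0).
  have g_mark : (g == k_mark) = (p == T).
    rewrite nthE; case: ltngtP => //= lt_Tp; case: ifP => [/w_kind[a -> _] //|_].
    by case: ifP => // _; case: ifP.
  have g_end : p = P.-1 -> g == k_end.
    move=> pE; rewrite nthE pE; have -> : (P.-1 < T) = false by rewrite PE; lia.
    have -> : (P.-1 == T) = false by rewrite PE; lia.
    have -> : (P.-1 - O < size w) = false by rewrite PE /O; lia.
    have -> : (P.-1 - O < size w + C) = false by rewrite PE /O; lia.
    by rewrite eqxx.
  have can_cell x : can 0 p (b_cell ord0 x) =
      (x == if p < O then blank M else nth (blank M) (input u) (p - O)).
    by rewrite /= tnth_mktuple /= cell_word.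
  rewrite !all_cat; apply/and3P; split.
  - rewrite /= !canE !orbF andbT; apply/and3P; split; first exact: eqxx.
      by rewrite g_mark; case: ifP => /= [-> //|/negbT].
    rewrite (eq_has (a2 := can 0 p)) // nthE.
    have has1 x : has (can 0 p) [:: x] = can 0 p x by rewrite /= orbF.
    have has_blank h : h \in [:: k_left; k_mark; k_blank; k_end] ->
        has (can 0 p) (cell_clause h) = can 0 p (b_cell ord0 (blank M)).
      by rewrite !inE -has1 => /or4P[] /eqP ->.
    case: ltngtP => [lt_pT|lt_Tp|pT]; last 1 first.
    + by rewrite has_blank // can_cell ltnS pT leqnn.
    + by rewrite has_blank // can_cell ltnS ltnW.
    have nO : (p < O) = false by rewrite /O; lia.
    case: ifP => [lt_w|ge_w].
      by have [a -> aE] := w_kind lt_w; rewrite [cell_clause _]/= has1 can_cell nO aE.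
    have u_nth : nth (blank M) (input u) (p - O) =
        nth (blank M) [seq inp (inr b) | b <- u] (p - O - size w).
      by rewrite /input map_cat -!map_comp nth_cat size_map ge_w.
    case: ifP => [lt_C|ge_C].
      have [lt_u|ge_u] := ltnP (p - O - size w) (size u).
        suff: can 0 p (b_cell ord0 (inp (inr (nth false u (p - O - size w))))).
          by case: (nth _ _ _) => can_b; apply/or3P; [constructor 1 | constructor 2].
        by rewrite can_cell nO u_nth (nth_map false).
      by apply/or3P; constructor 3; rewrite /= ?orbF; rewrite /O in nO ge_w *; lia.
    have blank_p : can 0 p (b_cell ord0 (blank M)).
      rewrite can_cell nO u_nth nth_default // size_map; lia.
    by case: ifP => _; rewrite has_blank.
  - case: ifPn => //; apply: contraR; rewrite /= canE /= andbT orbF negbK => /eqP.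
    exact: g_end.
  apply/all_enumP => i ne_i0; rewrite /= canE orbF /= tnth_mktuple (negbTE ne_i0).
  by rewrite cell_word nth_nil if_same.
(* A window is located by its second cell, the one whose contents are moved. The first cell is its
   left neighbour or, if [p = 0], the last cell of the previous row. *)
rewrite -/P; pose t := q.+1 %/ P; pose p := q.+1 %% P.
have lt_p : p < P by rewrite ltn_mod; lia.
have qE : q.+1 = t * P + p by exact: divn_eq.
have u_can x : canonical q.+1 x = can t p x by [].
have ul_case : (0 < p /\ forall x, canonical q x = can t p.-1 x) \/
    (p = 0 /\ forall x, canonical q x = can t.-1 P.-1 x).
  have [p0|p_gt0] := posnP p; [right | left]; split=> // x.
    have t_gt0 : 0 < t by case: (t) qE => //; rewrite p0.
    rewrite -(@canonical_index t.-1); last by lia.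
    congr canonical; move: qE; rewrite p0 -[in t * P](prednK t_gt0) mulSn; lia.
  rewrite -(@canonical_index t); last by lia.
  by congr canonical; lia.
have ul_ne : canonical q b_ne -> 0 < p.
  by case: ul_case => [[]//|[_ ->]]; rewrite /= eqxx.
have ul_can x : 0 < p -> canonical q x = can t p.-1 x.
  by case: ul_case => [[_ ->]|[-> ]].
have ul_mark : canonical q b_mark -> p = O.
  case: ul_case => [[p_gt0 ->] /eqP pT|[_ ->] /eqP PT]; first by rewrite /O -pT prednK.
  by move: lt_OP; rewrite PT /O; lia.
have ul_nmark : canonical q b_nmark -> p != O.
  case: ul_case => [[p_gt0 ->]|[-> _] _] //=; apply: contraNneq => ->.
  by rewrite /O.
(* The two conditions, which the guards provide, say that the contents stay within a row. *)
have tgt d : (d = MoveRight -> 0 < p) -> (d = MoveLeft -> p < P.-1) ->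
    exists p', [/\ source d p' = p, d = MoveLeft -> 0 < p' &
      forall x, canonical (q + offset P (target d)) x = can t.+1 p' x].
  move=> dR dL; case: d dR dL => /= dR dL.
  - have lt1 := dL erefl; exists p.+1; split=> // x.
    by rewrite -(@canonical_index t.+1); [congr canonical; rewrite /offset /= mulSn; lia | lia].
  - exists p; split=> // x.
    by rewrite -(@canonical_index t.+1 p) //; congr canonical; rewrite /offset /= mulSn; lia.
  have gt0 := dR erefl; exists p.-1; split=> //= [|x]; first by rewrite prednK.
  by rewrite -(@canonical_index t.+1 p.-1); [congr canonical; rewrite /offset /= mulSn; lia | lia].
have tgtS x : canonical (q + (P + 1)) x = can t.+1 p x.
  by rewrite -(@canonical_index t.+1 p) //; congr canonical; rewrite mulSn; lia.
have static x : x \in [:: b_ne; b_mark; b_nmark] -> rule_holds P canonical q (static_rule x).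
  move=> x_in; rewrite /rule_holds /= /atom_holds /offset /= !addn0 andbT orbF /canonical modnDr.
  by move: x_in; rewrite !inE => /or3P[] /eqP -> /=; apply/implyP.
have right x : (forall t p p', can t p x = can t p' x) -> rule_holds P canonical q (right_rule x).
  move=> eq_x; rewrite /rule_holds /= /atom_holds /offset /= !addn0 addn1 andbT orbF.
  by apply/implyP => /andP[/ul_ne/ul_can ->]; rewrite u_can (eq_x _ _ p).
have left x : (forall t p p', can t p x = can t p' x) -> rule_holds P canonical q (left_rule x).
  move=> eq_x; rewrite /rule_holds /= /atom_holds /offset /= !addn0 addn1 andbT orbF.
  by apply/implyP => /andP[/ul_ne/ul_can ->]; rewrite u_can (eq_x _ _ p).
have reject o y : o = 1 /\ y.2 != out true \/ o = 2 /\ y.2 != blank M -> halting y.1 ->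
    rule_holds P canonical q (reject_rule o y).
  move=> oy halt_y; rewrite /rule_holds /= /atom_holds /offset /= !addn0 addn1 u_can /=.
  apply/implyP => /and4P[/eqP yE /ul_mark pO + _].
  rewrite yE in halt_y; have := accept_u halt_y; rewrite /output /=.
  set tp := tnth (tapes _) ord_max => out_t.
  have [head_t next_t] : head_cell tp = out true /\ nth (blank M) (right_cells tp) 0 = blank M.
    move: out_t; case: eqVneq => // ne_b [-> ]; case: (right_cells tp) => //= x r.
    by case: eqVneq.
  case: oy => -[-> ne_y] /=.
    rewrite addn1 u_can /= -/tp pO cell_head head_t => /eqP yE2.
    by rewrite yE2 eqxx in ne_y.
  have -> : q + 2 = t * P + p.+1 by lia.
  rewrite canonical_index ?pO //=; last by lia.
  rewrite -/tp /cell; have -> : (O.+1 < O) = false by lia.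
  rewrite subSn // subnn /= next_t => /eqP yE2.
  by rewrite yE2 eqxx in ne_y.
have act_t i : let: (s', acts) := trans (current (conf u t)) (scanned (conf u t)) in
    current (conf u t.+1) = s' /\ tnth (tapes (conf u t.+1)) i =
      move_head (blank M) (tnth acts i).2 (write_cell (tnth acts i).1 (tnth (tapes (conf u t)) i)).
  by have := step_trans (conf u t); case: (trans _ _) => s' acts [-> /(_ i) ->].
rewrite /rules !all_cat; apply/andP; split.
  rewrite /= !static ?inE ?eqxx ?orbT //= andbT; apply/andP; split.
    rewrite /rule_holds /= /atom_holds /offset /= !addn0 addn1 andbT orbF.
    apply/implyP => /andP[/ul_ne p_gt0]; rewrite ul_can // u_can /= => /andP[-> le_p] /=.
    by apply: leq_trans le_p (leq_pred p).
  rewrite /rule_holds /= /atom_holds /offset /= !addn0 andbT orbF; apply/implyP.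
  rewrite /canonical /= => /andP[/eqP -> le_p] /=; rewrite tnth_mktuple /= cell_word.
  case: ifP => // ge_O; rewrite nth_default // /input size_map size_cat !size_map.
  by move: (q %% P) le_p => p'; lia.
apply/and5P; split; last (apply/and5P; split; last (apply/andP; split)); apply/all_enumP => y.
- by move=> _; apply: right.
- by move=> _; apply: left.
- by move=> _; apply: right.
- by move=> _; apply: left.
- move=> _; rewrite /rule_holds /= /atom_holds /offset /= !addn0 addn1 andbT orbF.
  apply/implyP => /andP[/ul_mark pO]; rewrite !u_can /= pO cell_head => /eqP ->.
  by rewrite tnth_mktuple.
- case: y => s a _; rewrite /rule_holds; apply/implyP; rewrite -[(state_rule _).1]/(ctx s a) all_ctx -/t.
  case/andP => /eqP -> /eqP ->; rewrite /= orbF /atom_holds /offset /= tgtS /=.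
  by have := act_t ord0; case: (trans _ _) => s' acts [->].
- case: y => [[s a] i] _; rewrite /rule_holds; apply/implyP.
  rewrite -[(write_rule _).1]/([:: (0, b_mark)] ++ ctx s a) all_cat all_ctx -/t /= andbT /atom_holds /offset /= addn0 orbF.
  case/and3P => /ul_mark pO /eqP -> /eqP ->.
  have := act_t i; case: (trans _ _) => s' acts [_ act_i]; set act := tnth acts i in act_i *.
  have [|| p' [src_p' gt0 tgt_p']] := tgt act.2; rewrite ?pO //.
  by rewrite tgt_p' /= act_i cell_move // cell_write src_p' pO eqxx.
- case: y => [[s a] [i x]] _; rewrite /rule_holds; apply/implyP.
  rewrite -[(shift_rule _).1]/([:: (0, b_nmark); (1, b_cell i x)] ++
    guard (tnth (trans s a).2 i).2 ++ ctx s a) !all_cat all_ctx -/t /=.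
  case/and3P => nm_cell guard_d /andP[/eqP sE /eqP aE]; move: nm_cell guard_d; rewrite {}sE {}aE.
  have := act_t i; case: (trans _ _) => s' acts [_ act_i] /=; set act := tnth acts i in act_i *.
  rewrite /atom_holds /offset /= addn0 addn1 andbT orbF u_can => /andP[/ul_nmark p_nO /= /eqP xE] guard_d.
  have [||p' [src_p' gt0 tgt_p']] := tgt act.2.
  + by move=> dE; move: guard_d; rewrite dE /= addn0 andbT => /ul_ne.
  + move=> dE; move: guard_d; rewrite dE /= addn1 u_can andbT /= => ne_p.
    by rewrite ltn_neqAle ne_p; move: lt_p; case: (P).
  move: (tgt_p' (b_cell i x)); rewrite /offset => -> /=.
  by rewrite act_i cell_move // cell_write src_p' (negbTE p_nO) xE.
- by case/andP => halt_y ne_y; apply: reject => //; left.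
by case/andP => halt_y ne_y; apply: reject => //; right.
Qed.

End Completeness.
End Instance.
End CookLevin.

(* The elements are processed from right to left, as the words are printed, and
   [d] is in reverse order, as the contents of a stack. *)
Fixpoint scan (U V : Type) (f : seq U -> U -> seq U -> seq V) d (s : seq U) : seq V :=
  if s is x :: s' then scan f (x :: d) s' ++ f d x s' else [::].

Lemma all_scan (U V : Type) (f : seq U -> U -> seq U -> seq V) (a : pred V) x0 d s :
  all a (scan f d s) <->
  forall i, i < size s -> all a (f (catrev (take i s) d) (nth x0 s i) (drop i.+1 s)).
Proof.
elim: s d => [|x s IHs] d /=; first by split.
rewrite all_cat; split.
  by case/andP=> /IHs all_s all_x [|i] lt_i /=; [rewrite drop0 | apply: all_s].
move=> all_f; rewrite -[X in _ && all _ (f _ _ X)]drop0 (all_f 0) // andbT.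
by apply/IHs => i; apply: (all_f i.+1).
Qed.

(** * From arrays to clauses *)

Section ArrayCnf.
Variables (X G : finType) (rules : seq (rule X)) (ic : G -> seq (seq X)).
Implicit Types (v : nat -> X -> bool) (f : X -> option bool).

Definition literals f : clause := [seq f x | x <- enum X].
Definition no_literals n : clause := flatten (nseq n (literals (fun=> None))).
Definition rule_literals (r : rule X) o x :=
  if (o, x) \in r.2 then Some true else if (o, x) \in r.1 then Some false else None.
Definition clause_literals (c : seq X) x := if x \in c then Some true else None.

Definition rule_clause P q q' (r : rule X) : clause :=
  no_literals q ++ literals (rule_literals r 0) ++ literals (rule_literals r 1) ++
  literals (rule_literals r 2) ++ no_literals (P - 3) ++ literals (rule_literals r 3) ++
  literals (rule_literals r 4) ++ literals (rule_literals r 5) ++ no_literals q'.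

Definition first_clause p p' (c : seq X) : clause :=
  no_literals p ++ literals (clause_literals c) ++ no_literals p'.

(** Only the length of [ws] matters: it is a unary counter, over which the printing program will
    loop. *)
Definition array_cnf (U : Type) (ws : seq U) (row : seq G) : seq clause :=
  scan (fun d _ s => [seq rule_clause (size row) (size d) (size s) r | r <- rules]) [::] ws ++
  scan (fun d g s => [seq first_clause (size d) (size ws + 2 + size s) c | c <- ic g]) [::] row.

(** The window at the last of the [size ws] positions ends [size row + 2] cells after it. *)
Definition array_size (U : Type) (ws : seq U) (row : seq G) := size ws + size row + 2.

Definition values v a n : seq bool :=
  flatten [seq [seq v q x | x <- enum X] | q <- iota a n].

Lemma clause_sat_cat x1 x2 c1 c2 : size c1 = size x1 ->
  clause_sat (x1 ++ x2) (c1 ++ c2) = clause_sat x1 c1 || clause_sat x2 c2.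
Proof. by move=> size_x; rewrite /clause_sat zip_cat // has_cat. Qed.

Lemma size_values v a n : size (values v a n) = n * #|X|.
Proof. by elim: n a => //= n IHn a; rewrite size_cat IHn size_map -cardE mulSn. Qed.

Lemma size_no_literals n : size (no_literals n) = n * #|X|.
Proof.
rewrite /no_literals; elim: n => //= n IHn.
by rewrite size_cat IHn size_map -cardE mulSn.
Qed.

Lemma size_literals f : size (literals f) = #|X|.
Proof. by rewrite size_map -cardE. Qed.

Lemma sat_no_literals x n : clause_sat x (no_literals n) = false.
Proof.
have: all (fun o => o == None) (no_literals n).
  rewrite /no_literals; elim: n => //= n IHn; rewrite all_cat IHn andbT.
  by apply/allP => o /mapP[? _ ->].
elim: (no_literals n) x => [|o c IHc] [|b x] //= /andP[/eqP -> /IHc].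
by rewrite /clause_sat /= => ->.
Qed.

Lemma sat_no_literals_cat v a n n' c :
  clause_sat (values v a (n + n')) (no_literals n ++ c) = clause_sat (values v (a + n) n') c.
Proof.
rewrite /values iotaD map_cat flatten_cat clause_sat_cat; last first.
  by rewrite size_no_literals -/(values v a n) size_values.
by rewrite sat_no_literals.
Qed.

Lemma sat_literals_cat v a n f c :
  clause_sat (values v a n.+1) (literals f ++ c) =
  [exists x, f x == Some (v a x)] || clause_sat (values v a.+1 n) c.
Proof.
rewrite /values /= clause_sat_cat; last by rewrite size_literals size_map -cardE.
congr orb; rewrite /clause_sat /literals zip_map has_map; apply/hasP/existsP => [[x _ ?]|[x ?]]; exists x => //.
by rewrite mem_enum.
Qed.

Lemma values_surj n (x : seq bool) : size x = n * #|X| -> exists v, x = values v 0 n.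
Proof.
elim: n x => [|n IHn] x; first by move/size0nil ->; exists (fun _ _ => false).
rewrite mulSn => size_x; have [|v vE] := IHn (drop #|X| x); first by rewrite size_drop size_x; lia.
exists (fun q => if q is q'.+1 then v q' else fun y => nth false x (index y (enum X))).
rewrite -{1}(cat_take_drop #|X| x) vE /values /= -[1]addn0 iotaDl -map_comp; congr (_ ++ _).
have size_t : size (take #|X| x) = #|X| by rewrite size_takel // size_x leq_addr.
apply: (@eq_from_nth _ false); first by rewrite size_t size_map -cardE.
rewrite size_t => i lt_i.
have x0 : X by case: (enum X) (cardE X) lt_i => [->|y].
by rewrite nth_take // (nth_map x0) -?cardE // index_uniq ?enum_uniq -?cardE.
Qed.

(** A clause gives a single sign to a variable, so no atom may be both in the body and among the
    heads; the offsets are those of the two windows. *)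
Definition wf_rule (r : rule X) :=
  all (fun a => (a.1 < 6) && (a \notin r.2)) r.1 && all (fun a => a.1 < 6) r.2.

Lemma sat_rule_clause v P q q' r : 2 < P -> wf_rule r ->
  clause_sat (values v 0 (q + q' + P + 3)) (rule_clause P q q' r) = rule_holds P v q r.
Proof.
move=> P_gt2 /andP[/allP wf_body /allP wf_head].
have -> : q + q' + P + 3 = q + (P - 3 + q'.+3).+3 by lia.
rewrite sat_no_literals_cat !sat_literals_cat sat_no_literals_cat !sat_literals_cat sat_no_literals.
rewrite orbF add0n.
pose sat o := [exists x, rule_literals r o x == Some (v (q + offset P o) x)].
have -> : [|| [exists x, rule_literals r 0 x == Some (v q x)],
    [exists x, rule_literals r 1 x == Some (v q.+1 x)],
    [exists x, rule_literals r 2 x == Some (v q.+2 x)],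
    [exists x, rule_literals r 3 x == Some (v (q.+3 + (P - 3)) x)],
    [exists x, rule_literals r 4 x == Some (v (q.+3 + (P - 3)).+1 x)]
  | [exists x, rule_literals r 5 x == Some (v (q.+3 + (P - 3)).+2 x)]] = has sat (iota 0 6).
  rewrite /= orbF /sat /offset /= !addn0 addn1 addn2.
  have -> : q.+3 + (P - 3) = q + P by lia.
  by rewrite addn1 addn2 !addnS.
apply/hasP/implyP => [[o o_in /existsP[x /eqP lit_x]] /allP body|rule_r].
  move: lit_x; rewrite /rule_literals; case: ifPn => [h_in [vx]|nh]; first by apply/hasP; exists (o, x).
  case: ifP => // b_in [vx]; have := body _ b_in.
  by rewrite /atom_holds -vx.
have [/rule_r/hasP[[o x] h_in vx]|/allPn[[o x] b_in nvx]] := boolP (all (atom_holds P v q) r.1).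
  exists o; first by rewrite mem_iota; have := wf_head _ h_in.
  by apply/existsP; exists x; rewrite /rule_literals h_in; move: vx; rewrite /atom_holds => ->.
have /andP[lt_o /negbTE nh] := wf_body _ b_in; exists o; first by rewrite mem_iota.
by apply/existsP; exists x; rewrite /rule_literals nh b_in; move: nvx; rewrite /atom_holds => /negbTE ->.
Qed.

Lemma sat_first_clause v p p' c :
  clause_sat (values v 0 (p + p'.+1)) (first_clause p p' c) = has (v p) c.
Proof.
rewrite sat_no_literals_cat sat_literals_cat sat_no_literals orbF add0n.
apply/existsP/hasP => [[x]|[x x_in vx]].
  by rewrite /clause_literals; case: ifP => // x_in /eqP[vx]; exists x.
by exists x; rewrite /clause_literals x_in vx.
Qed.

Variables (U : Type) (ws : seq U) (row : seq G).
Hypothesis row_gt2 : 2 < size row.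

Lemma array_cnf_size :
  all (fun c => size c == array_size ws row * #|X|) (array_cnf ws row).
Proof.
rewrite all_cat; apply/andP; split.
  case: (ws) => // u ws'; set s := u :: ws'.
  apply/(all_scan _ _ u) => i lt_i; rewrite all_map; apply/allP => r _ /=.
  rewrite catrevE cats0 size_rev /= !size_cat !size_no_literals !size_literals size_drop size_take lt_i.
  rewrite /array_size; move: #|X| => m; rewrite -{2 3 4 6 7 8}[m]mul1n -!mulnDl.
  by apply/eqP; congr (_ * _); move: lt_i row_gt2; rewrite /s /=; lia.
case: (row) row_gt2 => // g row' row2; set s := g :: row'.
apply/(all_scan _ _ g) => i lt_i; rewrite all_map; apply/allP => r _ /=.
rewrite catrevE cats0 size_rev /= !size_cat !size_no_literals !size_literals size_drop size_take lt_i.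
rewrite /array_size; move: #|X| => m; rewrite -{2}[m]mul1n -!mulnDl.
by apply/eqP; congr (_ * _); move: lt_i; rewrite /s /=; lia.
Qed.

Lemma array_cnf_sat : all wf_rule rules ->
  satisfiable (array_size ws row * #|X|) (array_cnf ws row) <->
  exists v, array_sat rules ic (size ws) row v.
Proof.
move=> /allP wf_rules.
suff H v : all (clause_sat (values v 0 (array_size ws row))) (array_cnf ws row) <->
    array_sat rules ic (size ws) row v.
  split=> [[x /values_surj[v ->] /H sat_v]|[v /H sat_v]]; first by exists v.
  by exists (values v 0 (array_size ws row)); first exact: size_values.
have g1 : G by case: (row) row_gt2.
have sat_ws : all (clause_sat (values v 0 (array_size ws row)))
    (scan (fun d _ s => [seq rule_clause (size row) (size d) (size s) r | r <- rules]) [::] ws) <->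
    forall q, q < size ws -> all (rule_holds (size row) v q) rules.
  case: (ws) => [|u ws']; first by split.
  set s := u :: ws'; split=> [/(all_scan _ _ u) all_s|all_s].
    move=> q lt_q; have := all_s q lt_q; rewrite all_map => /allP all_q.
    apply/allP => r r_in; have := all_q r r_in => /=.
    rewrite catrevE cats0 size_rev size_take lt_q size_drop.
    have -> : array_size s row = q + (size s - q.+1) + size row + 3 by rewrite /array_size; lia.
    by rewrite sat_rule_clause // wf_rules.
  apply/(all_scan _ _ u) => q lt_q; rewrite all_map; apply/allP => r r_in /=.
  rewrite catrevE cats0 size_rev size_take lt_q size_drop.
  have -> : array_size s row = q + (size s - q.+1) + size row + 3 by rewrite /array_size; lia.
  by rewrite sat_rule_clause // ?wf_rules //; apply: (allP (all_s q lt_q)).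
have sat_row : all (clause_sat (values v 0 (array_size ws row)))
    (scan (fun d g s => [seq first_clause (size d) (size ws + 2 + size s) c | c <- ic g]) [::] row) <->
    forall g0 p, p < size row -> all (has (v p)) (ic (nth g0 row p)).
  split=> [/(all_scan _ _ g1) all_s|all_s].
    move=> g0 p lt_p; have := all_s p lt_p; rewrite all_map (set_nth_default g0) // => /allP all_p.
    apply/allP => c c_in; have := all_p c c_in => /=.
    rewrite catrevE cats0 size_rev size_take lt_p size_drop.
    have -> : array_size ws row = p + (size ws + 2 + (size row - p.+1)).+1 by rewrite /array_size; lia.
    by rewrite sat_first_clause.
  apply/(all_scan _ _ g1) => p lt_p; rewrite all_map; apply/allP => c c_in /=.
  rewrite catrevE cats0 size_rev size_take lt_p size_drop.
  have -> : array_size ws row = p + (size ws + 2 + (size row - p.+1)).+1 by rewrite /array_size; lia.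
  by rewrite sat_first_clause; apply: (allP (all_s g1 p lt_p)).
rewrite all_cat; split=> [/andP[/sat_ws ? /sat_row ?] //|[/sat_ws -> /sat_row ->] //].
Qed.

End ArrayCnf.

(** * Programs on stacks *)

Section StackPrograms.
Variables (K : nat) (Sg : finType).
Notation reg := 'I_K.+1.

(* A store lists the contents of the stacks, the head of a list being the top of
   the stack.  [Loop r f] pops the stack [r] until it is empty, and executes
   [f x] for each letter [x] popped. *)
Definition store := seq (seq Sg).
Definition upd (s : store) (r : nat) v : store := set_nth [::] s r v.
Definition get (s : store) (r : nat) : seq Sg := nth [::] s r.

Inductive cmd :=
  Skip | Push of reg & Sg | Seq of cmd & cmd | Loop of reg & (Sg -> cmd).

(** A loop has a point of its own, its test, and those of one body per letter: the letter popped is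
    remembered in the control state. *)
Fixpoint pos (c : cmd) : finType :=
  match c with
  | Skip => void
  | Push _ _ => unit
  | Seq c1 c2 => (pos c1 + pos c2)%type
  | Loop _ f => option {x : Sg & pos (f x)}
  end.

Inductive instr (R : Type) := IPush of reg & Sg & R | IPop of reg & (option Sg -> R).

(* The program points of a command are injected by [inj] among those of the
   whole program, and the execution of the command ends at [ex]. *)
Fixpoint entry c (R : Type) : (pos c -> R) -> R -> R :=
  match c return (pos c -> R) -> R -> R with
  | Skip => fun _ ex => ex
  | Push _ _ => fun inj _ => inj tt
  | Seq c1 c2 => fun inj ex =>
      entry (fun p => inj (inl p)) (entry (fun p => inj (inr p)) ex)
  | Loop _ _ => fun inj _ => inj None
  end.

Fixpoint code c (R : Type) : (pos c -> R) -> R -> pos c -> instr R :=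
  match c return (pos c -> R) -> R -> pos c -> instr R with
  | Skip => fun _ _ p => match p with end
  | Push r x => fun _ ex _ => IPush r x ex
  | Seq c1 c2 => fun inj ex p =>
      match p with
      | inl p1 => code (fun p => inj (inl p)) (entry (fun p => inj (inr p)) ex) p1
      | inr p2 => code (fun p => inj (inr p)) ex p2
      end
  | Loop r f => fun inj ex p =>
      match p with
      | None => IPop r (fun o => if o is Some x
          then entry (fun p => inj (Some (existT (fun x => pos (f x)) x p))) (inj None)
          else ex)
      | Some (existT x p) =>
          code (fun p => inj (Some (existT (fun x => pos (f x)) x p))) (inj None) p
      end
  end.

Inductive run R (prog : R -> option (instr R)) : nat -> R -> store -> R -> store -> Prop :=
| RunNil p s : run prog 0 p s p s
| RunPush p r x q s t p' s' : prog p = Some (IPush r x q) ->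
    run prog t q (upd s r (x :: get s r)) p' s' -> run prog t.+1 p s p' s'
| RunPop p r f x v s t p' s' : prog p = Some (IPop r f) -> get s r = x :: v ->
    run prog t (f (Some x)) (upd s r v) p' s' -> run prog t.+1 p s p' s'
| RunEmpty p r f s t p' s' : prog p = Some (IPop r f) -> get s r = [::] ->
    run prog t (f None) s p' s' -> run prog t.+1 p s p' s'.

Lemma run_trans R (prog : R -> option (instr R)) t1 t2 p1 s1 p2 s2 p3 s3 :
  run prog t1 p1 s1 p2 s2 -> run prog t2 p2 s2 p3 s3 ->
  run prog (t1 + t2) p1 s1 p3 s3.
Proof.
elim=> // {t1 p1 s1 p2 s2} [p r x q s t p' s'|p r f x v s t p' s'|p r f s t p' s'].
- by move=> prog_p _ IH /IH; apply: RunPush prog_p.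
- by move=> prog_p get_r _ IH /IH; apply: RunPop prog_p get_r.
by move=> prog_p get_r _ IH /IH; apply: RunEmpty prog_p get_r.
Qed.

(* Within [t] steps, and whatever the program [prog] in which [c] is compiled. *)
Definition runs c s s' t :=
  forall R (prog : R -> option (instr R)) inj ex,
    (forall p, prog (inj p) = Some (code inj ex p)) ->
  exists2 t', t' <= t & run prog t' (@entry c R inj ex) s ex s'.

Lemma runs_le c s s' t t' : t <= t' -> runs c s s' t -> runs c s s' t'.
Proof.
move=> le_t run_c R prog inj ex progE; have [t1 le_t1 run1] := run_c R prog inj ex progE.
by exists t1 => //; apply: leq_trans le_t.
Qed.

Lemma runs_skip s : runs Skip s s 0.
Proof. by move=> R prog inj ex _; exists 0; last exact: RunNil. Qed.

Lemma runs_push (r : reg) x s : runs (Push r x) s (upd s r (x :: get s r)) 1.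
Proof.
move=> R prog inj ex progE; exists 1 => //.
by apply: RunPush (progE tt) _; apply: RunNil.
Qed.

Lemma runs_seq c1 c2 s s1 s2 t1 t2 :
  runs c1 s s1 t1 -> runs c2 s1 s2 t2 -> runs (Seq c1 c2) s s2 (t1 + t2).
Proof.
move=> run1 run2 R prog inj ex progE.
have [t1' le1 {}run1] := run1 R prog _ _ (fun p => progE (inl p)).
have [t2' le2 {}run2] := run2 R prog _ _ (fun p => progE (inr p)).
by exists (t1' + t2'); [apply: leq_add | apply: run_trans run2].
Qed.

Lemma runs_loop_nil (r : reg) f s : get s r = [::] -> runs (Loop r f) s s 1.
Proof.
move=> get_r R prog inj ex progE; exists 1 => //.
by apply: RunEmpty (progE None) get_r _; apply: RunNil.
Qed.

Lemma runs_loop_cons (r : reg) f s x v s1 s2 t1 t2 : get s r = x :: v ->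
  runs (f x) (upd s r v) s1 t1 -> runs (Loop r f) s1 s2 t2 ->
  runs (Loop r f) s s2 (t1 + t2).+1.
Proof.
move=> get_r run1 run2 R prog inj ex progE.
have [t1' le1 {}run1] := run1 R prog _ _ (fun p => progE (Some (existT _ x p))).
have [t2' le2 {}run2] := run2 R prog _ _ progE.
exists (t1' + t2').+1; first by rewrite ltnS leq_add.
by apply: RunPop (progE None) get_r _; apply: run_trans run2.
Qed.

Section Compile.
Variable c : cmd.

Definition point := option (pos c).

Definition program (p : point) : option (instr point) :=
  if p is Some q then Some (code Some None q) else None.

Definition mstate : finType := (bool + point * bool)%type.

Notation sym := (option Sg).

Definition one_act (h : K.+1.-tuple sym) (r : reg) (a : sym) (d : direction) :=
  [tuple if i == r then (a, d) else (tnth h i, Stay) | i < K.+1].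

(* [inl false] moves the input head to the left of the input word, [inl true]
   is the halting state.  A pop takes two steps. *)
Definition mtransition (q : mstate) (h : K.+1.-tuple sym) :
    mstate * K.+1.-tuple (sym * direction) :=
  match q with
  | inl false => (inr (entry Some None, false), one_act h ord0 (tnth h ord0) MoveLeft)
  | inl true => (q, one_act h ord0 (tnth h ord0) Stay)
  | inr (p, b) =>
    match program p with
    | None => (inl true, one_act h ord_max (tnth h ord_max) MoveRight)
    | Some (IPush r x p') => (inr (p', false), one_act h r (Some x) MoveLeft)
    | Some (IPop r f) =>
        if b then (inr (f (tnth h r), false), one_act h r None Stay)
        else (inr (p, true), one_act h r (tnth h r) MoveRight)
    end
  end.

Definition stack_machine : machine :=
  @Machine K mstate (option Sg) None (inl false)
    (fun q => if q is inl true then true else false) mtransition.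

(* A stack is stored to the right of the head, which scans a blank cell. *)
Definition stack_tape (t : tape sym) (v : seq Sg) :=
  exists g g', t = Tape (nseq g None) None (map Some v ++ nseq g' None).

Notation mconfig := (config stack_machine).

Definition represents (m : mconfig) (s : store) :=
  forall i : reg, stack_tape (tnth (tapes m) i) (get s i).

Lemma step_one_act (m : mconfig) q r a d : ~~ halting (current m) ->
    mtransition (current m) [tuple head_cell (tnth (tapes m) i) | i < _] =
      (q, one_act [tuple head_cell (tnth (tapes m) i) | i < _] r a d) ->
  current (step m) = q /\
  forall i : reg, tnth (tapes (step m)) i =
    if i == r then move_head None d (write_cell a (tnth (tapes m) i))
    else tnth (tapes m) i.
Proof.
move=> nhalt trans_m; rewrite /step (negbTE nhalt) /= trans_m /=; split=> // i.
rewrite !tnth_mktuple; case: ifP => // _ /=.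
by case: (tnth (tapes m) i).
Qed.

Lemma stack_push (t : tape sym) v x : stack_tape t v ->
  stack_tape (move_head None MoveLeft (write_cell (Some x) t)) (x :: v).
Proof.
move=> [g [g' ->]]; exists g.-1, g'; rewrite /write_cell /=.
by case: g.
Qed.

(** On an empty stack the head merely drifts by one blank to the right, which the slack [g] and [g']
    in [stack_tape] allows. *)
Lemma stack_pop (t : tape sym) v : stack_tape t v ->
  head_cell (move_head None MoveRight (write_cell (head_cell t) t)) = ohead v /\
  stack_tape (move_head None Stay (write_cell None
    (move_head None MoveRight (write_cell (head_cell t) t)))) (behead v).
Proof.
move=> [g [g' ->]] /=; case: v => [|x v] /=; last by split=> //; exists g.+1, g'.
by split; [case: g' | exists g.+1, g'.-1; case: g'].
Qed.

Lemma get_upd s r v i : get (upd s r v) i = if i == r then v else get s i.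
Proof. by rewrite /get /upd nth_set_nth. Qed.

Lemma represents_upd (m m' : mconfig) s (r : reg) v : represents m s ->
    (forall i : reg, i != r -> tnth (tapes m') i = tnth (tapes m) i) ->
    stack_tape (tnth (tapes m') r) v ->
  represents m' (upd s r v).
Proof.
move=> rep_m eq_m st_v i; rewrite get_upd; case: eqVneq => [/val_inj -> //|ne_ir].
by rewrite eq_m.
Qed.

Lemma run_machine t p s p' s' (m : mconfig) : run program t p s p' s' ->
    represents m s -> current m = inr (p, false) ->
  exists t', [/\ t' <= t * 2, represents (iter t' (@step stack_machine) m) s' &
    current (iter t' (@step stack_machine) m) = inr (p', false)].
Proof.
move=> run_p; elim: run_p m => {t p s p' s'}
  [p s|p r x q s t p' s'|p r f x v s t p' s'|p r f s t p' s'].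
- by move=> m rep_m cur_m; exists 0.
- move=> prog_p _ IH m rep_m cur_m.
  have [] := @step_one_act m (inr (q, false)) r (Some x) MoveLeft.
  + by rewrite cur_m.
  + by rewrite cur_m /= prog_p.
  move=> cur_m' tapes_m'; have rep_m' : represents (step m) (upd s r (x :: get s r)).
    apply: (represents_upd rep_m) => [i ne_ir|]; first by rewrite tapes_m' (negbTE ne_ir).
    by rewrite tapes_m' eqxx; apply: stack_push.
  have [t' [le_t rep_t cur_t]] := IH _ rep_m' cur_m'.
  by exists t'.+1; rewrite iterSr; split=> //; rewrite mulSn; lia.
- move=> prog_p get_r _ IH m rep_m cur_m.
  have [] := @step_one_act m (inr (p, true)) r (head_cell (tnth (tapes m) r)) MoveRight.
  + by rewrite cur_m.
  + by rewrite cur_m /= prog_p tnth_mktuple.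
  move=> cur_m1 tapes_m1; set m1 := step m in cur_m1 tapes_m1.
  have [head1 pop1] := stack_pop (rep_m r).
  rewrite get_r in head1 pop1.
  have [] := @step_one_act m1 (inr (f (Some x), false)) r None Stay.
  + by rewrite cur_m1.
  + by rewrite cur_m1 /= prog_p tnth_mktuple tapes_m1 eqxx head1.
  move=> cur_m2 tapes_m2; have rep_m2 : represents (step m1) (upd s r v).
    apply: (represents_upd rep_m) => [i ne_ir|].
      by rewrite tapes_m2 (negbTE ne_ir) tapes_m1 (negbTE ne_ir).
    by rewrite tapes_m2 eqxx tapes_m1 eqxx.
  have [t' [le_t rep_t cur_t]] := IH _ rep_m2 cur_m2.
  by exists t'.+2; rewrite !iterSr; split=> //; rewrite mulSn; lia.
move=> prog_p get_r _ IH m rep_m cur_m.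
have [] := @step_one_act m (inr (p, true)) r (head_cell (tnth (tapes m) r)) MoveRight.
+ by rewrite cur_m.
+ by rewrite cur_m /= prog_p tnth_mktuple.
move=> cur_m1 tapes_m1; set m1 := step m in cur_m1 tapes_m1.
have [head1 pop1] := stack_pop (rep_m r).
rewrite get_r in head1 pop1.
have [] := @step_one_act m1 (inr (f None, false)) r None Stay.
+ by rewrite cur_m1.
+ by rewrite cur_m1 /= prog_p tnth_mktuple tapes_m1 eqxx head1.
move=> cur_m2 tapes_m2; have rep_m2 : represents (step m1) s.
  move=> i; rewrite tapes_m2; case: (eqVneq i r) => [->|ne_ir].
    by rewrite tapes_m1 eqxx get_r.
  by rewrite tapes_m1 (negbTE ne_ir).
have [t' [le_t rep_t cur_t]] := IH _ rep_m2 cur_m2.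
by exists t'.+2; rewrite !iterSr; split=> //; rewrite mulSn; lia.
Qed.

Lemma halted_iter (M : machine) (m : config M) t :
  halting (current m) -> iter t (@step M) m = m.
Proof. by move=> halt_m; elim: t => //= t ->; rewrite /step halt_m. Qed.

Lemma take_blank (v : seq Sg) g (u := map Some v ++ nseq g None)
    (s := head None u :: behead u) : take (index None s) s = map Some v.
Proof.
rewrite /s /u {s u}; case: v => [|x v] /=; first by case: g.
congr cons; have -> : index (None : sym) (map Some v ++ nseq g None) = size (map (@Some Sg) v).
  by elim: v => [|y v IHv] /=; [case: g | rewrite IHv].
by rewrite take_size_cat.
Qed.

(** Each instruction takes at most two steps. The two extra ones move the input head to the blank
    before the word and, at the end, the output head to the first letter. *)
Lemma machine_output (w : seq Sg) s' t : runs c (w :: nseq K [::]) s' t ->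
  let m := iter (t * 2).+2 (@step stack_machine) (init stack_machine (map Some w)) in
  halting (current m) /\ output m = map Some (get s' K).
Proof.
move=> run_c; set m0 := init _ _.
have [] := @step_one_act m0 (inr (entry Some None, false)) ord0 (head_cell (tnth (tapes m0) ord0)) MoveLeft.
- by [].
- by rewrite /= tnth_mktuple.
move=> cur_m1 tapes_m1; set m1 := step m0 in cur_m1 tapes_m1.
have rep_m1 : represents m1 (w :: nseq K [::]).
  move=> i; rewrite tapes_m1 /m0 /= !tnth_mktuple; case: (eqVneq i ord0) => [->|ne_i0].
    case: (w) => [|x v]; first by exists 0, 1.
    by exists 0, 0; rewrite /= cats0.
  have -> : get (w :: nseq K [::]) i = [::].
    by case: i ne_i0 => -[|i] // lt_i _; rewrite /get /= nth_nseq if_same.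
  by exists 0, 0.
have [t1 le_t1 run_t1] := run_c _ program Some None (fun=> erefl).
have [t' [le_t rep_m2 cur_m2]] := run_machine run_t1 rep_m1 cur_m1.
set m2 := iter t' _ m1 in rep_m2 cur_m2.
have [] := @step_one_act m2 (inl true) ord_max (head_cell (tnth (tapes m2) ord_max)) MoveRight.
- by rewrite cur_m2.
- by rewrite cur_m2 /= tnth_mktuple.
move=> cur_m3 tapes_m3; set m3 := step m2 in cur_m3 tapes_m3.
have halt3 : halting (current m3) by rewrite cur_m3.
have -> : iter (t * 2).+2 (@step stack_machine) m0 = m3.
  rewrite iterSr -/m1 (_ : (t * 2).+1 = (t * 2 - t') + t'.+1); last by lia.
  by rewrite iterD iterS -/m2 -/m3 halted_iter.
split=> //; rewrite /output tapes_m3 eqxx.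
have [g [g' ->]] := rep_m2 ord_max; rewrite /=.
by rewrite take_blank.
Qed.

End Compile.

Lemma stack_polytime (A B : finType) (f : seq A -> seq B) (inp : A -> Sg) (out : B -> Sg)
    (c : cmd) (q : {poly nat}) :
    injective inp -> injective out ->
    (forall w, exists2 s, runs c (map inp w :: nseq K [::]) s q.[size w]%R &
       get s K = map out (f w)) ->
  polytime f.
Proof.
move=> inj_inp inj_out run_c.
exists (stack_machine c), (Some \o inp), (Some \o out), (q + q + 2%:P)%R; split=> //.
- by move=> x y [/inj_inp].
- by move=> x y [/inj_out].
move=> w; have [s run_w get_s] := run_c w.
have -> : ((q + q + 2%:P).[size w] = (q.[size w] * 2).+2 :> nat)%R.
  by rewrite !hornerD hornerC muln2 -addnn; exact: addn2.
by have := machine_output run_w; rewrite -map_comp get_s -map_comp.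
Qed.

End StackPrograms.

(** * Programs in polynomial time *)

Definition polyf (t : nat -> nat) := exists p : {poly nat}, forall n, t n <= p.[n]%R.

Lemma polyf_le t t' : (forall n, t n <= t' n) -> polyf t' -> polyf t.
Proof. by move=> le_t [p le_p]; exists p => n; apply: leq_trans (le_p n). Qed.

Lemma polyf_horner (p : {poly nat}) : polyf (fun n => p.[n]%R).
Proof. by exists p. Qed.

Lemma polyf_const a : polyf (fun=> a).
Proof. by exists (a%:P)%R => n; rewrite hornerC. Qed.

Lemma polyf_id : polyf id.
Proof. by exists 'X%R => n; rewrite hornerX. Qed.

Lemma polyfD t t' : polyf t -> polyf t' -> polyf (fun n => t n + t' n).
Proof.
move=> [p le_p] [p' le_p']; exists (p + p')%R => n.
by rewrite hornerD; apply: leq_add.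
Qed.

Lemma polyfM t t' : polyf t -> polyf t' -> polyf (fun n => t n * t' n).
Proof.
move=> [p le_p] [p' le_p']; exists (p * p')%R => n.
by rewrite hornerM; apply: leq_mul.
Qed.

Lemma polyf_sum (I : Type) (r : seq I) (t : I -> nat -> nat) :
  (forall i, polyf (t i)) -> polyf (fun n => \sum_(i <- r) t i n).
Proof.
move=> poly_t; elim: r => [|i r IHr].
  by apply: polyf_le (polyf_const 0) => n; rewrite big_nil.
by apply: polyf_le (polyfD (poly_t i) IHr) => n; rewrite big_cons.
Qed.

Section Programs.
Variables (K : nat) (Sg : finType).
Notation reg := 'I_K.+1.
Notation store := (store Sg).
Notation cmd := (cmd K Sg).

Lemma size_upd (s : store) (r : nat) v : r < size s -> size (upd s r v) = size s.
Proof. by move=> lt_r; rewrite size_set_nth; apply/maxn_idPr. Qed.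

Lemma store_eq (s s' : store) :
  size s = size s' -> (forall i, get s i = get s' i) -> s = s'.
Proof. by move=> size_s eq_s; apply: (@eq_from_nth _ [::]) => // i _; apply: eq_s. Qed.

Lemma upd_rcons (s : store) o (r : nat) v : r < size s -> upd (rcons s o) r v = rcons (upd s r v) o.
Proof. by rewrite /upd; elim: s r => //= x s IHs [|r] //= lt_r; rewrite IHs. Qed.

Lemma get_rcons (s : store) o (r : nat) : r < size s -> get (rcons s o) r = get s r.
Proof. by move=> lt_r; rewrite /get nth_rcons lt_r. Qed.

Definition rout : reg := ord_max.

(** The last letter is pushed first, so that the output stack reads [w] from its top. *)
Fixpoint emit (w : seq Sg) : cmd :=
  if w is x :: w' then Seq (emit w') (Push rout x) else Skip K Sg.

Lemma runs_emit w (s : store) o : size s = K ->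
  runs (emit w) (rcons s o) (rcons s (w ++ o)) (size w).
Proof.
move=> size_s; elim: w => [|x w IHw] /=; first exact: runs_skip.
rewrite -addn1; apply: runs_seq IHw _.
have := @runs_push K Sg rout x (rcons s (w ++ o)).
have -> // : upd (rcons s (w ++ o)) rout (x :: get (rcons s (w ++ o)) rout) = rcons s (x :: w ++ o).
rewrite /= -{}size_s; elim: s => //= y s IHs.
by rewrite -IHs.
Qed.

(** A loop that restores [r]. Meanwhile [tmp] holds the letters already visited and [r] those to
    come, which gives the body its position in the list. *)
Definition For r tmp (body : Sg -> cmd) : cmd :=
  Seq (Loop r (fun x => Seq (body x) (Push tmp x))) (Loop tmp (fun x => Push r x)).

Lemma runs_restore (r tmp : reg) (s : store) v d : r != tmp -> r < size s -> tmp < size s ->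
  runs (Loop tmp (fun x => Push r x)) (upd (upd s r v) tmp d) (upd (upd s r (catrev d v)) tmp [::])
    (size d * 2 + 1).
Proof.
move=> ne_r lt_r lt_tmp; have ne_r' : (r == tmp :> nat) = false by apply: negbTE.
elim: d v => [|x d IHd] v; first by apply: runs_loop_nil; rewrite get_upd eqxx.
have get_tmp : get (upd (upd s r v) tmp (x :: d)) tmp = x :: d by rewrite get_upd eqxx.
have := @runs_push K Sg r x (upd (upd (upd s r v) tmp (x :: d)) tmp d).
rewrite !get_upd ne_r' eqxx => run1.
have E : upd (upd (upd (upd s r v) tmp (x :: d)) tmp d) r (x :: v) = upd (upd s r (x :: v)) tmp d.
  apply: store_eq => [|i]; first by rewrite !size_upd ?size_upd ?size_upd.
  by rewrite !get_upd; case: (eqVneq i (r : nat)) => [->|_]; rewrite ?ne_r' //; case: eqP.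
rewrite E in run1; apply: runs_le (runs_loop_cons get_tmp run1 (IHd (x :: v))).
by rewrite /=; lia.
Qed.

Lemma runs_for_print (r tmp : reg) body (s : store) v0 wf tb o :
    size s = K -> r != tmp -> r < K -> tmp < K -> get s tmp = [::] -> get s r = v0 ->
    (forall d x v o, rev d ++ x :: v = v0 ->
       runs (body x) (rcons (upd (upd s r v) tmp d) o)
                     (rcons (upd (upd s r v) tmp d) (wf d x v ++ o)) tb) ->
  runs (For r tmp body) (rcons s o) (rcons s (scan wf [::] v0 ++ o)) (size v0 * (tb + 4) + 2).
Proof.
move=> size_s ne_r lt_r lt_tmp s_tmp s_r run_body.
have ne_r' : (r == tmp :> nat) = false by apply: negbTE.
have ne_tmp : (tmp == r :> nat) = false by rewrite eq_sym.
have loop v d o' : rev d ++ v = v0 ->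
    runs (Loop r (fun x => Seq (body x) (Push tmp x))) (rcons (upd (upd s r v) tmp d) o')
      (rcons (upd (upd s r [::]) tmp (rev v0)) (scan wf d v ++ o')) (size v * (tb + 2) + 1).
  elim: v d o' => [|x v IHv] d o' v0E.
    rewrite -v0E cats0 revK /=; apply: runs_loop_nil.
    by rewrite get_rcons ?size_upd ?size_upd ?size_s // !get_upd ne_r' eqxx.
  have get_r : get (rcons (upd (upd s r (x :: v)) tmp d) o') r = x :: v.
    by rewrite get_rcons ?size_upd ?size_upd ?size_s // !get_upd ne_r' eqxx.
  have E : upd (rcons (upd (upd s r (x :: v)) tmp d) o') r v = rcons (upd (upd s r v) tmp d) o'.
    rewrite upd_rcons ?size_upd ?size_upd ?size_s //; congr rcons.
    apply: store_eq => [|i]; first by rewrite !size_upd ?size_upd ?size_upd ?size_s.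
    by rewrite !get_upd; case: (eqVneq i (r : nat)) => [->|_]; rewrite ?ne_r' //; case: eqP.
  have run1 := run_body d x v o' v0E; rewrite -{1}E in run1.
  have := @runs_push K Sg tmp x (rcons (upd (upd s r v) tmp d) (wf d x v ++ o')).
  rewrite get_rcons ?size_upd ?size_upd ?size_s // get_upd eqxx.
  rewrite upd_rcons ?size_upd ?size_upd ?size_s // => run2.
  have E2 : upd (upd (upd s r v) tmp d) tmp (x :: d) = upd (upd s r v) tmp (x :: d).
    apply: store_eq => [|i]; first by rewrite !size_upd ?size_upd ?size_upd ?size_s.
    by rewrite !get_upd; case: eqP.
  rewrite E2 in run2; have v0E' : rev (x :: d) ++ v = v0 by rewrite rev_cons cat_rcons.
  have := runs_loop_cons get_r (runs_seq run1 run2) (IHv _ _ v0E').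
  rewrite /= catA; apply: runs_le; lia.
have E0 : upd (upd s r v0) tmp [::] = s.
  apply: store_eq => [|i]; first by rewrite !size_upd ?size_upd ?size_s.
  by rewrite !get_upd; case: eqP => [->//|_]; case: eqP => [->|].
have run1 := loop v0 [::] o erefl; rewrite E0 in run1.
have lt_K (q : reg) x : q < K -> q < size (rcons s x) by rewrite size_rcons size_s ltnS => /ltnW.
have run2 := @runs_restore r tmp (rcons s (scan wf [::] v0 ++ o)) [::] (rev v0) ne_r
  (lt_K _ _ lt_r) (lt_K _ _ lt_tmp).
rewrite !upd_rcons ?size_upd ?size_s // in run2.
have catrev_rev : catrev (rev v0) [::] = v0 by rewrite -/(rev _) revK.
rewrite catrev_rev E0 size_rev in run2.
by apply: runs_le (runs_seq run1 run2); lia.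
Qed.

Lemma runs_loop (r : reg) (f : Sg -> cmd) (I : seq Sg -> store) v0 tb :
    (forall v, get (I v) r = v) ->
    (forall d x v, d ++ x :: v = v0 -> runs (f x) (upd (I (x :: v)) r v) (I v) tb) ->
  runs (Loop r f) (I v0) (I [::]) (size v0 * (tb + 1) + 1).
Proof.
move=> get_I run_f.
suff H d v : d ++ v = v0 -> runs (Loop r f) (I v) (I [::]) (size v * (tb + 1) + 1) by apply: (H [::]).
elim: v d => [|x v IHv] d v0E; first exact: runs_loop_nil (get_I _).
have v0E' : rcons d x ++ v = v0 by rewrite cat_rcons.
apply: runs_le (runs_loop_cons (get_I _) (run_f _ _ _ v0E) (IHv _ v0E')).
by rewrite /=; lia.
Qed.

Section Uniform.
Variables (U : Type) (ok : U -> Prop) (len : U -> nat).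

(** The parameter [u] is the input, possibly with the position of an enclosing loop; the time bound
    depends on [len u] only, uniformly. *)
Definition pruns (c : cmd) (s s' : U -> store) :=
  exists2 t, polyf t & forall u, ok u -> runs c (s u) (s' u) (t (len u)).

Lemma pruns_skip s : pruns (Skip K Sg) s s.
Proof. by exists (fun=> 0); [apply: polyf_const | move=> u _; apply: runs_skip]. Qed.

Lemma pruns_seq c1 c2 s s1 s2 : pruns c1 s s1 -> pruns c2 s1 s2 -> pruns (Seq c1 c2) s s2.
Proof.
move=> [t1 poly1 run1] [t2 poly2 run2]; exists (fun n => t1 n + t2 n); first exact: polyfD.
by move=> u ok_u; apply: runs_seq (run1 u ok_u) (run2 u ok_u).
Qed.

Lemma pruns_ext c s s' s2 s2' : (forall u, ok u -> s u = s2 u) -> (forall u, ok u -> s' u = s2' u) ->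
  pruns c s s' -> pruns c s2 s2'.
Proof.
move=> eq_s eq_s' [t poly_t run]; exists t => // u ok_u.
by rewrite -eq_s // -eq_s' //; apply: run.
Qed.

End Uniform.

(** [I u v] is the store when [v] remains on [r]. Each letter has its own body and bound; as the
    alphabet is finite, the sum of these bounds serves for all. *)
Lemma pruns_loop (U : Type) (ok : U -> Prop) (len : U -> nat) (r : reg) (f : Sg -> cmd)
    (I : U -> seq Sg -> store) (v0 : U -> seq Sg) b :
    polyf b -> (forall u, ok u -> size (v0 u) <= b (len u)) ->
    (forall u v, get (I u v) r = v) ->
    (forall x, pruns (fun uv : U * seq Sg => ok uv.1 /\ exists d, d ++ x :: uv.2 = v0 uv.1)
       (fun uv => len uv.1) (f x)
       (fun uv => upd (I uv.1 (x :: uv.2)) r uv.2) (fun uv => I uv.1 uv.2)) ->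
  pruns ok len (Loop r f) (fun u => I u (v0 u)) (fun u => I u [::]).
Proof.
move=> poly_b le_b get_I /fin_all_exists2[t poly_t run_f].
exists (fun n => b n * ((\sum_(x <- enum Sg) t x n) + 1) + 1).
  apply: polyfD (polyf_const 1); apply: polyfM => //; apply: polyfD (polyf_const 1).
  exact: polyf_sum.
move=> u ok_u.
have run_u d x v : d ++ x :: v = v0 u ->
    runs (f x) (upd (I u (x :: v)) r v) (I u v) (\sum_(y <- enum Sg) t y (len u)).
  move=> v0E; apply: runs_le (run_f x (u, v) _); last by split=> //; exists d.
  by rewrite /= big_enum (bigD1 x) //= leq_addr.
apply: runs_le (runs_loop (get_I u) run_u).
by rewrite leq_add2r leq_mul2r le_b ?orbT.
Qed.

(** The output is the last stack, whose contents [o] are arbitrary; the other stacks are left as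
    they were. *)
Definition pprints (U : Type) (ok : U -> Prop) (len : U -> nat) (c : cmd) (s : U -> store) (w : U -> seq Sg) :=
  exists2 t, polyf t & forall u, ok u ->
    forall o, runs c (rcons (s u) o) (rcons (s u) (w u ++ o)) (t (len u)).

Section UniformPrint.
Variables (U : Type) (ok : U -> Prop) (len : U -> nat) (s : U -> store).
Hypothesis size_s : forall u, ok u -> size (s u) = K.

Lemma pprints_emit w : pprints ok len (emit w) s (fun=> w).
Proof.
exists (fun=> size w); first exact: polyf_const.
by move=> u ok_u o; apply/runs_emit/size_s.
Qed.

Lemma pprints_seq c1 c2 w1 w2 : pprints ok len c1 s w1 -> pprints ok len c2 s w2 ->
  pprints ok len (Seq c1 c2) s (fun u => w2 u ++ w1 u).
Proof.
move=> [t1 poly1 run1] [t2 poly2 run2]; exists (fun n => t1 n + t2 n); first exact: polyfD.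
by move=> u ok_u o; rewrite -catA; apply: runs_seq (run1 u ok_u o) (run2 u ok_u _).
Qed.

Lemma pprints_ext c w w' : (forall u, ok u -> w u = w' u) -> pprints ok len c s w ->
  pprints ok len c s w'.
Proof.
by move=> eq_w [t poly_t run]; exists t => // u ok_u o; rewrite -eq_w //; apply: run.
Qed.

Lemma pprints_for (r tmp : reg) body b (wf : Sg -> U * (seq Sg * seq Sg) -> seq Sg) :
    r != tmp -> r < K -> tmp < K -> polyf b ->
    (forall u, ok u -> size (get (s u) r) <= b (len u)) ->
    (forall u, ok u -> get (s u) tmp = [::]) ->
    (forall x, pprints (fun a : U * (seq Sg * seq Sg) =>
         ok a.1 /\ rev a.2.1 ++ x :: a.2.2 = get (s a.1) r)
       (fun a => len a.1) (body x)
       (fun a => upd (upd (s a.1) r a.2.2) tmp a.2.1) (wf x)) ->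
  pprints ok len (For r tmp body) s
    (fun u => scan (fun d x v => wf x (u, (d, v))) [::] (get (s u) r)).
Proof.
move=> ne_r lt_r lt_tmp poly_b le_b s_tmp /fin_all_exists2[t poly_t run_body].
exists (fun n => b n * ((\sum_(x <- enum Sg) t x n) + 4) + 2).
  apply: polyfD (polyf_const 2); apply: polyfM => //; apply: polyfD (polyf_const 4).
  exact: polyf_sum.
move=> u ok_u o; apply: runs_le (runs_for_print (tb := \sum_(x <- enum Sg) t x (len u)) _ (size_s ok_u) ne_r lt_r lt_tmp (s_tmp _ ok_u) erefl _).
  by rewrite leq_add2r leq_mul2r le_b ?orbT.
move=> d x v o' v0E.
apply: runs_le (run_body x (u, (d, v)) (conj ok_u v0E) o').
by rewrite /= big_enum (bigD1 x) //= leq_addr.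
Qed.

Lemma scan_const (V W : Type) (a : seq W) (d v : seq V) :
  scan (fun _ _ _ => a) d v = flatten (nseq (size v) a).
Proof.
elim: v d => //= x v IHv d; rewrite IHv.
by elim: (size v) => [|n IHn] /=; rewrite ?cats0 // -catA IHn.
Qed.

Lemma pprints_repeat (r tmp : reg) b w :
    r != tmp -> r < K -> tmp < K -> polyf b ->
    (forall u, ok u -> size (get (s u) r) <= b (len u)) ->
    (forall u, ok u -> get (s u) tmp = [::]) ->
  pprints ok len (For r tmp (fun=> emit w)) s (fun u => flatten (nseq (size (get (s u) r)) w)).
Proof.
move=> ne_r lt_r lt_tmp poly_b le_b s_tmp.
apply: (pprints_ext (w := fun u => scan (fun d x v => w) [::] (get (s u) r))) => [u _|].
  exact: scan_const.
apply: (pprints_for (wf := fun _ _ => w)) poly_b le_b s_tmp _ => // x.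
exists (fun=> size w); first exact: polyf_const.
move=> a [ok_a _] o; apply: runs_emit.
by rewrite !size_upd ?size_upd ?size_s.
Qed.

End UniformPrint.
End Programs.

Lemma flatten_map_scan (U V W : Type) (h : V -> seq W) f d (s : seq U) :
  flatten (map h (scan f d s)) = scan (fun d x v => flatten (map h (f d x v))) d s.
Proof. by elim: s d => //= x s IHs d; rewrite map_cat flatten_cat IHs. Qed.

Lemma scan_map (U V W : Type) (h : U -> V) (f : seq V -> V -> seq V -> seq W) d s :
  scan f (map h d) (map h s) = scan (fun d x v => f (map h d) (h x) (map h v)) d s.
Proof. by elim: s d => //= x s IHs d; rewrite (IHs (x :: d)). Qed.

Lemma eq_scan (U V : Type) (f g : seq U -> U -> seq U -> seq V) d s :
  (forall d x v, f d x v = g d x v) -> scan f d s = scan g d s.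
Proof. by move=> eq_fg; elim: s d => //= x s IHs d; rewrite IHs eq_fg. Qed.

Lemma flatten_nseqD (T : Type) a b (w : seq T) :
  flatten (nseq a w) ++ flatten (nseq b w) = flatten (nseq (a + b) w).
Proof. by rewrite nseqD flatten_cat. Qed.

Lemma flatten_nseqM (T : Type) a b (w : seq T) :
  flatten (nseq a (flatten (nseq b w))) = flatten (nseq (a * b) w).
Proof. by elim: a => //= a ->; rewrite flatten_nseqD mulSn. Qed.

Lemma rev_flatten_nseq (T : Type) a (w : seq T) :
  rev (flatten (nseq a w)) = flatten (nseq a (rev w)).
Proof.
elim: a => //= a IHa; rewrite rev_cat IHa -[X in _ ++ X = _]cats0.
by rewrite -[rev w ++ [::]]/(flatten (nseq 1 (rev w))) flatten_nseqD addn1.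
Qed.

Arguments get : simpl never.
Arguments upd : simpl never.

(** * Printing the board *)

Section Printing.
Variables (G X : finType) (rules : seq (rule X)) (ic : G -> seq (seq X)).

Definition letter : finType := (G + option 'I_4)%type.
Notation cmd := (cmd 11 letter).
Notation store := (store letter).
Definition tick : letter := inr None.

Definition r_inp : 'I_12 := @Ordinal 12 0 isT.
Definition r_rev : 'I_12 := @Ordinal 12 1 isT.
Definition r_n : 'I_12 := @Ordinal 12 2 isT.
Definition r_c : 'I_12 := @Ordinal 12 3 isT.
Definition r_t : 'I_12 := @Ordinal 12 4 isT.
Definition r_row : 'I_12 := @Ordinal 12 5 isT.
Definition r_row' : 'I_12 := @Ordinal 12 6 isT.
Definition r_win : 'I_12 := @Ordinal 12 7 isT.
Definition r_win' : 'I_12 := @Ordinal 12 8 isT.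
Definition r_gap : 'I_12 := @Ordinal 12 9 isT.
Definition r_tmp : 'I_12 := @Ordinal 12 10 isT.

Definition column_word (cs : seq column) : seq letter := map (inr \o Some) (flatten cs).
Definition letter_word (s : seq 'I_4) := column_word [seq [:: x; c3; c0] | x <- s].
Definition literals_word (c : clause) := letter_word (flatten (map literal_word c)).
Definition door_word := column_word [:: [:: c0; c0; c0]].
Definition sep_word := column_word [:: [:: c3; c3; c0]].
Definition free_cell := literals_word (literals (fun _ : X => None)).

Arguments column_word : simpl never.
Arguments letter_word : simpl never.
Arguments literals_word : simpl never.
Arguments door_word : simpl never.
Arguments sep_word : simpl never.
Arguments free_cell : simpl never.

Lemma column_word_cat cs cs' : column_word (cs ++ cs') = column_word cs ++ column_word cs'.
Proof. by rewrite /column_word flatten_cat map_cat. Qed.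

Lemma letter_word_cat s s' : letter_word (s ++ s') = letter_word s ++ letter_word s'.
Proof. by rewrite /letter_word map_cat column_word_cat. Qed.

Lemma literals_word_cat c c' : literals_word (c ++ c') = literals_word c ++ literals_word c'.
Proof. by rewrite /literals_word map_cat flatten_cat letter_word_cat. Qed.

Lemma column_word_flatten ss : column_word (flatten ss) = flatten (map column_word ss).
Proof. by elim: ss => //= cs ss IHss; rewrite column_word_cat IHss. Qed.

Lemma column_word_nseq n cs : column_word (flatten (nseq n cs)) = flatten (nseq n (column_word cs)).
Proof. by rewrite column_word_flatten map_nseq. Qed.

Lemma letter_word_nseq n s : letter_word (flatten (nseq n s)) = flatten (nseq n (letter_word s)).
Proof. by elim: n => //= n IHn; rewrite letter_word_cat IHn. Qed.

Lemma literals_word_free n : literals_word (no_literals X n) = flatten (nseq n free_cell).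
Proof.
rewrite /no_literals; elim: n => //= n IHn.
by rewrite literals_word_cat IHn.
Qed.

Lemma gadget_word s : column_word (gadget s) = door_word ++ letter_word s ++ sep_word.
Proof. by rewrite /gadget -cat1s -cats1 !column_word_cat. Qed.

Lemma clause_gadget_word c : column_word (gadget (clause_word c)) =
  door_word ++ literals_word c ++ letter_word [:: c2; c0; c2; c0] ++ sep_word.
Proof. by rewrite gadget_word /clause_word letter_word_cat -!catA. Qed.

Definition gadgets_word (cs : seq clause) : seq letter :=
  flatten [seq column_word (gadget (clause_word c)) | c <- cs].

Lemma gadgets_word_cat cs cs' : gadgets_word (cs ++ cs') = gadgets_word cs ++ gadgets_word cs'.
Proof. by rewrite /gadgets_word map_cat flatten_cat. Qed.

Lemma cnf_gadgets_word n cnf : column_word (flatten (map gadget (cnf_words n cnf))) =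
  column_word (gadget (alternating c0 (n * 2).+1)) ++
  column_word (gadget (alternating c1 (n * 2).+1)) ++ gadgets_word cnf.
Proof. by rewrite column_word_flatten /cnf_words !map_cons -!map_comp. Qed.

Fixpoint print_all (cs : seq cmd) : cmd :=
  if cs is c :: cs' then Seq (print_all cs') c else Skip 11 letter.

Lemma pprints_all (U : Type) (ok : U -> Prop) (len : U -> nat) (s : U -> store)
    (T : Type) (f : T -> cmd) (wf : T -> U -> seq letter) l :
  (forall x, pprints ok len (f x) s (wf x)) ->
  pprints ok len (print_all (map f l)) s (fun u => flatten [seq wf x u | x <- l]).
Proof.
move=> run_f; elim: l => [|x l IHl] /=; last exact: pprints_seq.
exists (fun=> 0); first exact: polyf_const.
by move=> u _ o; apply: runs_skip.
Qed.

Definition repeat r w : cmd := For r r_tmp (fun=> emit 11 w).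

(** Prints [w] once per cell of the array, hence the two isolated copies. *)
Definition print_cells w : cmd :=
  Seq (emit 11 w) (Seq (emit 11 w) (Seq (repeat r_win w) (repeat r_row w))).

(** Within the loop over the windows, [r_win'] and [r_win] are as long as the parts of the array
    before the window and after it, and [r_gap] as the part between its two rows. *)
Definition print_rule (r : rule X) : cmd :=
  Seq (emit 11 (letter_word [:: c2; c0; c2; c0] ++ sep_word))
  (Seq (repeat r_win free_cell)
  (Seq (emit 11 (literals_word (literals (rule_literals r 3) ++
     literals (rule_literals r 4) ++ literals (rule_literals r 5))))
  (Seq (repeat r_gap free_cell)
  (Seq (emit 11 (literals_word (literals (rule_literals r 0) ++
     literals (rule_literals r 1) ++ literals (rule_literals r 2))))
  (Seq (repeat r_win' free_cell) (emit 11 door_word)))))).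

Definition print_first (c : seq X) : cmd :=
  Seq (emit 11 (letter_word [:: c2; c0; c2; c0] ++ sep_word))
  (Seq (repeat r_row free_cell)
  (Seq (emit 11 (free_cell ++ free_cell))
  (Seq (repeat r_win free_cell)
  (Seq (emit 11 (literals_word (literals (clause_literals c))))
  (Seq (repeat r_row' free_cell) (emit 11 door_word)))))).

Definition print_windows : cmd :=
  For r_win r_win' (fun=> print_all [seq print_rule r | r <- rules]).

Definition print_row : cmd :=
  For r_row r_row' (fun x =>
    if x is inl g then print_all [seq print_first c | c <- ic g] else Skip 11 letter).

Let m := #|X|.

Definition print_alternating c : cmd :=
  Seq (emit 11 (letter_word [:: c2; c] ++ sep_word))
  (Seq (print_cells (letter_word (flatten (nseq (m * 2) [:: c2; c])))) (emit 11 door_word)).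

(* The word is printed from right to left. *)
Definition print_board : cmd :=
  Seq (emit 11 (nseq 4 tick))
  (Seq (print_cells (nseq (m * 6) tick))
  (Seq (emit 11 (column_word clock_end))
  (Seq (print_cells (column_word (flatten (nseq (m * 2) clock_block))))
  (Seq (emit 11 door_word)
  (Seq print_row
  (Seq print_windows
  (Seq (print_alternating c1)
  (Seq (print_alternating c0)
  (Seq (print_cells (column_word (flatten (nseq (m * 2) (rev clock_block)))))
  (emit 11 (column_word (rev clock_end)))))))))))).

Section Correct.
Variables (U : Type) (ok : U -> Prop) (len : U -> nat) (s : U -> store)
  (row : U -> seq G) (W : U -> nat) (b_row b_win : nat -> nat).
Hypotheses (poly_row : polyf b_row) (poly_win : polyf b_win)
  (le_row : forall u, ok u -> size (row u) <= b_row (len u))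
  (le_win : forall u, ok u -> W u <= b_win (len u)).
Hypotheses (size_s : forall u, ok u -> size (s u) = 11)
  (s_row : forall u, ok u -> get (s u) r_row = map inl (row u))
  (s_row' : forall u, ok u -> get (s u) r_row' = [::])
  (s_win : forall u, ok u -> get (s u) r_win = nseq (W u) tick)
  (s_win' : forall u, ok u -> get (s u) r_win' = [::])
  (s_gap : forall u, ok u -> get (s u) r_gap = nseq (size (row u) - 3) tick)
  (s_tmp : forall u, ok u -> get (s u) r_tmp = [::]).

Lemma prints_cells w : pprints ok len (print_cells w) s
  (fun u => flatten (nseq (W u + size (row u) + 2) w)).
Proof.
apply: (pprints_ext (w := fun u =>
  (((flatten (nseq (size (get (s u) r_row)) w) ++ flatten (nseq (size (get (s u) r_win)) w)) ++ w) ++ w))).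
  move=> u ok_u; rewrite s_row // s_win // size_map size_nseq flatten_nseqD -catA.
  have -> : w ++ w = flatten (nseq 2 w) by rewrite /= cats0.
  by rewrite flatten_nseqD; congr (flatten (nseq _ _)); lia.
apply: pprints_seq; first exact: pprints_emit.
apply: pprints_seq; first exact: pprints_emit.
apply: pprints_seq.
  by apply: (pprints_repeat size_s (b := b_win)) => // u ok_u; rewrite s_win // size_nseq le_win.
by apply: (pprints_repeat size_s (b := b_row)) => // u ok_u; rewrite s_row // size_map le_row.
Qed.

Lemma prints_rule r : pprints (fun a : U * (seq letter * seq letter) =>
      ok a.1 /\ rev a.2.1 ++ tick :: a.2.2 = get (s a.1) r_win)
    (fun a => len a.1) (print_rule r)
    (fun a => upd (upd (s a.1) r_win a.2.2) r_win' a.2.1)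
  (fun a => column_word (gadget (clause_word
     (rule_clause (size (row a.1)) (size a.2.1) (size a.2.2) r)))).
Proof.
have size_a (a : U * (seq letter * seq letter)) : ok a.1 ->
    size (upd (upd (s a.1) r_win a.2.2) r_win' a.2.1) = 11.
  by move=> ok_a; rewrite !size_upd ?size_upd ?size_s.
have size_win a : ok a.1 /\ rev a.2.1 ++ tick :: a.2.2 = get (s a.1) r_win ->
    size a.2.1 + (size a.2.2).+1 = W a.1.
  case=> ok_a; rewrite s_win // => /(congr1 size).
  by rewrite size_cat size_rev size_nseq.
pose wd := fun a : U * (seq letter * seq letter) =>
  (((((door_word ++ flatten (nseq (size (get (upd (upd (s a.1) r_win a.2.2) r_win' a.2.1) r_win')) free_cell)) ++
  literals_word (literals (rule_literals r 0) ++ literals (rule_literals r 1) ++ literals (rule_literals r 2))) ++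
  flatten (nseq (size (get (upd (upd (s a.1) r_win a.2.2) r_win' a.2.1) r_gap)) free_cell)) ++
  literals_word (literals (rule_literals r 3) ++ literals (rule_literals r 4) ++ literals (rule_literals r 5))) ++
  flatten (nseq (size (get (upd (upd (s a.1) r_win a.2.2) r_win' a.2.1) r_win)) free_cell)) ++
  (letter_word [:: c2; c0; c2; c0] ++ sep_word).
apply: (pprints_ext (w := wd)).
  move=> [u [d v]] [/= ok_u _]; rewrite /wd /= clause_gadget_word /rule_clause !literals_word_cat.
  rewrite !literals_word_free !get_upd /= s_gap // size_nseq.
  by rewrite -!catA.
have ok_s (a : U * (seq letter * seq letter)) :
  ok a.1 /\ rev a.2.1 ++ tick :: a.2.2 = get (s a.1) r_win -> ok a.1 by case.
apply: pprints_seq; first by apply: pprints_emit => a /ok_s/size_a.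
apply: pprints_seq.
  apply: (pprints_repeat _ (b := b_win)) => //.
  - by move=> a /ok_s/size_a.
  - move=> a ok_a; cbv beta; rewrite !get_upd /=; apply: leq_trans (le_win (ok_s _ ok_a)).
    by rewrite -size_win //; apply: leq_trans (leqnSn _) (leq_addl _ _).
  - by move=> a ok_a; cbv beta; rewrite !get_upd /=; apply/s_tmp/(ok_s _ ok_a).
apply: pprints_seq; first by apply: pprints_emit => a /ok_s/size_a.
apply: pprints_seq.
  apply: (pprints_repeat _ (b := b_row)) => //.
  - by move=> a /ok_s/size_a.
  - move=> a ok_a; cbv beta; rewrite !get_upd /= s_gap ?size_nseq; last exact: ok_s ok_a.
    by apply: leq_trans (le_row (ok_s _ ok_a)); rewrite leq_subr.
  - by move=> a ok_a; cbv beta; rewrite !get_upd /=; apply/s_tmp/(ok_s _ ok_a).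
apply: pprints_seq; first by apply: pprints_emit => a /ok_s/size_a.
apply: pprints_seq; last by apply: pprints_emit => a /ok_s/size_a.
apply: (pprints_repeat _ (b := b_win)) => //.
- by move=> a /ok_s/size_a.
- move=> a ok_a; cbv beta; rewrite !get_upd /=; apply: leq_trans (le_win (ok_s _ ok_a)).
  by rewrite -size_win //; apply: leq_addr.
- by move=> a ok_a; cbv beta; rewrite !get_upd /=; apply/s_tmp/(ok_s _ ok_a).
Qed.

Lemma prints_first g c : pprints (fun a : U * (seq letter * seq letter) =>
      ok a.1 /\ rev a.2.1 ++ inl g :: a.2.2 = get (s a.1) r_row)
    (fun a => len a.1) (print_first c)
    (fun a => upd (upd (s a.1) r_row a.2.2) r_row' a.2.1)
  (fun a => column_word (gadget (clause_word
     (first_clause (size a.2.1) (W a.1 + 2 + size a.2.2) c)))).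
Proof.
have size_a (a : U * (seq letter * seq letter)) : ok a.1 ->
    size (upd (upd (s a.1) r_row a.2.2) r_row' a.2.1) = 11.
  by move=> ok_a; rewrite !size_upd ?size_upd ?size_s.
have size_row a : ok a.1 /\ rev a.2.1 ++ inl g :: a.2.2 = get (s a.1) r_row ->
    size a.2.1 + (size a.2.2).+1 = size (row a.1).
  case=> ok_a; rewrite s_row // => /(congr1 size).
  by rewrite size_cat size_rev size_map.
pose wd := fun a : U * (seq letter * seq letter) =>
  (((((door_word ++ flatten (nseq (size (get (upd (upd (s a.1) r_row a.2.2) r_row' a.2.1) r_row')) free_cell)) ++
  literals_word (literals (clause_literals c))) ++
  flatten (nseq (size (get (upd (upd (s a.1) r_row a.2.2) r_row' a.2.1) r_win)) free_cell)) ++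
  (free_cell ++ free_cell)) ++
  flatten (nseq (size (get (upd (upd (s a.1) r_row a.2.2) r_row' a.2.1) r_row)) free_cell)) ++
  (letter_word [:: c2; c0; c2; c0] ++ sep_word).
apply: (pprints_ext (w := wd)).
  move=> [u [d v]] [/= ok_u _]; rewrite /wd /= clause_gadget_word /first_clause !literals_word_cat.
  rewrite !literals_word_free !get_upd /= s_win // size_nseq.
  have -> : free_cell ++ free_cell = flatten (nseq 2 free_cell) by rewrite /= cats0.
  by rewrite -!flatten_nseqD -!catA.
have ok_s (a : U * (seq letter * seq letter)) :
  ok a.1 /\ rev a.2.1 ++ inl g :: a.2.2 = get (s a.1) r_row -> ok a.1 by case.
apply: pprints_seq; first by apply: pprints_emit => a /ok_s/size_a.
apply: pprints_seq.
  apply: (pprints_repeat _ (b := b_row)) => //.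
  - by move=> a /ok_s/size_a.
  - move=> a ok_a; cbv beta; rewrite !get_upd /=; apply: leq_trans (le_row (ok_s _ ok_a)).
    by rewrite -size_row //; apply: leq_trans (leqnSn _) (leq_addl _ _).
  - by move=> a ok_a; cbv beta; rewrite !get_upd /=; apply/s_tmp/(ok_s _ ok_a).
apply: pprints_seq; first by apply: pprints_emit => a /ok_s/size_a.
apply: pprints_seq.
  apply: (pprints_repeat _ (b := b_win)) => //.
  - by move=> a /ok_s/size_a.
  - move=> a ok_a; cbv beta; rewrite !get_upd /= s_win ?size_nseq; last exact: ok_s ok_a.
    exact: le_win (ok_s _ ok_a).
  - by move=> a ok_a; cbv beta; rewrite !get_upd /=; apply/s_tmp/(ok_s _ ok_a).
apply: pprints_seq; first by apply: pprints_emit => a /ok_s/size_a.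
apply: pprints_seq; last by apply: pprints_emit => a /ok_s/size_a.
apply: (pprints_repeat _ (b := b_row)) => //.
- by move=> a /ok_s/size_a.
- move=> a ok_a; cbv beta; rewrite !get_upd /=; apply: leq_trans (le_row (ok_s _ ok_a)).
  by rewrite -size_row //; apply: leq_addr.
- by move=> a ok_a; cbv beta; rewrite !get_upd /=; apply/s_tmp/(ok_s _ ok_a).
Qed.

Lemma prints_windows : pprints ok len print_windows s (fun u => gadgets_word
  (scan (fun d _ v => [seq rule_clause (size (row u)) (size d) (size v) r | r <- rules])
     [::] (nseq (W u) tick))).
Proof.
pose wf (x : letter) (a : U * (seq letter * seq letter)) : seq letter :=
  flatten [seq column_word (gadget (clause_word
     (rule_clause (size (row a.1)) (size a.2.1) (size a.2.2) r))) | r <- rules].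
apply: (pprints_ext (w := fun u => scan (fun d x v => wf x (u, (d, v))) [::] (get (s u) r_win))).
  move=> u ok_u; rewrite /gadgets_word flatten_map_scan s_win //.
  by apply: eq_scan => d x v; rewrite -map_comp.
apply: (pprints_for size_s (b := b_win)) => //.
- by move=> u ok_u; rewrite s_win // size_nseq le_win.
move=> x; have [/eqP->|nx] := boolP (x == tick).
  by apply: pprints_all => r; apply: prints_rule.
exists (fun=> 0); first exact: polyf_const.
move=> [u [d v]] [/= ok_u]; rewrite s_win // => E.
have : x \in nseq (W u) tick by rewrite -E mem_cat mem_head orbT.
by rewrite mem_nseq (negbTE nx) andbF.
Qed.

Lemma prints_row : pprints ok len print_row s (fun u => gadgets_word
  (scan (fun d g v => [seq first_clause (size d) (W u + 2 + size v) c | c <- ic g])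
     [::] (row u))).
Proof.
pose wf (x : letter) (a : U * (seq letter * seq letter)) : seq letter :=
  if x is inl g then
    flatten [seq column_word (gadget (clause_word
     (first_clause (size a.2.1) (W a.1 + 2 + size a.2.2) c))) | c <- ic g]
  else [::].
apply: (pprints_ext (w := fun u => scan (fun d x v => wf x (u, (d, v))) [::] (get (s u) r_row))).
  move=> u ok_u; rewrite /gadgets_word flatten_map_scan s_row //.
  rewrite (@scan_map _ _ _ (@inl G (option 'I_4)) _ [::]); apply: eq_scan => d x v.
  by rewrite -map_comp /= !size_map.
apply: (pprints_for size_s (b := b_row)) => //.
- by move=> u ok_u; rewrite s_row // size_map le_row.
case=> [g|o]; first by apply: pprints_all => c; apply: prints_first.
by exists (fun=> 0); [exact: polyf_const | move=> a _ o'; apply: runs_skip].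
Qed.

Let size_u u := (W u + size (row u) + 2) * m.

Lemma prints_alternating c : pprints ok len (print_alternating c) s (fun u =>
  column_word (gadget (alternating c (size_u u * 2).+1))).
Proof.
apply: (pprints_ext (w := fun u => (door_word ++
    flatten (nseq (W u + size (row u) + 2) (letter_word (flatten (nseq (m * 2) [:: c2; c]))))) ++
    (letter_word [:: c2; c] ++ sep_word))).
  move=> u ok_u; rewrite gadget_word /alternating -[(size_u u * 2).+1]addn1 -(flatten_nseqD (size_u u * 2) 1).
  rewrite letter_word_cat -!catA; congr (_ ++ (_ ++ _)).
  by rewrite /size_u -mulnA -[in RHS]flatten_nseqM [in RHS]letter_word_nseq.
apply: pprints_seq; first exact: pprints_emit.
apply: pprints_seq; first exact: prints_cells.
exact: pprints_emit.
Qed.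

(** A cell has [m] variables, hence [m * 2] clock blocks of three columns and [m * 6] units of the
    bound; the other 4 units are the end of the clock. *)
Lemma prints_board : pprints ok len print_board s (fun u => map inr
  (board_word (size_u u) (array_cnf rules ic (nseq (W u) tick) (row u)))).
Proof.
pose Q u := W u + size (row u) + 2.
apply: (pprints_ext (w := fun u =>
 ((((((((((column_word (rev clock_end) ++
   flatten (nseq (Q u) (column_word (flatten (nseq (m * 2) (rev clock_block)))))) ++
   column_word (gadget (alternating c0 (size_u u * 2).+1))) ++
   column_word (gadget (alternating c1 (size_u u * 2).+1))) ++
   gadgets_word (scan (fun d _ v => [seq rule_clause (size (row u)) (size d) (size v) r | r <- rules])
     [::] (nseq (W u) tick))) ++
   gadgets_word (scan (fun d g v => [seq first_clause (size d) (W u + 2 + size v) c | c <- ic g])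
     [::] (row u))) ++ door_word) ++
   flatten (nseq (Q u) (column_word (flatten (nseq (m * 2) clock_block))))) ++
   column_word clock_end) ++ flatten (nseq (Q u) (nseq (m * 6) tick))) ++ nseq 4 tick))).
  move=> u ok_u; rewrite /board_word /board_columns map_cat map_nseq -map_comp.
  rewrite -/(column_word _) (column_word_cat (rev _)) (column_word_cat (rcons _ _)) -cats1.
  rewrite (column_word_cat _ [:: _]) cnf_gadgets_word /clock rev_cat rev_flatten_nseq.
  rewrite (column_word_cat (rev _)) (column_word_cat (flatten (nseq _ clock_block))) -!catA.
  have blocks (b : seq column) : column_word (flatten (nseq (size_u u * 2) b)) =
      flatten (nseq (Q u) (column_word (flatten (nseq (m * 2) b)))).
    by rewrite /size_u -mulnA -[in LHS]flatten_nseqM column_word_nseq.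
  rewrite !blocks; congr (_ ++ (_ ++ _)).
  rewrite /array_cnf size_nseq gadgets_word_cat -!catA.
  do 7!congr (_ ++ _).
  rewrite -/(clock (size_u u * 2)) size_clock /size_u -/(Q u).
  have -> (a b : nat) : flatten (nseq a (nseq b tick)) = nseq (a * b) tick.
    by elim: a => //= a ->; rewrite -nseqD mulSn.
  by rewrite -nseqD; congr nseq; rewrite -!mulnA addn4.
apply: pprints_seq; first exact: pprints_emit.
apply: pprints_seq; first exact: prints_cells.
apply: pprints_seq; first exact: pprints_emit.
apply: pprints_seq; first exact: prints_cells.
apply: pprints_seq; first exact: pprints_emit.
apply: pprints_seq; first exact: prints_row.
apply: pprints_seq; first exact: prints_windows.
apply: pprints_seq; first exact: prints_alternating.
apply: pprints_seq; first exact: prints_alternating.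
by apply: pprints_seq; [exact: prints_cells | exact: pprints_emit].
Qed.

End Correct.
End Printing.

(** * Unary arithmetic on stacks *)

Section Counters.
Variables (K : nat) (Sg : finType).
Notation reg := 'I_K.+1.
Notation store := (store Sg).
Notation cmd := (cmd K Sg).

Lemma upd_upd (s : store) r v v' : upd (upd s r v) r v' = upd s r v'.
Proof. by rewrite /upd set_set_nth eqxx. Qed.

Lemma upd_comm (s : store) r r' v v' : r != r' -> upd (upd s r v) r' v' = upd (upd s r' v') r v.
Proof. by move=> ne_r; rewrite /upd set_set_nth (negbTE ne_r). Qed.

Lemma upd_get (s : store) r v : r < size s -> get s r = v -> upd s r v = s.
Proof.
move=> lt_r <-; apply: store_eq => [|i]; first exact: size_upd.
by rewrite get_upd; case: eqP => // ->.
Qed.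

(** Unlike in [runs_for_print], the body may change other stacks: [s d] is the store once the
    letters [d] have been visited. *)
Lemma runs_for (r tmp : reg) body (s : seq Sg -> store) v0 tb :
    r != tmp -> (forall d, r < size (s d)) -> (forall d, tmp < size (s d)) ->
    (forall d x v, rev d ++ x :: v = v0 ->
       runs (body x) (upd (upd (s d) r v) tmp d) (upd (upd (s (x :: d)) r v) tmp d) tb) ->
  runs (For r tmp body) (upd (upd (s [::]) r v0) tmp [::])
    (upd (upd (s (rev v0)) r v0) tmp [::]) (size v0 * (tb + 4) + 2).
Proof.
move=> ne_r lt_r lt_tmp run_body; have ne_r' : (r == tmp :> nat) = false by apply: negbTE.
have ne_tmp : (tmp == r :> nat) = false by rewrite eq_sym.
have loop v d : rev d ++ v = v0 ->
    runs (Loop r (fun x => Seq (body x) (Push tmp x))) (upd (upd (s d) r v) tmp d)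
      (upd (upd (s (rev v0)) r [::]) tmp (rev v0)) (size v * (tb + 2) + 1).
  elim: v d => [|x v IHv] d v0E.
    by rewrite -v0E cats0 revK /=; apply: runs_loop_nil; rewrite !get_upd ne_r' eqxx.
  have get_r : get (upd (upd (s d) r (x :: v)) tmp d) r = x :: v.
    by rewrite !get_upd ne_r' eqxx.
  have run1 := run_body d x v v0E.
  rewrite -[upd (s d) r v](upd_upd _ _ (x :: v)) upd_comm ?ne_r' // in run1.
  have := @runs_push K Sg tmp x (upd (upd (s (x :: d)) r v) tmp d).
  rewrite get_upd eqxx upd_upd => run2.
  have v0E' : rev (x :: d) ++ v = v0 by rewrite rev_cons cat_rcons.
  by apply: runs_le (runs_loop_cons get_r (runs_seq run1 run2) (IHv _ v0E')); rewrite /=; lia.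
have run1 := loop v0 [::] erefl.
have run2 := runs_restore [::] (rev v0) ne_r (lt_r (rev v0)) (lt_tmp (rev v0)).
have catrev_rev : catrev (rev v0) [::] = v0 by rewrite -/(rev _) revK.
rewrite catrev_rev size_rev in run2.
by apply: runs_le (runs_seq run1 run2); lia.
Qed.

Lemma pruns_for (U : Type) (ok : U -> Prop) (len : U -> nat) (r tmp : reg) body
    (s : U -> seq Sg -> store) v0 b :
    r != tmp -> polyf b -> (forall u, ok u -> size (v0 u) <= b (len u)) ->
    (forall u d, r < size (s u d)) -> (forall u d, tmp < size (s u d)) ->
    (forall x, pruns (fun a : U * (seq Sg * seq Sg) =>
         ok a.1 /\ rev a.2.1 ++ x :: a.2.2 = v0 a.1)
       (fun a => len a.1) (body x)
       (fun a => upd (upd (s a.1 a.2.1) r a.2.2) tmp a.2.1)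
       (fun a => upd (upd (s a.1 (x :: a.2.1)) r a.2.2) tmp a.2.1)) ->
  pruns ok len (For r tmp body) (fun u => upd (upd (s u [::]) r (v0 u)) tmp [::])
    (fun u => upd (upd (s u (rev (v0 u))) r (v0 u)) tmp [::]).
Proof.
move=> ne_r poly_b le_b lt_r lt_tmp /fin_all_exists2[t poly_t run_body].
exists (fun n => b n * ((\sum_(x <- enum Sg) t x n) + 4) + 2).
  apply: polyfD (polyf_const 2); apply: polyfM => //; apply: polyfD (polyf_const 4).
  exact: polyf_sum.
move=> u ok_u; apply: runs_le (runs_for (tb := \sum_(x <- enum Sg) t x (len u)) ne_r (lt_r u) (lt_tmp u) _).
  by rewrite leq_add2r leq_mul2r le_b ?orbT.
move=> d x v v0E; apply: runs_le (run_body x (u, (d, v)) (conj ok_u v0E)).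
by rewrite /= big_enum (bigD1 x) //= leq_addr.
Qed.

Lemma pruns_pushE (U : Type) (ok : U -> Prop) (len : U -> nat) (r : reg) x (s s' : U -> store) :
  (forall u, ok u -> upd (s u) r (x :: get (s u) r) = s' u) -> pruns ok len (Push r x) s s'.
Proof.
move=> sE; exists (fun=> 1); first exact: polyf_const.
by move=> u ok_u; rewrite -sE //; apply: runs_push.
Qed.

Fixpoint push_all (r : reg) (w : seq Sg) : cmd :=
  if w is x :: w' then Seq (push_all r w') (Push r x) else Skip K Sg.

Lemma pruns_push_all (U : Type) (ok : U -> Prop) (len : U -> nat) (r : reg) w (s s' : U -> store) :
  (forall u, ok u -> r < size (s u)) ->
  (forall u, ok u -> upd (s u) r (w ++ get (s u) r) = s' u) -> pruns ok len (push_all r w) s s'.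
Proof.
move=> lt_r; elim: w s' => [|x w IHw] s' sE /=.
  apply: (pruns_ext (s := s) (s' := s)) => // [u ok_u|]; last exact: pruns_skip.
  by rewrite -sE // upd_get ?lt_r.
apply: pruns_seq (IHw _ (fun u _ => erefl)) _.
by apply: pruns_pushE => u ok_u; rewrite get_upd eqxx upd_upd -sE.
Qed.

Section Horner.
Variables (tick : Sg) (x acc acc2 tmp : reg).
Hypotheses (ne_xa : x != acc) (ne_xa2 : x != acc2) (ne_xt : x != tmp)
  (ne_aa2 : acc != acc2) (ne_at : acc != tmp) (ne_a2t : acc2 != tmp).

Definition mul_cmd : cmd :=
  Seq (Loop acc (fun=> For x tmp (fun=> Push acc2 tick))) (Loop acc2 (fun y => Push acc y)).

Fixpoint horner_cmd (p : seq nat) : cmd :=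
  if p is a :: p' then Seq (horner_cmd p') (Seq mul_cmd (push_all acc (nseq a tick)))
  else Skip K Sg.

Variables (U : Type) (ok : U -> Prop) (len : U -> nat) (s : U -> store)
  (xv : U -> nat) (b : nat -> nat).
Hypotheses (poly_b : polyf b) (le_b : forall u, ok u -> xv u <= b (len u))
  (size_s : forall u, size (s u) = K.+1)
  (s_x : forall u, ok u -> get (s u) x = nseq (xv u) tick)
  (s_acc2 : forall u, ok u -> get (s u) acc2 = [::])
  (s_tmp : forall u, ok u -> get (s u) tmp = [::]).

Lemma pruns_mul k bk : polyf bk -> (forall u, ok u -> k u <= bk (len u)) ->
  pruns ok len mul_cmd (fun u => upd (s u) acc (nseq (k u) tick))
    (fun u => upd (s u) acc (nseq (k u * xv u) tick)).
Proof.
move=> poly_k le_k.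
have neN (r r' : reg) : r != r' -> (r == r' :> nat) = false by move/negbTE.
have neN' (r r' : reg) : r != r' -> (r' == r :> nat) = false by rewrite [_ == _ :> nat]eq_sym => /negbTE.
have lt_r (r : reg) u : r < size (s u) by rewrite size_s.
(* Each letter already popped from [acc] has left [xv u] ticks on [acc2]. *)
pose I1 u v := upd (upd (s u) acc2 (nseq ((k u - size v) * xv u) tick)) acc v.
apply: (pruns_seq (s1 := fun u => I1 u [::])).
  apply: (pruns_ext (s := fun u => I1 u (nseq (k u) tick)) (s' := fun u => I1 u [::])) => // [u ok_u|].
    by rewrite /I1 size_nseq subnn [upd (s u) acc2 _]upd_get ?s_acc2.
  apply: (pruns_loop (b := bk)) => // [u ok_u|u v|y]; first by rewrite size_nseq le_k.
    by rewrite get_upd eqxx.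
  pose s' (a : U * seq Sg) (d : seq Sg) :=
    upd (upd (s a.1) acc2 (nseq (size d + (k a.1 - (size a.2).+1) * xv a.1) tick)) acc a.2.
  apply: (pruns_ext (s := fun a => upd (upd (s' a [::]) x (nseq (xv a.1) tick)) tmp [::])
      (s' := fun a => upd (upd (s' a (rev (nseq (xv a.1) tick))) x (nseq (xv a.1) tick)) tmp [::])).
  - move=> [u v] [/= ok_u _]; rewrite /s' /I1 /= add0n upd_upd.
    rewrite [upd _ x _]upd_get ?[upd _ tmp _]upd_get // ?size_upd //.
    + by rewrite !get_upd ![_ == acc :> nat]eq_sym !neN // ?[_ == acc2]eq_sym // s_tmp.
    + by rewrite !get_upd !neN // s_x.
  - move=> [u v] [/= ok_u [d E]]; rewrite /s' /I1 /= size_rev size_nseq.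
    have k_v : (size v).+1 <= k u.
      by move/(congr1 size): E; rewrite size_cat size_nseq /= => <-; apply: leq_addl.
    have -> : xv u + (k u - (size v).+1) * xv u = (k u - size v) * xv u.
      by rewrite -mulSn subnSK.
    rewrite [upd _ x _]upd_get ?[upd _ tmp _]upd_get // ?size_upd //.
    + by rewrite !get_upd ![_ == acc :> nat]eq_sym !neN // ?[_ == acc2]eq_sym // s_tmp.
    + by rewrite !get_upd !neN // s_x.
  apply: (pruns_for (b := b)) => //.
  - by move=> [u v] [/= ok_u _]; rewrite size_nseq le_b.
  - by move=> [u v] d; rewrite /s' !size_upd // ?size_upd.
  - by move=> [u v] d; rewrite /s' !size_upd // ?size_upd.
  move=> z; apply: pruns_pushE => -[[u v] [d v']] [[/= ok_u _] _]; rewrite /s' /=.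
  rewrite !get_upd (neN _ _ ne_a2t) (neN' _ _ ne_xa2) (neN' _ _ ne_aa2) eqxx.
  rewrite (@upd_comm _ tmp acc2) ?(neN' _ _ ne_a2t) //.
  rewrite (@upd_comm _ x acc2) // (@upd_comm _ acc acc2) // upd_upd; congr upd.
apply: (pruns_ext (s := fun u => I1 u [::]) (s' := fun u => upd (s u) acc (nseq (k u * xv u) tick))) => //.
exists (fun n => bk n * b n * 2 + 1).
  by apply: polyfD (polyf_const 1); apply: polyfM (polyf_const 2); apply: polyfM.
move=> u ok_u; rewrite /I1 subn0 upd_comm ?(eq_sym (acc2 : nat)) //.
have := runs_restore (s := s u) [::] (nseq (k u * xv u) tick) ne_aa2 (lt_r _ _) (lt_r _ _).
rewrite -/(rev _) rev_nseq size_nseq [upd _ acc2 [::]]upd_get ?size_upd //; last first.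
  by rewrite get_upd (eq_sym (acc2 : nat)) neN // s_acc2.
by apply: runs_le; rewrite leq_add2r leq_mul2r leq_mul ?le_k ?le_b.
Qed.

(** A polynomial bound on the intermediate value is carried along, since that value is the number of
    rounds of the next multiplication. *)
Lemma pruns_horner (p : seq nat) : (forall u, ok u -> get (s u) acc = [::]) ->
  (exists2 bp, polyf bp & forall u, ok u -> horner_rec p (xv u) <= bp (len u)) /\
  pruns ok len (horner_cmd p) s (fun u => upd (s u) acc (nseq (horner_rec p (xv u)) tick)).
Proof.
move=> s_acc; have lt_r (r : reg) u : r < size (s u) by rewrite size_s.
elim: p => [|a p [[bp poly_bp le_bp] run_p]] /=.
  split; first by exists (fun=> 0) => //; apply: polyf_const.
  apply: (pruns_ext (s := s) (s' := s)) => // [u ok_u|]; last exact: pruns_skip.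
  by rewrite upd_get ?s_acc.
split.
  exists (fun n => bp n * b n + a); first by apply: polyfD (polyf_const a); apply: polyfM.
  by move=> u ok_u; apply: leq_add => //; apply: leq_mul; [apply: le_bp | apply: le_b].
apply: pruns_seq run_p _; apply: pruns_seq (pruns_mul poly_bp le_bp) _.
apply: pruns_push_all => u ok_u; first by rewrite size_upd.
rewrite get_upd eqxx upd_upd -nseqD; congr upd; congr nseq.
by rewrite addnC.
Qed.

End Horner.
End Counters.

(** * Preparing the registers *)

Section Setup.
Variables (A : finType) (p1 pv : {poly nat}).
Notation sym := (letter (kind A)).
Notation cmd := (cmd 11 sym).
Notation store := (store sym).
Notation tick := (tick (kind A)).

Definition k_letter (g : kind A) : sym := inl g.

Definition registers (reg_rev reg_n reg_c reg_t reg_row reg_win reg_gap : seq sym) : store :=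
  [:: [::]; reg_rev; reg_n; reg_c; reg_t; reg_row; [::]; reg_win; [::]; reg_gap; [::]; [::]].

Let word (w : seq A) : seq sym := map (fun a => k_letter (inl a)) w.
Let ok (w : seq A) := True.
Let len (w : seq A) := size w.
Let C (w : seq A) := p1.[size w]%R.
(** The time bound of the verifier for a certificate of maximal length. *)
Let T (w : seq A) := pv.[size w + C w]%R.

Lemma polyf_C : polyf (fun n => p1.[n]%R). Proof. exact: polyf_horner. Qed.

Lemma polyf_T : polyf (fun n => pv.[n + p1.[n]]%R).
Proof. by exists (pv \Po ('X + p1))%R => n; rewrite horner_comp hornerD hornerX. Qed.

Definition read_input : cmd := Loop r_inp (fun x => Seq (Push r_rev x) (Push r_n tick)).

Lemma run_read_input : pruns ok len read_input
  (fun w => word w :: nseq 11 [::])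
  (fun w => registers (rev (word w)) (nseq (size w) tick) [::] [::] [::] [::] [::]).
Proof.
pose I (w : seq A) (v : seq sym) : store :=
  [:: v; rev (take (size w - size v) (word w)); nseq (size w - size v) tick;
      [::]; [::]; [::]; [::]; [::]; [::]; [::]; [::]; [::]].
have size_word w : size (word w) = size w by rewrite size_map.
apply: (pruns_ext (s := fun w => I w (word w)) (s' := fun w => I w [::])).
- by move=> w _; rewrite /I size_word subnn take0.
- by move=> w _; rewrite /I subn0 take_oversize ?size_word.
apply: (pruns_loop (b := id)) => //; first exact: polyf_id.
  by move=> w _; rewrite size_word.
move=> x; apply: (pruns_seq (s1 := fun a => upd (upd (I a.1 (x :: a.2)) r_inp a.2) r_rev
   (x :: get (I a.1 (x :: a.2)) r_rev))); first exact: pruns_pushE.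
apply: pruns_pushE => -[w v] [_ [d /= E]]; rewrite /I /= /upd /get /=.
have size_d : size w = size d + (size v).+1.
  by move/(congr1 size): E; rewrite size_cat size_word => <-.
rewrite -E size_d addnK addnS -addSn addnK.
by rewrite take_size_cat // -cat_rcons take_size_cat ?size_rcons // rev_rcons.
Qed.

Definition count_input : cmd := For r_c r_tmp (fun=> Push r_n tick).

Lemma run_count_input (rv : seq A -> seq sym) : pruns ok len count_input
  (fun w => registers (rv w) (nseq (size w) tick) (nseq (C w) tick) [::] [::] [::] [::])
  (fun w => registers (rv w) (nseq (size w + C w) tick) (nseq (C w) tick) [::] [::] [::] [::]).
Proof.
pose s w (d : seq sym) := registers (rv w) (nseq (size d + size w) tick) [::] [::] [::] [::] [::].
apply: (pruns_ext (s := fun w => upd (upd (s w [::]) r_c (nseq (C w) tick)) r_tmp [::])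
  (s' := fun w => upd (upd (s w (rev (nseq (C w) tick))) r_c (nseq (C w) tick)) r_tmp [::])) => //.
  by move=> w _; rewrite /s size_rev size_nseq addnC.
apply: (pruns_for (b := fun n => p1.[n]%R)) => //; first exact: polyf_C.
  by move=> w _; rewrite size_nseq.
by move=> x; apply: pruns_pushE.
Qed.

(** The ticks on [r_gap] count the letters put on the row. *)
Definition repeat2 r x : cmd := For r r_tmp (fun=> Seq (Push r_row x) (Push r_gap tick)).

Lemma run_repeat2 x (rv rn rc rr rg : seq A -> seq sym) : pruns ok len (repeat2 r_t x)
  (fun w => registers (rv w) (rn w) (rc w) (nseq (T w) tick) (rr w) [::] (rg w))
  (fun w => registers (rv w) (rn w) (rc w) (nseq (T w) tick) (nseq (T w) x ++ rr w) [::]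
    (nseq (T w) tick ++ rg w)).
Proof.
pose s w (d : seq sym) := registers (rv w) (rn w) (rc w) [::] (nseq (size d) x ++ rr w) [::]
  (nseq (size d) tick ++ rg w).
apply: (pruns_ext (s := fun w => upd (upd (s w [::]) r_t (nseq (T w) tick)) r_tmp [::])
  (s' := fun w => upd (upd (s w (rev (nseq (T w) tick))) r_t (nseq (T w) tick)) r_tmp [::])) => //.
  by move=> w _; rewrite /s size_rev size_nseq.
apply: (pruns_for (b := fun n => pv.[n + p1.[n]]%R)) => //; first exact: polyf_T.
  by move=> w _; rewrite size_nseq.
move=> y; apply: (pruns_seq (s1 := fun a => upd (upd (upd (s a.1 a.2.1) r_t a.2.2) r_tmp a.2.1) r_row
  (x :: nseq (size a.2.1) x ++ rr a.1))); exact: pruns_pushE.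
Qed.

Definition move_row (r : 'I_12) (f : sym -> sym) : cmd :=
  Loop r (fun x => Seq (Push r_row (f x)) (Push r_gap tick)).

Lemma run_move_cert (rv rn rt rr rg : seq A -> seq sym) x :
  pruns ok len (move_row r_c (fun=> x))
  (fun w => registers (rv w) (rn w) (nseq (C w) tick) (rt w) (rr w) [::] (rg w))
  (fun w => registers (rv w) (rn w) [::] (rt w) (nseq (C w) x ++ rr w) [::]
    (nseq (C w) tick ++ rg w)).
Proof.
pose I w (v : seq sym) := registers (rv w) (rn w) v (rt w) (nseq (C w - size v) x ++ rr w) [::]
  (nseq (C w - size v) tick ++ rg w).
apply: (pruns_ext (s := fun w => I w (nseq (C w) tick)) (s' := fun w => I w [::])).
- by move=> w _; rewrite /I size_nseq subnn.
- by move=> w _; rewrite /I subn0.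
apply: (pruns_loop (b := fun n => p1.[n]%R)) => //; first exact: polyf_C.
  by move=> w _; rewrite size_nseq.
move=> y; apply: (pruns_seq (s1 := fun a => upd (upd (I a.1 (y :: a.2)) r_c a.2) r_row
   (x :: get (I a.1 (y :: a.2)) r_row))); first exact: pruns_pushE.
apply: pruns_pushE => -[w v] [_ [d /= E]]; rewrite /I /= /upd /get /=.
have size_d : C w = size d + (size v).+1.
  by move/(congr1 size): E; rewrite size_cat size_nseq => <-.
by rewrite size_d addnK addnS -addSn addnK.
Qed.

Lemma run_move_input (rn rc rt rr rg : seq A -> seq sym) :
  pruns ok len (move_row r_rev id)
  (fun w => registers (rev (word w)) (rn w) (rc w) (rt w) (rr w) [::] (rg w))
  (fun w => registers [::] (rn w) (rc w) (rt w) (word w ++ rr w) [::]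
    (nseq (size w) tick ++ rg w)).
Proof.
have size_word w : size (rev (word w)) = size w by rewrite size_rev size_map.
pose I w (v : seq sym) := registers v (rn w) (rc w) (rt w)
  (rev (take (size w - size v) (rev (word w))) ++ rr w) [::]
  (nseq (size w - size v) tick ++ rg w).
apply: (pruns_ext (s := fun w => I w (rev (word w))) (s' := fun w => I w [::])).
- by move=> w _; rewrite /I size_word subnn take0.
- by move=> w _; rewrite /I subn0 take_oversize ?size_word // revK.
apply: (pruns_loop (b := id)) => //; first exact: polyf_id.
  by move=> w _; rewrite size_word.
move=> x; apply: (pruns_seq (s1 := fun a => upd (upd (I a.1 (x :: a.2)) r_rev a.2) r_row
   (x :: get (I a.1 (x :: a.2)) r_row))); first exact: pruns_pushE.
apply: pruns_pushE => -[w v] [_ [d /= E]]; rewrite /I /= /upd /get /=.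
have size_d : size w = size d + (size v).+1.
  by move/(congr1 size): E; rewrite size_cat size_word => <-.
rewrite -E size_d addnK addnS -addSn addnK.
by rewrite take_size_cat // -cat_rcons take_size_cat ?size_rcons // rev_rcons.
Qed.

(** The row is pushed from its right end. The end, one blank and the mark come without a tick, so
    [r_gap] receives three ticks less than the length of the row. *)
Definition build_row : cmd :=
  Seq (Push r_row (k_letter (k_end A)))
  (Seq (repeat2 r_t (k_letter (k_blank A)))
  (Seq (Push r_row (k_letter (k_blank A)))
  (Seq (move_row r_c (fun=> k_letter (k_cert A)))
  (Seq (move_row r_rev id)
  (Seq (Push r_row (k_letter (k_mark A)))
  (Seq (repeat2 r_t (k_letter (k_left A)))
  (Seq (Push r_row (k_letter (k_left A))) (Push r_gap tick)))))))).

Let row w := first_row w (C w) (T w).+1.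

Lemma run_build_row (rn : seq A -> seq sym) : pruns ok len build_row
  (fun w => registers (rev (word w)) (rn w) (nseq (C w) tick) (nseq (T w) tick) [::] [::] [::])
  (fun w => registers [::] (rn w) [::] (nseq (T w) tick) (map k_letter (row w)) [::]
     (nseq (size (row w) - 3) tick)).
Proof.
apply: (pruns_seq (s1 := fun w => registers (rev (word w)) (rn w) (nseq (C w) tick)
  (nseq (T w) tick) [:: k_letter (k_end A)] [::] [::])); first exact: pruns_pushE.
apply: pruns_seq (run_repeat2 _ _ _ _ _ _) _.
apply: (pruns_seq (s1 := fun w => registers (rev (word w)) (rn w) (nseq (C w) tick)
  (nseq (T w) tick) (nseq (T w).+1 (k_letter (k_blank A)) ++ [:: k_letter (k_end A)]) [::]
  (nseq (T w) tick ++ [::]))); first exact: pruns_pushE.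
apply: pruns_seq (run_move_cert _ _ _ _ _ _) _.
apply: pruns_seq (run_move_input _ _ _ _ _) _.
pose rr w := k_letter (k_mark A) :: word w ++ nseq (C w) (k_letter (k_cert A)) ++
  nseq (T w).+1 (k_letter (k_blank A)) ++ [:: k_letter (k_end A)].
pose gg w := nseq (size w) tick ++ nseq (C w) tick ++ nseq (T w) tick ++ [::].
apply: (pruns_seq (s1 := fun w => registers [::] (rn w) [::] (nseq (T w) tick) (rr w) [::] (gg w)));
  first exact: pruns_pushE.
apply: pruns_seq (run_repeat2 _ _ _ _ _ _) _.
apply: (pruns_seq (s1 := fun w => registers [::] (rn w) [::] (nseq (T w) tick)
  (k_letter (k_left A) :: nseq (T w) (k_letter (k_left A)) ++ rr w) [::] (nseq (T w) tick ++ gg w)));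
  first exact: pruns_pushE.
apply: pruns_pushE => w _; rewrite /upd /get /=; congr [:: _; _; _; _; _; _; _; _; _; _; _; _].
- rewrite /row /first_row -cats1 !(map_cat, map_cons, map_nseq) -map_comp.
  by rewrite /rr /word.
rewrite /gg cats0 -!nseqD -[tick :: _]/(nseq _.+1 tick) /row /first_row; congr nseq.
by rewrite !(size_cat, size_nseq, size_map) /= !(size_cat, size_nseq, size_map) /= size_rcons size_nseq; lia.
Qed.

Definition count_row : cmd := For r_row r_row' (fun=> Push r_win tick).
(** One more round than [r_t] has ticks, for [(T w).+1] rows. *)
Definition count_windows : cmd := Seq (For r_t r_tmp (fun=> count_row)) count_row.

Let P w := size (row w).

Lemma polyf_P : polyf (fun n => (pv.[n + p1.[n]]).+1 * 2 + n + p1.[n] + 2)%R.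
Proof.
apply: polyfD (polyf_const 2); apply: polyfD polyf_C; apply: polyfD polyf_id.
apply: polyfM (polyf_const 2); apply: (polyf_le (t' := fun n => pv.[n + p1.[n]]%R + 1)) => [n|].
  by rewrite addn1.
exact: polyfD polyf_T (polyf_const 1).
Qed.

Lemma run_count_row (U : Type) (ok' : U -> Prop) (len' : U -> nat) (f : U -> seq A)
    (rn rt tmp gg : U -> seq sym) (a : U -> nat) :
  (forall u, ok' u -> len' u = size (f u)) ->
  pruns ok' len' count_row
  (fun u => [:: [::]; [::]; rn u; [::]; rt u; map k_letter (row (f u)); [::]; nseq (a u) tick; [::];
     gg u; tmp u; [::]])
  (fun u => [:: [::]; [::]; rn u; [::]; rt u; map k_letter (row (f u)); [::];
     nseq (P (f u) + a u) tick; [::]; gg u; tmp u; [::]]).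
Proof.
move=> len_f.
pose s u (d : seq sym) : store := [:: [::]; [::]; rn u; [::]; rt u; [::]; [::];
  nseq (size d + a u) tick; [::]; gg u; tmp u; [::]].
pose v0 u := map k_letter (row (f u)).
apply: (pruns_ext (s := fun u => upd (upd (s u [::]) r_row (v0 u)) r_row' [::])
  (s' := fun u => upd (upd (s u (rev (v0 u))) r_row (v0 u)) r_row' [::])) => //.
  by move=> u _; rewrite /s size_rev size_map.
apply: (pruns_for (b := fun n => (pv.[n + p1.[n]]).+1 * 2 + n + p1.[n] + 2)%R) => //.
- exact: polyf_P.
- by move=> u ok_u; rewrite size_map /row size_first_row len_f.
by move=> x; apply: pruns_pushE.
Qed.

Lemma run_count_windows (rn gg : seq A -> seq sym) : pruns ok len count_windows
  (fun w => registers [::] (rn w) [::] (nseq (T w) tick) (map k_letter (row w)) [::] (gg w))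
  (fun w => registers [::] (rn w) [::] (nseq (T w) tick) (map k_letter (row w))
     (nseq ((T w).+1 * P w) tick) (gg w)).
Proof.
apply: (pruns_seq (s1 := fun w => registers [::] (rn w) [::] (nseq (T w) tick)
    (map k_letter (row w)) (nseq (T w * P w) tick) (gg w))); last first.
  by apply: (run_count_row (f := id)).
pose s w (d : seq sym) := registers [::] (rn w) [::] [::] (map k_letter (row w))
  (nseq (size d * P w) tick) (gg w).
apply: (pruns_ext (s := fun w => upd (upd (s w [::]) r_t (nseq (T w) tick)) r_tmp [::])
  (s' := fun w => upd (upd (s w (rev (nseq (T w) tick))) r_t (nseq (T w) tick)) r_tmp [::])) => //.
  by move=> w _; rewrite /s size_rev size_nseq.
apply: (pruns_for (b := fun n => pv.[n + p1.[n]]%R)) => //; first exact: polyf_T.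
  by move=> w _; rewrite size_nseq.
move=> y; apply: (run_count_row (f := fun a => a.1)) => //.
Qed.

End Setup.

Lemma wf_rules (M : machine) (out : bool -> symbol M) : all (@wf_rule (bit M)) (rules out).
Proof.
have wf_ctx s a o x : o != 1 ->
    all (fun y => (y.1 < 6) && (y \notin [:: (o, x)])) (@ctx M s a).
  move=> o_n1; rewrite /= inE xpair_eqE /= eq_sym (negbTE o_n1) /= all_map.
  by apply/allP => i _; rewrite /= inE xpair_eqE /= eq_sym (negbTE o_n1).
have target_n1 d : target d != 1 by case: d.
have target_lt d : target d < 6 by case: d.
rewrite /rules !all_cat.
apply/andP; split=> //.
do 5!(apply/andP; split;
  first by apply/all_enumP).
apply/andP; split; first by apply/all_enumP => y _; rewrite /wf_rule wf_ctx.
apply/andP; split.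
  apply/all_enumP => -[[s a] i] _; rewrite /wf_rule /write_rule; cbv zeta.
  rewrite -cat1s all_cat wf_ctx /=; last exact: target_n1.
  by rewrite target_lt; case: (tnth _ _).2.
apply/andP; split.
  apply/all_enumP => -[[s a] [i x]] _; rewrite /wf_rule /shift_rule; cbv zeta.
  rewrite -(cat1s (1, _)) -(cat1s (0, b_nmark M)) !all_cat wf_ctx /=; last exact: target_n1.
  by rewrite target_lt; case: (tnth _ _).2.
by apply/andP; split; apply/all_enumP => y _.
Qed.

(** * The reduction *)

Section HardnessReduction.
Variables (A : finType) (M : machine) (inp : A + bool -> symbol M) (out : bool -> symbol M)
  (p1 pv : {poly nat}).
Notation sym := (letter (kind A)).
Notation tick := (tick (kind A)).

Let C (w : seq A) := p1.[size w]%R.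
Let T (w : seq A) := pv.[size w + C w]%R.
(** One row more than the time bound: with [T] rows, [array_sound] examines the configuration after
    [T.-1] steps. *)
Let row w := first_row w (C w) (T w).+1.
Let W w := (T w).+1 * size (row w).
Let cnf w := array_cnf (rules out) (kind_clauses inp) (nseq (W w) tick) (row w).

Definition reduction w := board_word ((W w + size (row w) + 2) * #|bit M|) (cnf w).

Definition compute_bound (p : {poly nat}) r : cmd 11 sym := horner_cmd tick r_n r r_row' r_tmp p.

Definition reduction_cmd : cmd 11 sym :=
  Seq (read_input A)
  (Seq (compute_bound p1 r_c)
  (Seq (count_input A)
  (Seq (compute_bound pv r_t)
  (Seq (build_row A)
  (Seq (count_windows A) (print_board (rules out) (kind_clauses inp))))))).

Lemma run_compute_bound (p : {poly nat}) (r : 'I_12) (s : seq A -> store sym) (xv : seq A -> nat) b :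
  polyf b -> (forall w, xv w <= b (size w)) ->
  r \notin [:: r_n; r_row'; r_tmp] ->
  (forall w, size (s w) = 12) -> (forall w, get (s w) r_n = nseq (xv w) tick) ->
  (forall w, [/\ get (s w) r = [::], get (s w) r_row' = [::] & get (s w) r_tmp = [::]]) ->
  pruns (fun=> True) size (compute_bound p r) s (fun w => upd (s w) r (nseq p.[xv w]%R tick)).
Proof.
move=> poly_b le_b; rewrite !inE !negb_or => /and3P[r1 r2 r3] size_s s_x s_r.
have [] // := @pruns_horner 11 sym tick r_n r r_row' r_tmp _ _ _ _ _ _ _ (fun=> True) size s xv b
   _ _ _ _ _ _ p => //.
- by rewrite eq_sym.
- by move=> w _; case: (s_r w).
- by move=> w _; case: (s_r w).
- by move=> w _; case: (s_r w).
Qed.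

Lemma polyf_windows : exists2 b, polyf b & forall w, size (row w) <= b (size w) /\ W w <= b (size w).
Proof.
pose b n := (pv.[n + p1.[n]].+1 * 2 + n + p1.[n] + 2)%R.
have poly_b : polyf b by apply: polyf_P.
exists (fun n => (pv.[n + p1.[n]].+1 * b n)%R).
  apply: polyfM poly_b; apply: (polyf_le (t' := fun n => pv.[n + p1.[n]]%R + 1)) => [n|].
    by rewrite addn1.
  exact: polyfD (polyf_T _ _) (polyf_const 1).
move=> w; have -> : size (row w) = b (size w) by rewrite size_first_row.
by split; [apply: leq_pmull | rewrite /W size_first_row].
Qed.

Lemma run_reduction : exists2 t, polyf t & forall w, exists2 s,
  runs reduction_cmd (map (fun a => inl (inl a)) w :: nseq 11 [::]) s (t (size w)) &
  get s 11 = map inr (reduction w).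
Proof.
have [b poly_b le_b] := polyf_windows.
pose s w : store sym := [:: [::]; [::]; nseq (size w + C w) tick; [::]; nseq (T w) tick;
  map inl (row w); [::]; nseq (W w) tick; [::]; nseq (size (row w) - 3) tick; [::]].
suff [t poly_t run_t] : pruns (fun=> True) size reduction_cmd
    (fun w => map (fun a => inl (inl a)) w :: nseq 11 [::])
    (fun w => rcons (s w) (map inr (reduction w) ++ [::])).
  exists t => // w; exists (rcons (s w) (map inr (reduction w) ++ [::])); first exact: run_t.
  by rewrite cats0.
apply: pruns_seq (run_read_input A) _.
apply: pruns_seq; first exact: (run_compute_bound (xv := size) p1 (r := r_c) polyf_id).
apply: pruns_seq (run_count_input p1 _) _.
apply: pruns_seq.
  exact: (run_compute_bound (xv := fun w => size w + C w) pv (r := r_t)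
    (polyfD polyf_id (polyf_C p1))).
apply: pruns_seq (run_build_row p1 pv _) _.
apply: pruns_seq; first exact: run_count_windows.
have [] // := @prints_board (kind A) (bit M) (rules out) (kind_clauses inp) (seq A)
  (fun=> True) size s row W b b; try by move=> w _; case: (le_b w).
by move=> t poly_t run_t; exists t => // w _; apply: (run_t w I [::]).
Qed.

Lemma polytime_reduction : polytime reduction.
Proof.
have [t [q le_t] run_t] := run_reduction.
apply: (@stack_polytime 11 sym _ _ _ (fun a => inl (inl a)) inr reduction_cmd q).
- by move=> a a' [].
- by move=> o o' [].
by move=> w; have [s run_s out_s] := run_t w; exists s => //; apply: runs_le run_s.
Qed.

Hypotheses (inj_out : injective out) (out_blank : forall b, out b != blank M).
Variable V : seq (A + bool) -> seq bool.
Hypothesis run_V : forall x : seq (A + bool),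
  let c := iter pv.[size x]%R (@step M) (init M (map inp x)) in
  halting (current c) /\ output c = map out (V x).

(** Since the coefficients are natural numbers; the time bound for the longest certificate thus
    covers the shorter ones. *)
Lemma leq_horner (p : {poly nat}) m n : m <= n -> p.[m]%R <= p.[n]%R.
Proof.
rewrite /horner; elim: (polyseq p) => //= a s IHs le_mn.
by rewrite leq_add2r leq_mul ?IHs.
Qed.

Lemma iter_step_halted (c : config M) k : halting (current c) -> iter k (@step M) c = c.
Proof. by move=> c_halts; elim: k => //= k ->; rewrite /step c_halts. Qed.

Lemma iter_step_eq (c : config M) k k' : halting (current (iter k (@step M) c)) ->
  k <= k' -> iter k' (@step M) c = iter k (@step M) c.
Proof. by move=> c_halts /subnK <-; rewrite iterD iter_step_halted. Qed.

Lemma reduction_correct w :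
  free_flood_it 'I_4 3 (reduction w) <->
  exists u, size u <= p1.[size w]%R /\ V (map inl w ++ map inr u) = [:: true].
Proof.
have row_gt2 : 2 < size (row w) by rewrite size_first_row; lia.
have W_large : (T w).+1 * size (row w) <= W w by [].
have sizeE : (W w + size (row w) + 2) * #|bit M| = array_size (nseq (W w) tick) (row w) * #|bit M|.
  by rewrite /array_size size_nseq.
rewrite /reduction sizeE.
split=> [/(flood_satisfiable (array_cnf_size _ _ _ row_gt2)) |[u [size_u acc_u]]].
  move/(array_cnf_sat _ _ row_gt2 (wf_rules out)) => [v]; rewrite size_nseq => sat_v.
  have [|u le_u acc_u] := array_sound inj_out out_blank (ltn0Sn (T w)) W_large sat_v
    (V := fun u => V (map inl w ++ map inr u)); last by exists u.
  move=> u le_u; have [halts out_V] := run_V (map inl w ++ map inr u).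
  have le_T : (pv.[size (map inl w ++ map inr u)]%R <= T w)%N.
    by apply: leq_horner; rewrite size_cat !size_map leq_add2l.
  by rewrite /conf /input (iter_step_eq halts le_T).
apply/(flood_satisfiable (array_cnf_size _ _ _ row_gt2)).
apply/(array_cnf_sat _ _ row_gt2 (wf_rules out)); rewrite size_nseq.
exists (canonical inp w (C w) (T w).+1 u); apply: array_complete => // t.
have [] := run_V (map inl w ++ map inr u); rewrite acc_u /conf /input.
(* All the halting configurations of a run are equal, so the output known after [k] steps is also
   that of any row in which the machine has halted. *)
set k := pv.[_]%R => halts out_V halts_t; rewrite -[[:: out true]]/(map out [:: true]) -out_V; case: (leqP t k) => [le_tk|/ltnW le_kt].
  by rewrite (iter_step_eq halts_t le_tk).
by rewrite (iter_step_eq halts le_kt).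
Qed.
End HardnessReduction.

Theorem theorem5p4 : NP_hard (free_flood_it 'I_4 3).
Proof.
move=> A L [V [p1 [[M [inp [out [pv [inj_inp inp_blank inj_out out_blank run_V]]]]] L_V]]].
exists (reduction inp out p1 pv); split; first exact: polytime_reduction.
move=> w; rewrite L_V; symmetry; exact: reduction_correct.
Qed.
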